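(* Let $n\ge 2$ and let $M_{2n}$ be the Möbius ladder graph on $2n$ vertices. Then, with $k$ a nonnegative integer determined by $n$ in each case: (a) $$\operatorname{Ind}(M_{2n})\simeq \begin{cases}\mathbb{S}^{2k-1} & \text{if } n=4k,\\ \bigvee_3 \mathbb{S}^{2k} & \text{if } n=4k+2,\\ \mathbb{S}^{2k} & \text{if } n=4k+1 \text{ or } n=4k+3.\end{cases}$$ (b) If $n=2k$, then $\mathcal M_p(M_{2n})\simeq \bigvee_2 \mathbb{S}^{k-1}$. (c) If $n$ is odd, then $$\mathcal M_p(M_{2n})\simeq \begin{cases}\bigvee_4 \mathbb{S}^{2k+1} & \text{if } n=3(2k+1),\\ \bigvee_2 \mathbb{S}^{2k+2} & \text{if } n=3(2k+1)+2 \text{ or } n=3(2k+1)+4.\end{cases}$$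
   Context: The Möbius ladder graph $M_{2n}$ ($n\ge 2$) is the simple graph with vertex set $\{v_1,\dots,v_{2n}\}$ and edge set $\{v_iv_{i+1} : 1\le i\le 2n-1\}\cup\{v_1v_{2n}\}\cup\{v_jv_{j+n} : 1\le j\le n\}$. For a finite simple graph $G$, the independence complex $\operatorname{Ind}(G)$ is the simplicial complex whose faces are the independent sets of $G$ (sets of pairwise non-adjacent vertices). The perfect matching complex $\mathcal M_p(G)$ is the simplicial complex, on the edges of $G$, whose faces are the matchings of $G$ that can be extended to (are contained in) a perfect matching of $G$. $\simeq$ denotes homotopy equivalence (of geometric realizations), $\mathbb S^d$ is the $d$-sphere, and $\bigvee_r X$ is the wedge of $r$ copies of $X$. *)

(* Defs.v *)
From HB Require Import structures.
From mathcomp Require Import all_boot all_order all_algebra.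
From mathcomp Require Import all_classical all_reals all_analysis.
From mathcomp Require Import wedge_sigT zify.

Set Implicit Arguments.
Unset Strict Implicit.
Unset Printing Implicit Defensive.

Import Order.TTheory GRing.Theory Num.Theory.
Import numFieldNormedType.Exports.

Local Open Scope classical_set_scope.
Local Open Scope ring_scope.

Record sgraph (V : finType) := SGraph {
  adj : rel V;
  adj_sym : symmetric adj;
  adj_irrefl : irreflexive adj }.

Definition edges (V : finType) (G : sgraph V) : {set {set V}} :=
  [set e : {set V} | [exists x, exists y, adj G x y && (e == [set x; y]%SET)]]%SET.

(* The vertex v_{i+1} is the ordinal i; the three clauses are the edges
   v_i v_{i+1}, v_1 v_{2n} and v_j v_{j+n}, each in one orientation. *)
Definition mobius_arc (n : nat) (x y : 'I_(2 * n)) : bool :=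
  [|| x.+1 == y :> nat,
      (x == 0%N :> nat) && (y == (2 * n).-1 :> nat)
    | (x < n)%N && (y == x + n :> nat)%N].

Definition mobius_adj (n : nat) : rel 'I_(2 * n) :=
  fun x y => mobius_arc x y || mobius_arc y x.

Lemma mobius_adj_sym (n : nat) : symmetric (@mobius_adj n).
Proof. by move=> x y; rewrite /mobius_adj orbC. Qed.

Lemma mobius_adj_irrefl (n : nat) : irreflexive (@mobius_adj n).
Proof.
move=> x; rewrite /mobius_adj orbb /mobius_arc.
by apply/negbTE/negP; have := ltn_ord x; lia.
Qed.

Definition mobius_ladder (n : nat) : sgraph 'I_(2 * n) :=
  SGraph (@mobius_adj_sym n) (@mobius_adj_irrefl n).

(* Elements of V that lie in no face are not vertices of the complex. *)
Record simplicial_complex (V : finType) := SimplicialComplex {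
  faces : {set {set V}};
  faces_down : forall s t : {set V},
    s \in faces -> (t \subset s)%SET -> t \in faces }.

Definition independent (V : finType) (G : sgraph V) (s : {set V}) : bool :=
  [forall x in s, forall y in s, ~~ adj G x y].

Lemma independent_down (V : finType) (G : sgraph V) (s t : {set V}) :
  s \in [set u | independent G u]%SET -> (t \subset s)%SET ->
  t \in [set u | independent G u]%SET.
Proof.
rewrite !inE => /forall_inP sG /fintype.subsetP ts.
apply/forall_inP => x /ts /sG /forall_inP xs.
by apply/forall_inP => y /ts /xs.
Qed.

Definition independence_complex (V : finType) (G : sgraph V) :
  simplicial_complex V := SimplicialComplex (@independent_down V G).

Definition matching (V : finType) (G : sgraph V) (M : {set {set V}}) : bool :=
  (M \subset edges G)%SET && finset.trivIset M.

Definition perfect_matching (V : finType) (G : sgraph V) (M : {set {set V}}) :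
  bool := matching G M && (finset.cover M == [set: V]%SET).

Definition extendable_matching (V : finType) (G : sgraph V)
    (M : {set {set V}}) : bool :=
  matching G M && [exists P : {set {set V}}, perfect_matching G P && (M \subset P)%SET].

Lemma extendable_matching_down (V : finType) (G : sgraph V)
    (s t : {set {set V}}) :
  s \in [set M | extendable_matching G M]%SET -> (t \subset s)%SET ->
  t \in [set M | extendable_matching G M]%SET.
Proof.
rewrite !inE => /andP[/andP[sE sT] /existsP[P /andP[PG sP]]] ts.
rewrite /extendable_matching /matching (fintype.subset_trans ts sE) (finset.trivIsetS ts sT)/=.
by apply/existsP; exists P; rewrite PG (fintype.subset_trans ts sP).
Qed.

Definition perfect_matching_complex (V : finType) (G : sgraph V) :
  simplicial_complex {set V} :=
  SimplicialComplex (@extendable_matching_down V G).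

(* Barycentric coordinates; as V is finite, the subspace topology inherited
   from R^V is the usual topology of the realization. *)
Definition realization (R : realType) (V : finType) (K : simplicial_complex V) :
    topologicalType :=
  set_type [set x : {ptws V -> R} | [/\ forall v, 0 <= x v,
    \sum_(v : V) x v = 1 & [set v | x v != 0]%SET \in faces K]].

(* The norm of 'rV[R]_n is the sup norm, whence the explicit equation. *)
Definition sphere_set (R : realType) (d : nat) : set 'rV[R]_d.+1 :=
  [set x | \sum_(i < d.+1) x ord0 i ^+ 2 = 1].

Arguments sphere_set : clear implicits.

Definition sphere (R : realType) (d : nat) : topologicalType :=
  set_type (sphere_set R d).

Lemma sphere_base_proof (R : realType) (d : nat) :
  (delta_mx ord0 ord0 : 'rV[R]_d.+1) \in sphere_set R d.
Proof.
apply/mem_set; rewrite /sphere_set /= big_ord_recl big1.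
  by rewrite mxE !eqxx expr1n addr0.
by move=> i _; rewrite mxE eqxx /= expr0n.
Qed.

Definition sphere_base (R : realType) (d : nat) : sphere R d :=
  exist (fun x => x \in sphere_set R d) (delta_mx ord0 ord0) (sphere_base_proof R d).

Definition wedge_spheres (R : realType) (r d : nat) : topologicalType :=
  wedge (fun _ : 'I_r => sphere_base R d).

Definition homotopic (R : realType) (X Y : topologicalType) (f g : X -> Y) :
    Prop :=
  exists H : X * R -> Y,
    [/\ {within [set: X] `*` `[0, 1]%classic, continuous H},
        forall x, H (x, 0) = f x & forall x, H (x, 1) = g x].

Definition homotopy_equivalent (R : realType) (X Y : topologicalType) : Prop :=
  exists (f : X -> Y) (g : Y -> X),
    [/\ continuous f, continuous g,
        homotopic R (g \o f) id & homotopic R (f \o g) id].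

(* Main.v *)
(* Every complex is compared with one built from the empty complex by elementary
   expansions and a few cells of one dimension.

   Ind(M_{2n}): if a vertex w adjacent to neither x nor y has all its neighbours
   among those of x and y, adding or removing the edge xy does not change the
   homotopy type of the independence complex. Such moves turn the ladder with n + 2
   rungs into the disjoint union of a 4-cycle and the oppositely twisted ladder with
   n rungs, so its complex is the suspension of the latter, and induction leaves
   n = 2 and n = 3.

   M_p(M_{2n}): a perfect matching either is invariant under exchanging the opposite
   rails v_i v_{i+1} and v_{i+n} v_{i+n+1}, or n is odd and it is one of the two
   alternating matchings A, B of the Hamiltonian cycle v_1 ... v_{2n}. The invariant
   ones give an independence complex that folds to that of a cyclic strip; it has two
   top cells for even n and is contractible for odd n. In the latter case the
   simplices A and B meet it in independence complexes of n-cycles, and gluing them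
   amounts to coning off these two subcomplexes.

   Finally, the cone over the part built by expansions is contracted inside the
   realization; the interiors of the remaining faces are mapped to spheres by
   stereographic projection. *)
Require Import Defs.
From mathcomp Require Import all_boot zify.

Set Implicit Arguments.
Unset Strict Implicit.
Unset Printing Implicit Defensive.

(** * Expansions and independence complexes *)

(** Over the empty complex the first elementary pair consists of the empty face and a vertex;
    realized, it turns the empty space into a point. Only pairs with a nonempty smaller face give
    homotopy equivalences. Hence the spare apex: if L is built by pairs alone, joining its faces
    with a fresh vertex p turns these pairs into pairs of nonempty faces, so the cone over L can be
    added without changing the homotopy type. The cells share one cardinality so that they can be
    attached together, with boundaries inside L; once the cone over L is contracted, only their
    number matters. Toggling edges both adds and removes faces, so a ladder is not presented as an
    [attach] construction but as the end of a chain of expansions and collapses, which [sph]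
    records. The chain stays inside one vertex set so that the apex remains fresh throughout. A
    ladder step exchanges the straight and the twisted ladder, so the twist returns after two steps,
    which produces the period four in n. *)

Definition down_closed (V : finType) (K : {set {set V}}) :=
  forall s t : {set V}, s \in K -> t \subset s -> t \in K.

Section Expansions.
Variable V : finType.
Implicit Types (K L M F : {set {set V}}) (s t : {set V}) (u v p : V).

(* [K] arises from [K0] by adding elementary pairs [s, v |: s] (expansions) and
   [r] faces with [c] elements: over [K0 = set0], discrete Morse theory gives a
   wedge of [r] spheres of dimension [c - 1]. *)
Inductive attach (c : nat) K0 : nat -> {set {set V}} -> Prop :=
| attach_refl : attach c K0 0 K0
| attach_pair r K s v : attach c K0 r K -> v \notin s -> s \notin K ->
    (forall t, t \proper v |: s -> t != s -> t \in K) ->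
    attach c K0 r (s |: ((v |: s) |: K))
| attach_cell r K s : attach c K0 r K -> s \notin K -> #|s| = c ->
    (forall t, t \proper s -> t \in K) ->
    attach c K0 r.+1 (s |: K).

Definition join1 p K := [set p |: t | t in K].

Lemma attach_trans c K0 r K1 r' K2 :
  attach c K0 r K1 -> attach c K1 r' K2 -> attach c K0 (r + r') K2.
Proof.
move=> K01; elim=> [|r1 K s v _ IH vs sK fK|r1 K s _ IH sK cs fK].
- by rewrite addn0.
- exact: attach_pair.
- by rewrite addnS; apply: attach_cell.
Qed.

Lemma attach_sub c K0 r K : attach c K0 r K -> K0 \subset K.
Proof.
elim=> // [r1 {}K s v _ IH _ _ _|r1 {}K s _ IH _ _ _].
  by rewrite (subset_trans IH) // setUA subsetUr.
by rewrite (subset_trans IH) // subsetUr.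
Qed.

Lemma down_closed_pair K s v : down_closed K -> v \notin s ->
  (forall t, t \proper v |: s -> t != s -> t \in K) ->
  down_closed (s |: ((v |: s) |: K)).
Proof.
move=> dK vs fK x t.
have sub : t \subset v |: s -> t \in s |: ((v |: s) |: K).
  move=> tvs; rewrite !inE; have [//|ts] := eqVneq t s.
  have [//|tvs'] := eqVneq t (v |: s).
  by rewrite fK // properEneq tvs'.
rewrite [x \in _]inE => /orP[/set1P ->|/setU1P[->|xK]] tx.
- by apply: sub; rewrite (subset_trans tx) // subsetUr.
- exact: sub.
- by rewrite !inE (dK _ _ xK tx) !orbT.
Qed.

Lemma attach_down_closed c K0 r K :
  down_closed K0 -> attach c K0 r K -> down_closed K.
Proof.
move=> dK0; elim=> // [r1 {}K s v _ IH vs _ fK|r1 {}K s _ IH _ _ fK].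
  exact: down_closed_pair.
move=> x t; rewrite !inE => /predU1P[->|xK] tx; last by rewrite (IH _ _ xK tx) orbT.
by have [//|ts] := eqVneq t s; rewrite fK // properEneq ts.
Qed.

Lemma down_closed0 : down_closed (set0 : {set {set V}}).
Proof. by move=> s t; rewrite inE. Qed.

Lemma down_closedU K L : down_closed K -> down_closed L -> down_closed (K :|: L).
Proof.
by move=> dK dL s t; rewrite !in_setU => /orP[/dK h /h ->|/dL h /h ->]; rewrite ?orbT.
Qed.

Lemma down_closedI K L : down_closed K -> down_closed L -> down_closed (K :&: L).
Proof.
move=> dK dL s t; rewrite !in_setI => /andP[sK sL] ts.
by rewrite (dK _ _ sK ts) (dL _ _ sL ts).
Qed.

Lemma down_closed_powerset s : down_closed (powerset s).
Proof. by move=> t t'; rewrite !powersetE => ts /subset_trans; exact. Qed.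

Lemma setD1_id u s : u \notin s -> s :\ u = s.
Proof.
move=> us; apply/setP => x; rewrite !inE.
by have [->|] := eqVneq x u; rewrite ?(negbTE us).
Qed.

Lemma down_closed_join p M L : down_closed M -> down_closed L -> L \subset M ->
  down_closed (M :|: join1 p L).
Proof.
move=> dM dL /subsetP LM s t; rewrite !in_setU => /orP[/dM h /h -> //|].
move=> /imsetP[x xL ->] tx; have tL : t :\ p \in L.
  by apply: dL xL _; rewrite subDset.
have [pt|pt] := boolP (p \in t); last by rewrite -(setD1_id pt) LM.
by apply/orP; right; apply/imsetP; exists (t :\ p); rewrite ?setD1K.
Qed.

(** Only cells mention [c], so without cells it can be changed freely. *)
Lemma attach_card c c' K0 r K : attach c K0 r K -> r = 0 -> attach c' K0 0 K.
Proof.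
elim=> // [|r1 {}K s v _ IH vs sK fK r0]; first by move=> _; exact: attach_refl.
exact: attach_pair (IH r0) vs sK fK.
Qed.

Lemma proper_join p v s t : p \notin v |: s -> t \proper p |: (v |: s) ->
  t != p |: s -> p \in t -> (t :\ p \proper v |: s) && (t :\ p != s).
Proof.
move=> pvs; rewrite properE => /andP[tp np] ts pt; rewrite properE.
apply/andP; split; [apply/andP; split|].
- by rewrite subDset.
- by apply: contra np => h; rewrite -(setD1K pt) setUS.
- by apply: contra_neq ts => <-; rewrite setD1K.
Qed.

(** Adding [p] turns every pair of [L] into a pair and every cell into a cell with one more element.
    The boundary faces that avoid [p] are available because they lie in [M]. *)
Lemma attach_join c M p r L : attach c set0 r L -> L \subset M ->
  (forall t, t \in M -> p \notin t) -> attach c.+1 M r (M :|: join1 p L).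
Proof.
move=> + + pM; elim=> [|r1 K s v K0 IH vs sK fK|r1 K s K0 IH sK cs fK] LM.
- by rewrite /join1 imset0 setU0; exact: attach_refl.
- have sM : s \in M by rewrite (subsetP LM) // !inE eqxx.
  have vsM : v |: s \in M by rewrite (subsetP LM) // !inE eqxx orbT.
  have KM : K \subset M by apply: subset_trans LM; rewrite setUA subsetUr.
  have pvs := pM _ vsM.
  have dM : down_closed K by apply: attach_down_closed K0; exact: down_closed0.
  have -> : M :|: join1 p (s |: ((v |: s) |: K)) =
    (p |: s) |: ((v |: (p |: s)) |: (M :|: join1 p K)).
    rewrite /join1 !imsetU !imset_set1 [v |: (p |: s)]setUCA.
    by rewrite [M :|: _]setUCA [M :|: (_ :|: _)]setUCA.
  apply: attach_pair; first exact: IH.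
  + by rewrite !inE negb_or vs andbT; apply: contraNneq pvs => ->; rewrite !inE eqxx.
  + rewrite inE negb_or; apply/andP; split.
      by apply/negP => /pM; rewrite !inE eqxx.
    apply/imsetP => -[t tK pst]; case/negP: sK.
    have pt : p \notin t by apply: pM; exact: (subsetP KM).
    suff -> : s = t by [].
    by rewrite -(setU1K pt) -pst setU1K //; exact: pM.
  + move=> t; rewrite [v |: (p |: s)]setUCA => tp ts; rewrite inE.
    have [pt|pt] := boolP (p \in t).
      have /andP[t1 t2] := proper_join pvs tp ts pt.
      apply/orP; right; apply/imsetP; exists (t :\ p); last by rewrite setD1K.
      exact: fK.
    apply/orP; left; have tvs : t \subset v |: s.
      apply/subsetP => x xt; have := subsetP (proper_sub tp) _ xt.
      by rewrite in_setU1 => /predU1P[xp|//]; rewrite xp in xt; rewrite xt in pt.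
    have [->//|ts'] := eqVneq t s; have [->//|tvs'] := eqVneq t (v |: s).
    by apply: (subsetP KM); apply: fK => //; rewrite properEneq tvs'.
- have sM : s \in M by rewrite (subsetP LM) // !inE eqxx.
  have KM : K \subset M by apply: subset_trans LM; rewrite subsetUr.
  have ps := pM _ sM.
  have -> : M :|: join1 p (s |: K) = (p |: s) |: (M :|: join1 p K).
    by rewrite /join1 imsetU imset_set1 setUCA.
  apply: attach_cell; first exact: IH.
  + rewrite inE negb_or; apply/andP; split.
      by apply/negP => /pM; rewrite !inE eqxx.
    apply/imsetP => -[t tK pst]; case/negP: sK.
    have pt : p \notin t by apply: pM; exact: (subsetP KM).
    suff -> : s = t by [].
    by rewrite -(setU1K pt) -pst setU1K.
  + by rewrite cardsU1 ps cs.
  + move=> t tp; rewrite inE; have [pt|pt] := boolP (p \in t).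
      apply/orP; right; apply/imsetP; exists (t :\ p); last by rewrite setD1K.
      apply: fK; rewrite properE subDset (proper_sub tp) /=.
      by apply: contra (proper_subn tp) => h; rewrite -(setD1K pt) setUS.
    apply/orP; left; have ts : t \subset s.
      apply/subsetP => x xt; have := subsetP (proper_sub tp) _ xt.
      by rewrite in_setU1 => /predU1P[xp|//]; rewrite xp in xt; rewrite xt in pt.
    have [->//|ts'] := eqVneq t s.
    by apply: (subsetP KM); apply: fK; rewrite properEneq ts'.
Qed.

(** More faces at the start only enlarge the supply of boundary faces; disjointness keeps the later
    faces new. *)
Lemma attach_union c K0 r K (S : {set {set V}}) : attach c K0 r K -> [disjoint S & K] ->
  attach c (K0 :|: S) r (K :|: S).
Proof.
elim=> [|r1 {}K s v _ IH vs sK fK|r1 {}K s _ IH sK cs fK] dS.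
- exact: attach_refl.
- have dK : [disjoint S & K].
    by apply: disjointWr dS; rewrite setUA subsetUr.
  rewrite -!setUA; apply: attach_pair => //; first exact: IH.
    by rewrite inE negb_or sK (disjointFl dS) // !inE eqxx.
  by move=> t tp ts; rewrite inE fK.
- have dK : [disjoint S & K] by apply: disjointWr dS; rewrite subsetUr.
  rewrite -!setUA; apply: attach_cell => //; first exact: IH.
    by rewrite inE negb_or sK (disjointFl dS) // !inE eqxx.
  by move=> t tp; rewrite inE fK.
Qed.

(* A face of cardinal [c] can be attached after everything of smaller cardinal
   and before the rest. *)
Lemma attach_reorder c r K : attach c set0 r K -> exists L F,
  [/\ attach c set0 0 L, #|F| = r,
      forall s, s \in F -> [/\ #|s| = c, s \notin L & forall t, t \proper s -> t \in L] &
      attach c (L :|: F) 0 K].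
Proof.
move=> K0.
(* The induction also carries that every face of [K] with fewer than [c] elements lies in [L]: this
   supplies the boundaries of later cells and of later small pairs. *)
suff [L [F [hL hF hc hK LK]]] : exists L F,
  [/\ attach c set0 0 L, #|F| = r,
      forall s, s \in F -> [/\ #|s| = c, s \notin L & forall t, t \proper s -> t \in L],
      attach c (L :|: F) 0 K &
      forall t, t \in K -> #|t| < c -> t \in L] by exists L, F.
elim: K0 => [|r1 {}K s v K0 [L [F [hL hF hc hK LK]]] vs sK fK
             |r1 {}K s K0 [L [F [hL hF hc hK LK]]] sK cs fK].
- exists set0, set0; split; rewrite ?cards0 ?setU0 //; try exact: attach_refl.
  by move=> s; rewrite inE.
- have dK := attach_down_closed down_closed0 K0.
  have vsK : v |: s \notin K by apply: contra sK => h; apply: dK h _; rewrite subsetUr.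
  have LFK := attach_sub hK.
  have cvs : #|v |: s| = #|s|.+1 by rewrite cardsU1 vs.
  (* A pair whose smaller face has at least [c] elements goes after the cells. Otherwise it goes
     before them: the other proper faces of [v |: s] have fewer than [c] elements and are in [L] by
     the invariant. *)
  have [sc|sc] := leqP c #|s|.
    exists L, F; split=> //; first exact: attach_pair.
    move=> t; rewrite !inE => /or3P[/eqP ->|/eqP ->|]; last exact: LK.
      by lia.
    by rewrite cvs; lia.
  exists (s |: ((v |: s) |: L)), F; split=> //.
  + apply: attach_pair => //.
      by apply: contra sK => sL; rewrite (subsetP LFK) // inE sL.
    move=> t tp ts; apply: LK; first exact: fK.
    by have := proper_card tp; lia.
  + move=> u uF; have [cu uL fu] := hc u uF; split=> //.
      rewrite !inE !negb_or uL andbT; apply/andP; split.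
        by apply: contraTneq sc => <-; rewrite cu ltnn.
      by apply: contraNneq vsK => <-; rewrite (subsetP LFK) // inE uF orbT.
    by move=> t /fu tL; rewrite !inE tL !orbT.
  + have -> : s |: ((v |: s) |: L) :|: F = (L :|: F) :|: [set s; v |: s].
      apply/setP => x; rewrite !inE; case: (x == s); case: (x == _);
      by case: (x \in L); case: (x \in F).
    have -> : s |: ((v |: s) |: K) = K :|: [set s; v |: s] by rewrite setUA setUC.
    apply: attach_union => //; rewrite disjoint_sym.
    by rewrite disjoint_subset; apply/subsetP => t tK; rewrite !inE; apply/norP; split;
      [apply: contraNneq sK|apply: contraNneq vsK] => <-.
  + move=> t; rewrite !inE => /or3P[->//|->|tK tc]; first by rewrite orbT.
    by rewrite (LK t) ?orbT.
- have LFK := attach_sub hK.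
  exists L, (s |: F); split=> //.
  + rewrite cardsU1 (_ : s \notin F) ?hF //.
    by apply: contra sK => sF; rewrite (subsetP LFK) // inE sF orbT.
  + move=> u; rewrite !inE => /predU1P[->|/hc//]; split=> //.
      by apply: contra sK => sL; rewrite (subsetP LFK) // inE sL.
    move=> t tp; apply: LK; first exact: fK.
    by have := proper_card tp; lia.
  + have -> : L :|: (s |: F) = (L :|: F) :|: [set s] by rewrite [s |: F]setUC setUA.
    rewrite [s |: K]setUC; apply: attach_union => //.
    by rewrite disjoints1.
  + move=> t; rewrite !inE => /predU1P[->|]; last exact: LK.
    by rewrite cs ltnn.
Qed.

(* Toggling [p] matches the faces of [K2] outside [K1] in pairs. *)
Definition cone_step p K1 K2 := [/\ down_closed K1, down_closed K2, K1 \subset K2 &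
  forall t, t \in K2 -> t \notin K1 -> p |: t \in K2 /\ t :\ p \notin K1].

(** A largest face t of [K2] outside [K1] contains [p], and the only faces of [K2] above [t :\ p]
    are [t :\ p] and t. This pair can therefore be attached last, and induction on the size of [K2]
    treats the rest. *)
Lemma cone_step_attach c p K1 K2 : cone_step p K1 K2 -> attach c K1 0 K2.
Proof.
move: {2}#|_| (leqnn #|K2|) => m; elim: m K2 => [|m IH] K2 cK [dK1 dK2 K12 pK].
  have K20 : K2 = set0 by apply/eqP; rewrite -cards_eq0 -leqn0.
  by move: K12; rewrite K20 subset0 => /eqP ->; exact: attach_refl.
have [->|] := eqVneq K1 K2; first exact: attach_refl.
rewrite eqEsubset K12 /= => /subsetPn[t0 t0K2 t0K1].
pose P t := (t \in K2) && (t \notin K1).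
have P0 : P t0 by rewrite /P t0K2.
case: (@arg_maxnP _ t0 P (fun t => #|t|) P0) => t /andP[tK2 tK1] tmax.
have inK1 (x y : {set V}) : x \subset y -> x \notin K1 -> y \notin K1.
  by move=> xy; apply: contra => yK; exact: dK1 yK xy.
have big x : x \in K2 -> t \subset x -> x = t.
  move=> xK tx; have Px : P x by rewrite /P xK (inK1 t).
  by apply/esym/eqP; rewrite eqEcard tx; exact: tmax.
have [ptK2 tpK1] := pK t tK2 tK1.
have pt : p \in t by rewrite -(big _ ptK2 (subsetUr _ _)) !inE eqxx.
set s := t :\ p in tpK1.
have pst : p |: s = t by rewrite setD1K.
have ps : p \notin s by rewrite !inE eqxx.
have sK2 : s \in K2 by apply: dK2 tK2 _; exact: subsetDl.
pose K2' := K2 :\ s :\ t.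
have bigs x : x \in K2 -> s \subset x -> x = s \/ x = t.
  move=> xK sx; have [px|px] := boolP (p \in x).
    by right; apply: big => //; rewrite -pst subUset sub1set px.
  left; have xK1 : x \notin K1 by apply: inK1 sx tpK1.
  have [pxK _] := pK x xK xK1.
  by rewrite -(setU1K px) (big _ pxK) // -pst setUS.
have E : K2 = s |: ((p |: s) |: K2').
  rewrite pst /K2' setD1K ?setD1K // !inE tK2 andbT.
  by apply: contraTneq pt => ->.
rewrite [X in attach _ _ _ X]E; apply: attach_pair => //.
- apply: IH.
    have : #|K2'| < #|K2|; last by move: cK; lia.
    apply: proper_card; apply/properP; split.
      by rewrite (subset_trans (subsetDl _ _)) // subsetDl.
    by exists s => //; rewrite !inE eqxx andbF.
  split=> //.
  + move=> x y; rewrite !inE => /and3P[xt xs xK] yx.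
    have yK := dK2 _ _ xK yx; rewrite yK andbT; apply/andP; split.
      by apply: contra_neq xt => yt; apply: big; rewrite -?yt.
    apply/eqP => ys; rewrite ys in yx; case: (bigs x xK yx) => h.
      by rewrite h eqxx in xs.
    by rewrite h eqxx in xt.
  + apply/subsetP => x xK; rewrite !inE (subsetP K12) // andbT.
    by apply/andP; split; [apply: contraNneq tK1|apply: contraNneq tpK1] => <-.
  + move=> x; rewrite !inE => /and3P[xt xs xK] xK1.
    have [pxK xpK] := pK x xK xK1; split=> //; rewrite pxK andbT.
    apply/andP; split; last first.
      by apply: contraTneq (setU11 p x) => ->.
    apply/eqP => pxt; have sx : s \subset x.
      apply/subsetP => y; rewrite inE -pxt !inE.
      by move=> /andP[/negbTE ->].
    by case: (bigs x xK sx) => h; rewrite h eqxx in xs xt.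
- by rewrite !inE eqxx andbF.
- move=> x; rewrite pst => xt xs; rewrite !inE xs (dK2 _ _ tK2 (proper_sub xt)).
  by rewrite (proper_neq xt).
Qed.

(** The suspension of [K], as the union of two cones over [K]. *)
Definition susp u u' K := K :|: (join1 u K :|: join1 u' K).

(* [K] is linked to an [attach]-built wedge of [r] spheres by expansions and
   collapses inside the simplex [A]; a vertex outside [A] stays available as the
   apex used in [sph_geo]. *)
Inductive sph (A : {set V}) (c r : nat) : {set {set V}} -> Prop :=
| sph_attach K : K \subset powerset A -> attach c set0 r K -> sph A c r K
| sph_expand p K1 K2 : K2 \subset powerset A -> set0 \in K1 ->
    cone_step p K1 K2 -> sph A c r K1 -> sph A c r K2
| sph_collapse p K1 K2 : K2 \subset powerset A -> set0 \in K1 ->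
    cone_step p K1 K2 -> sph A c r K2 -> sph A c r K1.

Lemma in_susp u u' K t : (forall x, x \in K -> (u \notin x) && (u' \notin x)) ->
  u != u' -> (t \in susp u u' K) =
  (t :\ u :\ u' \in K) && ~~ ((u \in t) && (u' \in t)).
Proof.
move=> fr uu'; rewrite !inE; apply/idP/idP.
  case/or3P => [tK|/imsetP[x xK ->]|/imsetP[x xK ->]].
  - by have /andP[ut u't] := fr t tK; rewrite (setD1_id ut) (setD1_id u't) tK (negbTE ut).
  - have /andP[ux u'x] := fr x xK; rewrite setU1K // setD1_id //.
    by rewrite xK !inE eqxx (negbTE u'x) eq_sym (negbTE uu').
  - have /andP[ux u'x] := fr x xK.
    rewrite (@setD1_id u (u' |: x)); last by rewrite !inE negb_or uu'.
    by rewrite setU1K // xK !inE eqxx (negbTE ux) (negbTE uu').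
move=> /andP[tK]; have [ut|ut] := boolP (u \in t) => /= [u't|_].
  apply/or3P/Or32/imsetP; exists (t :\ u); last by rewrite setD1K.
  by move: tK; rewrite [t :\ u :\ u']setD1_id // !inE (negbTE u't) andbF.
rewrite (setD1_id ut) in tK; have [u't|u't] := boolP (u' \in t).
  by apply/or3P/Or33/imsetP; exists (t :\ u') => //; rewrite setD1K.
by rewrite (setD1_id u't) in tK; rewrite tK.
Qed.

Lemma susp_down_closed u u' K : down_closed K ->
  (forall x, x \in K -> (u \notin x) && (u' \notin x)) -> u != u' ->
  down_closed (susp u u' K).
Proof.
move=> dK fr uu' s t; rewrite !in_susp // => /andP[sK nus] ts.
rewrite (dK _ _ sK) ?setSD //; apply: contra nus => /andP[ut u't].
by rewrite !(subsetP ts).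
Qed.

Lemma susp_powerset u u' (A : {set V}) K : K \subset powerset A ->
  susp u u' K \subset powerset (u |: (u' |: A)).
Proof.
move=> /subsetP KA; apply/subsetP => t; rewrite !inE.
case/or3P => [/KA|/imsetP[x /KA]|/imsetP[x /KA]]; rewrite inE => h.
- by rewrite setUA (subset_trans h) // subsetUr.
- by move->; rewrite setUS // (subset_trans h) // subsetUr.
- by move->; rewrite setUCA setUS // (subset_trans h) // subsetUr.
Qed.

(** Where something is matched, [p] lies in [A] and the apexes do not, so toggling [p] commutes with
    removing them. *)
Lemma susp_cone_step u u' p (A : {set V}) K1 K2 : u != u' -> u \notin A ->
  u' \notin A -> K2 \subset powerset A -> cone_step p K1 K2 ->
  cone_step p (susp u u' K1) (susp u u' K2).
Proof.
move=> uu' uA u'A /subsetP KA [dK1 dK2 /subsetP K12 pK].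
have fr2 x : x \in K2 -> (u \notin x) && (u' \notin x).
  move=> /KA; rewrite inE => /subsetP xA.
  by apply/andP; split; [apply: contra uA|apply: contra u'A]; exact: xA.
have fr1 x : x \in K1 -> (u \notin x) && (u' \notin x) by move/K12/fr2.
split; try exact: susp_down_closed.
  apply/subsetP => t; rewrite !in_susp // => /andP[tK ->].
  by rewrite K12.
move=> t; rewrite !in_susp // => /andP[tK2 ut]; rewrite ut andbT => tK1.
have [ptK2 tpK1] := pK _ tK2 tK1.
have pA : p \in A by have := KA _ ptK2; rewrite inE => /subsetP; apply; rewrite setU11.
have pu : p != u by apply: contraNneq uA => <-.
have pu' : p != u' by apply: contraNneq u'A => <-.
have E1 : (p |: t) :\ u :\ u' = p |: (t :\ u :\ u').
  apply/setP => x; rewrite !inE; have [->|] := eqVneq x p; rewrite ?pu ?pu' //.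
have E2 : t :\ p :\ u :\ u' = t :\ u :\ u' :\ p.
  by apply/setP => x; rewrite !inE; case: (x == p); case: (x == u); case: (x == u').
split; first by rewrite E1 ptK2 !inE !(eq_sym _ p) (negbTE pu) (negbTE pu').
by rewrite E2 (negbTE tpK1).
Qed.

(** Toggling the apex of a cone matches all faces, the empty one included. *)
Lemma cone_attach c p K : down_closed K -> (forall t, t \in K -> p |: t \in K) ->
  attach c set0 0 K.
Proof.
move=> dK pK; apply: (@cone_step_attach c p); split=> //.
- exact: down_closed0.
- exact: sub0set.
- by move=> t tK _; rewrite inE; split=> //; exact: pK.
Qed.

(** The first cone needs no cells at all; the second one repeats the construction of [K] with [u']
    added, whence the same number of cells one dimension up. *)
Lemma attach_susp c r K u u' : attach c set0 r K -> u != u' ->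
  (forall x, x \in K -> (u \notin x) && (u' \notin x)) ->
  attach c.+1 set0 r (susp u u' K).
Proof.
move=> K0 uu' fr; have dK := attach_down_closed down_closed0 K0.
rewrite /susp setUA -[r]add0n.
have C : attach c.+1 set0 0 (K :|: join1 u K).
  apply: (@cone_attach _ u).
    exact: down_closed_join.
  move=> t; rewrite !inE => /orP[tK|/imsetP[x xK ->]]; apply/orP; right.
    exact: imset_f.
  by rewrite setUA setUid imset_f.
apply: (attach_trans C); apply: (attach_join K0); first exact: subsetUl.
move=> t; rewrite !inE => /orP[/fr/andP[]//|/imsetP[x /fr/andP[ux u'x] ->]].
by rewrite !inE negb_or u'x eq_sym uu'.
Qed.

Lemma sph_susp A c r K u u' : sph A c r K -> u != u' -> u \notin A -> u' \notin A ->
  sph (u |: (u' |: A)) c.+1 r (susp u u' K).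
Proof.
move=> sK uu' uA u'A; elim: sK => [{}K KA K0|p K1 K2 K2A K10 st _ IH|p K1 K2 K2A K10 st _ IH].
- apply: sph_attach; first exact: susp_powerset.
  apply: attach_susp => // x /(subsetP KA); rewrite inE => /subsetP xA.
  by apply/andP; split; [apply: contra uA|apply: contra u'A]; exact: xA.
- apply: (@sph_expand _ _ _ p) IH; [exact: susp_powerset|by rewrite inE K10|].
  exact: (@susp_cone_step _ _ _ A).
- apply: (@sph_collapse _ _ _ p) IH; [exact: susp_powerset|by rewrite inE K10|].
  exact: (@susp_cone_step _ _ _ A).
Qed.

End Expansions.

(** * Independence complexes: deletion and link, folding, suspension, edge toggling *)

Section IndependentSets.
Variables (V : finType).
Implicit Types (A : {set V}) (e : rel V) (u v w : V) (t : {set V}).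

(** The vertex set is a subset [A] of a fixed type, so that deletions, links and graphs of different
    sizes give complexes over the same type. *)
Definition indep A e : {set {set V}} :=
  [set t : {set V} | (t \subset A) && [forall x in t, forall y in t, ~~ e x y]].

Lemma indepP A e t : reflect (t \subset A /\ {in t &, forall x y, ~~ e x y})
  (t \in indep A e).
Proof.
rewrite inE; apply: (iffP andP) => -[tA h]; split=> //.
  by move=> x y xt yt; have /forall_inP/(_ _ xt)/forall_inP/(_ _ yt) := h.
by apply/forall_inP => x xt; apply/forall_inP => y; exact: h.
Qed.

Lemma indep_down_closed A e : down_closed (indep A e).
Proof.
move=> s t /indepP[sA es] ts; apply/indepP; split.
  exact: subset_trans ts sA.
by move=> x y xt yt; apply: es; exact: (subsetP ts).
Qed.

Lemma indep_powerset A e : indep A e \subset powerset A.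
Proof. by apply/subsetP => t /indepP[tA _]; rewrite inE. Qed.

Lemma indep_set0 A e : set0 \in indep A e.
Proof. by apply/indepP; rewrite sub0set; split=> // x y; rewrite inE. Qed.

Lemma eq_indep A A' e e' : A = A' -> {in A &, e =2 e'} -> indep A e = indep A' e'.
Proof.
move=> <- ee'; apply/setP => t; apply/indepP/indepP => -[tA h]; split=> // x y xt yt.
  by rewrite -ee' ?(subsetP tA) ?h.
by rewrite ee' ?(subsetP tA) ?h.
Qed.

Lemma indep_mono A A' e e' : A \subset A' -> {in A &, subrel e' e} ->
  indep A e \subset indep A' e'.
Proof.
move=> AA' ee'; apply/subsetP => t /indepP[tA h]; apply/indepP; split.
  exact: subset_trans AA'.
by move=> x y xt yt; apply: contra (h x y xt yt); apply: ee'; exact: (subsetP tA).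
Qed.

Lemma indep_U1 A e u t : symmetric e -> irreflexive e -> u \in A ->
  t \in indep A e -> {in t, forall x, ~~ e u x} -> u |: t \in indep A e.
Proof.
move=> se ie uA /indepP[tA h] ut; apply/indepP; split.
  by rewrite subUset sub1set uA.
move=> x y; rewrite !inE => /predU1P[->|xt] /predU1P[->|yt].
- by rewrite ie.
- exact: ut.
- by rewrite se; exact: ut.
- exact: h.
Qed.

(** The complex whose only face is empty plays the sphere of dimension -1: the empty face is a cell
    with no elements. *)
Lemma indep_no_vertices e : attach 0 set0 1 (indep set0 e).
Proof.
have -> : indep set0 e = set0 |: set0.
  apply/setP => t; rewrite setU0 !inE subset0; case: eqP => // ->.
  by rewrite -[RHS]/true; apply/forall_inP => x; rewrite inE.
apply: attach_cell; [exact: attach_refl|by rewrite inE|exact: cards0|].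
by move=> t; rewrite properE sub0set andbF.
Qed.

Lemma indep_cone c A e w : symmetric e -> irreflexive e -> w \in A ->
  {in A, forall x, ~~ e w x} -> attach c set0 0 (indep A e).
Proof.
move=> se ie wA h; apply: (@cone_attach _ c w); first exact: indep_down_closed.
move=> t tA; apply: indep_U1 => // x xt; apply: h.
by have /indepP[/subsetP h' _] := tA; exact: h'.
Qed.

(** The faces containing [v] form the join of [v] with the link, which consists of the independent
    sets avoiding [v] and its neighbours. A cell of the link gains [v], hence the shift of [c]. *)
Lemma indep_split c r r' A e v : symmetric e -> irreflexive e -> v \in A ->
  attach c.+1 set0 r (indep (A :\ v) e) ->
  attach c set0 r' (indep [set x in A | (x != v) && ~~ e v x] e) ->
  attach c.+1 set0 (r + r') (indep A e).
Proof.
move=> se ie vA del lk.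
have -> : indep A e = indep (A :\ v) e :|:
    join1 v (indep [set x in A | (x != v) && ~~ e v x] e).
  apply/setP => t; rewrite in_setU; apply/idP/orP => [tA|[|/imsetP[s sA ->]]].
  - have /indepP[tA' h] := tA; have [vt|vt] := boolP (v \in t); last first.
      by left; apply/indepP; rewrite subsetD1 tA'.
    right; apply/imsetP; exists (t :\ v); last by rewrite setD1K.
    apply/indepP; split.
      apply/subsetP => x; rewrite !inE => /andP[xv xt].
      by rewrite (subsetP tA') // xv h.
    by move=> x y; rewrite !inE => /andP[_ xt] /andP[_ yt]; exact: h.
  - by apply/subsetP/indep_mono => //; exact: subsetDl.
  - apply: indep_U1 => //.
      apply: (subsetP _ _ sA); apply: indep_mono => //.
      by apply/subsetP => x; rewrite inE => /andP[].
    by move=> x xs; have /indepP[/subsetP/(_ _ xs)] := sA; rewrite inE => /and3P[].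
apply: (attach_trans del); apply: (attach_join lk).
  by apply: indep_mono => //; apply/subsetP => x; rewrite !inE => /and3P[-> ->].
by move=> t /indepP[/subsetP tA _]; apply/negP => /tA; rewrite !inE eqxx.
Qed.

(** A face lost by deleting [v] contains [v], so it avoids the neighbours of [v] and thereby those
    of [u]: toggling [u] is always possible. *)
Lemma fold_cone_step A e u v : symmetric e -> irreflexive e -> u \in A -> v \in A ->
  u != v -> ~~ e u v -> {in A, forall x, e u x -> e v x} ->
  cone_step u (indep (A :\ v) e) (indep A e).
Proof.
move=> se ie uA vA uv euv euev; split; try exact: indep_down_closed.
  by apply: indep_mono => //; exact: subsetDl.
move=> t tA tv; have vt : v \in t.
  apply: contraR tv => vt; have /indepP[tA' h] := tA.
  by apply/indepP; rewrite subsetD1 tA'.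
have /indepP[tA' h] := tA; split.
  apply: indep_U1 => // x xt; apply: contra (h v x vt xt).
  by apply: euev; exact: (subsetP tA').
apply/indepP => -[/subsetP/(_ v)]; rewrite !inE vt eqxx eq_sym uv.
by move/(_ isT).
Qed.

Lemma indep_fold c r A e u v : symmetric e -> irreflexive e -> u \in A -> v \in A ->
  u != v -> ~~ e u v -> {in A, forall x, e u x -> e v x} ->
  attach c set0 r (indep (A :\ v) e) -> attach c set0 r (indep A e).
Proof.
move=> se ie uA vA uv euv euev del; rewrite -[r]addn0.
apply: (attach_trans del); apply: (@cone_step_attach _ c u).
exact: fold_cone_step.
Qed.

(** The complex of a separate edge is two points, and the join with two points is the suspension. *)
Lemma indep_susp A e u u' : symmetric e -> irreflexive e -> u \notin A -> u' \notin A ->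
  e u u' -> {in A, forall x, ~~ e u x && ~~ e u' x} ->
  indep (u |: (u' |: A)) e = susp u u' (indep A e).
Proof.
move=> se ie uA u'A euu' eA.
have uu' : u != u' by apply: contraTneq euu' => ->; rewrite ie.
have fr x : x \in indep A e -> (u \notin x) && (u' \notin x).
  move=> /indepP[/subsetP xA _].
  by apply/andP; split; [apply: contra uA|apply: contra u'A]; exact: xA.
apply/setP => t; rewrite in_susp //; apply/indepP/andP => -[].
  move=> tA h; split; last first.
    by apply/negP => /andP[ut u't]; have := h _ _ ut u't; rewrite euu'.
  apply/indepP; split; last first.
    by move=> x y; rewrite !inE => /and3P[_ _ xt] /and3P[_ _ yt]; exact: h.
  apply/subsetP => x; rewrite !inE => /and3P[xu' xu xt].
  by have := subsetP tA _ xt; rewrite !inE (negbTE xu) (negbTE xu').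
move=> /indepP[tA h] nuu'; split.
  apply/subsetP => x xt; rewrite !inE; have [//|xu] := eqVneq x u.
  by have [//|xu'] := eqVneq x u'; rewrite (subsetP tA) // !inE xu xu'.
have inA x : x \in t -> x != u -> x != u' -> x \in t :\ u :\ u'.
  by move=> xt xu xu'; rewrite !inE xu xu'.
have sub x y : x \in t -> y \in t -> (x == u) || (x == u') -> ~~ e x y.
  move=> xt yt xuu'.
  have [yu|yu] := eqVneq y u; have [xu|xu] := eqVneq x u; subst; rewrite ?ie //.
  - by move: xuu' => /=; rewrite (negbTE xu) => /eqP xu'; subst; rewrite xt yt in nuu'.
  - have [yu'|yu'] := eqVneq y u'; first by subst; rewrite xt yt in nuu'.
    by have /eA/andP[] := subsetP tA _ (inA _ yt yu yu').
  - move: xuu' => /=; rewrite (negbTE xu) => /eqP xu'; subst.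
    have [->|yu'] := eqVneq y u'; first by rewrite ie.
    by have /eA/andP[] := subsetP tA _ (inA _ yt yu yu').
move=> x y xt yt; have [xuu'|] := boolP ((x == u) || (x == u')); first exact: sub.
rewrite negb_or => /andP[xu xu'].
have [yuu'|] := boolP ((y == u) || (y == u')); first by rewrite se; exact: sub.
by rewrite negb_or => /andP[yu yu']; apply: h; exact: inA.
Qed.

Lemma indep_susp_attach c r A e u u' : symmetric e -> irreflexive e ->
  u \notin A -> u' \notin A ->
  e u u' -> {in A, forall x, ~~ e u x && ~~ e u' x} ->
  attach c set0 r (indep A e) -> attach c.+1 set0 r (indep (u |: (u' |: A)) e).
Proof.
move=> se ie uA u'A euu' eA h; rewrite indep_susp //.
apply: attach_susp => //; first by apply: contraTneq euu' => ->; rewrite ie.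
move=> x /indepP[/subsetP xA _].
by apply/andP; split; [apply: contra uA|apply: contra u'A]; exact: xA.
Qed.

(* The independent sets containing both ends of the new edge are matched by
   toggling [w]. *)
Lemma edge_cone_step A e1 e2 w x y : symmetric e1 -> irreflexive e1 ->
  w \in A -> x \in A -> y \in A -> w != x -> w != y ->
  {in A &, forall a b, e2 a b = e1 a b || ((a == x) && (b == y)) || ((a == y) && (b == x))} ->
  ~~ e1 w x -> ~~ e1 w y -> {in A, forall z, e1 w z -> e1 x z || e1 y z} ->
  cone_step w (indep A e2) (indep A e1).
Proof.
move=> se ie wA xA yA wx wy e12 ewx ewy ew; split; try exact: indep_down_closed.
  by apply: indep_mono => // a b aA bA eab; rewrite e12 // eab.
move=> t tA tn; have /indepP[tA' h] := tA.
have /andP[xt yt] : (x \in t) && (y \in t).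
  apply: contraR tn => xyt; apply/indepP; split=> // a b at_ bt.
  rewrite e12 ?(subsetP tA') // (negbTE (h a b at_ bt)) /=.
  apply: contra xyt => /orP[]/andP[/eqP ax /eqP bx]; subst; by rewrite at_ bt.
split.
  apply: indep_U1 => // z zt; apply/negP => /(ew _ (subsetP tA' _ zt)).
  by rewrite (negbTE (h _ _ xt zt)) (negbTE (h _ _ yt zt)).
apply/indepP => -[_ /(_ x y)]; rewrite !inE xt yt !(eq_sym _ w) wx wy /= e12 // !eqxx orbT.
by move/(_ isT isT).
Qed.

End IndependentSets.

(** * Moebius ladders *)

Section Ladder.
Variable N : nat.
Notation vertex := ('I_N * bool)%type.

Definition symm_closure (T : Type) (a : rel T) : rel T := fun x y => a x y || a y x.

(* The prism over an [m]-cycle ([eps = false]) or its Moebius twist. *)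
Definition lad (m : nat) (eps : bool) : rel vertex :=
  symm_closure (fun x y : vertex => [|| (x.1 == y.1 :> nat) && (x.2 != y.2),
    [&& x.1.+1 == y.1 :> nat, y.1 < m & x.2 == y.2] |
    [&& x.1.+1 == m, y.1 == 0 :> nat & y.2 == x.2 (+) eps]]).

Definition rungs m : {set vertex} := [set x : vertex | x.1 < m].

Lemma sph_mono (V : finType) (A A' : {set V}) c r K : A \subset A' ->
  sph A c r K -> sph A' c r K.
Proof.
move=> AA'; have PP : powerset A \subset powerset A' by rewrite powersetS.
elim=> [{}K KA|p K1 K2 KA K0 st _|p K1 K2 KA K0 st _].
- exact/sph_attach/(subset_trans KA).
- exact/(@sph_expand _ _ _ _ p)/st/K0/(subset_trans KA).
- exact/(@sph_collapse _ _ _ _ p)/st/K0/(subset_trans KA).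
Qed.

Section Step.
Variables (n : nat) (eps : bool).
Hypotheses (n2 : 1 < n) (nN : n.+1 < N).

(* Ladders with [n] and with [n.+2] rungs live on the same vertices. The flags
   tell, for each side, whether the edge from rung [n.-1] to rung [n] ([c]), from
   rung [n.+1] to rung [0] ([d]), and the short cut from rung [n.-1] to rung [0]
   ([a]) is present: all [c] and [d] give the ladder with [n.+2] rungs, while all
   [a] give the ladder with [n] rungs and the opposite twist, next to a 4-cycle. *)
Definition flag_core : rel vertex := fun x y =>
  [|| (x.1 == y.1 :> nat) && (x.2 != y.2),
      [&& x.1.+1 == y.1 :> nat, y.1 < n & x.2 == y.2] |
      [&& x.1 == n :> nat, y.1 == n.+1 :> nat & x.2 == y.2]].

Definition flag_arc (c d a : bool -> bool) : rel vertex := fun x y =>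
  [|| flag_core x y,
      [&& x.1.+1 == n, y.1 == n :> nat, x.2 == y.2 & c x.2],
      [&& x.1 == n.+1 :> nat, y.1 == 0 :> nat, y.2 == x.2 (+) eps & d x.2] |
      [&& x.1.+1 == n, y.1 == 0 :> nat, y.2 == ~~ (x.2 (+) eps) & a x.2]].

Definition lad_flags c d a : rel vertex := symm_closure (flag_arc c d a).

Definition upd (f : bool -> bool) (s0 : bool) := fun s => (s == s0) || f s.

Lemma lad_flags_sym c d a : symmetric (lad_flags c d a).
Proof. by move=> x y; rewrite /lad_flags /symm_closure /flag_arc /flag_core orbC. Qed.

Lemma lad_flags_irrefl c d a : irreflexive (lad_flags c d a).
Proof.
move=> [[i hi] s]; rewrite /lad_flags /symm_closure /flag_arc /flag_core orbb /= eqxx /=.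
by apply/negbTE/negP; case: s; lia.
Qed.

Let i0N : 0 < N. Proof. lia. Qed.
Let ipN : n.-1 < N. Proof. lia. Qed.
Let inN : n < N. Proof. lia. Qed.

(** The vertices met in turn along one rail through the two extra rungs. The twist is put into [x3],
    so that [x2 s] precedes [x3 s], while the short cut leads from [x0 s] to [x3 (~~ s)]. *)
Let x0 s : vertex := (Ordinal ipN, s).
Let x1 s : vertex := (Ordinal inN, s).
Let x2 s : vertex := (Ordinal nN, s).
Let x3 s : vertex := (Ordinal i0N, s (+) eps).

Let A := rungs n.+2.

Lemma x1_adj (c d a : bool -> bool) s z : lad_flags c d a (x1 s) z =
  [|| z == x1 (~~ s), z == x2 s | c s && (z == x0 s)].
Proof.
case: z => [[j hj] t]; rewrite /lad_flags /symm_closure /flag_arc /flag_core /x0 /x1 /x2.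
rewrite !xpair_eqE -!val_eqE /=.
case: (ltngtP j n) => [jn|jn|->]; case: s; case: t => /=; lia.
Qed.

Lemma x2_adj (c d a : bool -> bool) s z : lad_flags c d a (x2 s) z =
  [|| z == x2 (~~ s), z == x1 s | d s && (z == x3 s)].
Proof.
case: z => [[j hj] t]; rewrite /lad_flags /symm_closure /flag_arc /flag_core /x3 /x1 /x2.
rewrite !xpair_eqE -!val_eqE /=.
case: (ltngtP j n.+1) => [jn|jn|->]; case: eps; case: s; case: t => /=; lia.
Qed.

Lemma rung_adj (c d a : bool -> bool) i s : lad_flags c d a (i, s) (i, ~~ s).
Proof. by rewrite /lad_flags /symm_closure /flag_arc /flag_core /= eqxx; case: s. Qed.

Lemma x03_adj (c d a : bool -> bool) s : a s ->
  lad_flags c d a (x0 s) (x3 (~~ s)).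
Proof.
move=> as_; rewrite /lad_flags /symm_closure /flag_arc /flag_core /= as_ prednK ?eqxx; last lia.
by rewrite addNb eqxx !orbT.
Qed.

Let pred_eq i : (i == n.-1) = (i.+1 == n). Proof. lia. Qed.

Let symm_closure_or (T : Type) (a b : rel T) x y (dl : rel T) :
  (forall x y, b x y = a x y || dl x y) ->
  symm_closure b x y = symm_closure a x y || dl x y || dl y x.
Proof.
move=> h; rewrite /symm_closure !h.
by case: (a x y); case: (a y x); case: (dl x y).
Qed.

Lemma upd_c (c d a : bool -> bool) s0 p q : lad_flags (upd c s0) d a p q =
  lad_flags c d a p q || ((p == x0 s0) && (q == x1 s0)) || ((p == x1 s0) && (q == x0 s0)).
Proof.
rewrite [(p == x1 s0) && _]andbC.
apply: (@symm_closure_or _ _ _ _ _ (fun p q => (p == x0 s0) && (q == x1 s0))).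
move=> {p q} [[i hi] s] [[j hj] t]; rewrite /flag_arc /upd !xpair_eqE -!val_eqE /= !pred_eq.
case: (flag_core _ _) => //=; case: (i.+1 == n); case: (j == n); rewrite ?andbF ?orbF //=.
by case: s; case: t; case: s0; rewrite /= ?orbF ?orbT.
Qed.

Lemma upd_d (c d a : bool -> bool) s0 p q : lad_flags c (upd d s0) a p q =
  lad_flags c d a p q || ((p == x2 s0) && (q == x3 s0)) || ((p == x3 s0) && (q == x2 s0)).
Proof.
rewrite [(p == x3 s0) && _]andbC.
apply: (@symm_closure_or _ _ _ _ _ (fun p q => (p == x2 s0) && (q == x3 s0))).
move=> {p q} [[i hi] s] [[j hj] t]; rewrite /flag_arc /upd !xpair_eqE -!val_eqE /=.
case: (flag_core _ _) => //=; case: (i == n.+1); case: (j == 0); rewrite ?andbF ?orbF //=.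
case: [&& _, _, _ & c s] => //=.
by case: s; case: t; case: s0; case: (eps); rewrite /= ?orbF ?orbT.
Qed.

Lemma upd_a (c d a : bool -> bool) s0 p q : lad_flags c d (upd a s0) p q =
  lad_flags c d a p q || ((p == x0 s0) && (q == x3 (~~ s0))) ||
  ((p == x3 (~~ s0)) && (q == x0 s0)).
Proof.
rewrite [(p == x3 _) && _]andbC.
apply: (@symm_closure_or _ _ _ _ _ (fun p q => (p == x0 s0) && (q == x3 (~~ s0)))).
move=> {p q} [[i hi] s] [[j hj] t]; rewrite /flag_arc /upd !xpair_eqE -!val_eqE /= !pred_eq.
case: (flag_core _ _) => //=; case: (i.+1 == n); case: (j == 0); rewrite ?andbF ?orbF //=.
case: [&& _, _ & c s] => //=; case: [&& _, _ & d s] => //=.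
by case: s; case: t; case: s0; case: (eps); rewrite /= ?orbF ?orbT.
Qed.

Let x01 s t : (x0 s == x1 t) = false.
Proof. by rewrite xpair_eqE -val_eqE /=; lia. Qed.
Let x02 s t : (x0 s == x2 t) = false.
Proof. by rewrite xpair_eqE -val_eqE /=; lia. Qed.
Let x03 s t : (x0 s == x3 t) = false.
Proof. by rewrite xpair_eqE -val_eqE /=; lia. Qed.
Let x12 s t : (x1 s == x2 t) = false.
Proof. by rewrite xpair_eqE -val_eqE /=; lia. Qed.
Let x13 s t : (x1 s == x3 t) = false.
Proof. by rewrite xpair_eqE -val_eqE /=; lia. Qed.
Let x23 s t : (x2 s == x3 t) = false.
Proof. by rewrite xpair_eqE -val_eqE /=; lia. Qed.

Let x10 s t : (x1 s == x0 t) = false. Proof. by rewrite eq_sym x01. Qed.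
Let x20 s t : (x2 s == x0 t) = false. Proof. by rewrite eq_sym x02. Qed.
Let x30 s t : (x3 s == x0 t) = false. Proof. by rewrite eq_sym x03. Qed.
Let x21 s t : (x2 s == x1 t) = false. Proof. by rewrite eq_sym x12. Qed.
Let x31 s t : (x3 s == x1 t) = false. Proof. by rewrite eq_sym x13. Qed.
Let x32 s t : (x3 s == x2 t) = false. Proof. by rewrite eq_sym x23. Qed.

Let side_neq (i : 'I_N) s : ((i, s) == (i, ~~ s) :> vertex) = false.
Proof. by rewrite xpair_eqE eqxx; case: s. Qed.

Let x0A s : x0 s \in A. Proof. by rewrite inE /=; lia. Qed.
Let x1A s : x1 s \in A. Proof. by rewrite inE /=; lia. Qed.
Let x2A s : x2 s \in A. Proof. by rewrite inE /=; lia. Qed.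
Let x3A s : x3 s \in A. Proof. by rewrite inE /=; lia. Qed.

(** The vertex [x1 (~~ s)] certifies the edge from [x0 s] to [x3 (~~ s)]: its neighbours [x1 s],
    [x2 (~~ s)] and possibly [x0 (~~ s)] are adjacent to an end through [c s], [d (~~ s)] and a rung
    respectively. *)
Lemma toggle_a (c d a : bool -> bool) s : c s -> d (~~ s) ->
  cone_step (x1 (~~ s)) (indep A (lad_flags c d (upd a s))) (indep A (lad_flags c d a)).
Proof.
move=> cs ds.
have se := lad_flags_sym c d a.
apply: (@edge_cone_step _ _ _ _ _ (x0 s) (x3 (~~ s))) => //.
- exact: lad_flags_irrefl.
- by rewrite x10.
- by rewrite x13.
- by move=> p q _ _; exact: upd_a.
- by rewrite x1_adj x01 x02 side_neq andbF.
- by rewrite x1_adj x31 x32 x30 andbF.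
move=> z _; rewrite x1_adj negbK => /or3P[/eqP ->|/eqP ->|/andP[_ /eqP ->]].
- by rewrite se x1_adj eqxx cs !orbT.
- by rewrite [X in _ || X]se x2_adj eqxx ds !orbT.
- by rewrite rung_adj.
Qed.

(** Here [x2 (~~ s)] certifies the edge from [x0 s] to [x1 s]; its possible neighbour [x3 (~~ s)] is
    adjacent to [x0 s] by the short cut. *)
Lemma toggle_c (c d a : bool -> bool) s : a s ->
  cone_step (x2 (~~ s)) (indep A (lad_flags (upd c s) d a)) (indep A (lad_flags c d a)).
Proof.
move=> as_; have se := lad_flags_sym c d a.
apply: (@edge_cone_step _ _ _ _ _ (x0 s) (x1 s)) => //.
- exact: lad_flags_irrefl.
- by rewrite x20.
- by rewrite x21.
- by move=> p q _ _; exact: upd_c.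
- by rewrite x2_adj x01 x02 x03 andbF.
- by rewrite x2_adj x12 x13 side_neq andbF.
move=> z _; rewrite x2_adj negbK => /or3P[/eqP ->|/eqP ->|/andP[_ /eqP ->]].
- by rewrite [X in _ || X]x1_adj eqxx !orbT.
- by rewrite [X in _ || X]x1_adj eqxx !orbT.
- by rewrite x03_adj.
Qed.

(** Here [x1 (~~ s)] certifies the edge from [x2 s] to [x3 s]; its possible neighbour [x0 (~~ s)] is
    adjacent to [x3 s] by the short cut. *)
Lemma toggle_d (c d a : bool -> bool) s : a (~~ s) ->
  cone_step (x1 (~~ s)) (indep A (lad_flags c (upd d s) a)) (indep A (lad_flags c d a)).
Proof.
move=> as_; have se := lad_flags_sym c d a.
apply: (@edge_cone_step _ _ _ _ _ (x2 s) (x3 s)) => //.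
- exact: lad_flags_irrefl.
- by rewrite x12.
- by rewrite x13.
- by move=> p q _ _; exact: upd_d.
- by rewrite x1_adj x21 x20 side_neq andbF.
- by rewrite x1_adj x31 x32 x30 andbF.
move=> z _; rewrite x1_adj negbK => /or3P[/eqP ->|/eqP ->|/andP[_ /eqP ->]].
- by rewrite x2_adj eqxx /= ?orbT.
- by rewrite x2_adj eqxx /= ?orbT.
- by have := x03_adj c d as_; rewrite negbK [X in _ || X]se => ->; rewrite orbT.
Qed.

(** The hypotheses of the toggles dictate the order: [c] and [d] are switched on while all short
    cuts are present, and the short cuts are removed once all [c] and [d] are present. *)
Lemma ladder_step c r : sph (rungs n) c r (indep (rungs n) (lad n (~~ eps))) ->
  sph (rungs n.+2) c.+1 r (indep (rungs n.+2) (lad n.+2 eps)).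
Proof.
pose f0 := fun _ : bool => false; pose f1 := fun _ : bool => true.
pose e0 := lad_flags f0 f0 f1.
have -> : indep (rungs n) (lad n (~~ eps)) = indep (rungs n) e0.
  apply: eq_indep => // -[[i hi] s] [[j hj] t]; rewrite !inE /= => iA jA.
  rewrite /e0 /lad_flags /symm_closure /flag_arc /flag_core /lad /symm_closure /=.
  rewrite /f0 /f1 (ltn_eqF iA) (ltn_eqF jA) !andbF !andbT !orbF /= !addbN.
  by rewrite !orbA.
have se : symmetric e0 by exact: lad_flags_sym.
have ie : irreflexive e0 by exact: lad_flags_irrefl.
have x1n s : x1 s \notin rungs n by rewrite inE /= ltnn.
have AE1 : rungs n.+1 = x1 false |: (x1 true |: rungs n).
  apply/setP => -[[i hi] s]; rewrite !inE !xpair_eqE -!val_eqE /= ltnS leq_eqVlt.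
  by case: s; rewrite ?andbT ?andbF ?orbF.
move=> IH.
(* With all [c] off, rung [n] is a separate edge next to the ladder with [n] rungs and suspends its
   complex. *)
have h1 : sph (rungs n.+1) c.+1 r (indep (rungs n.+1) e0).
  rewrite AE1 indep_susp //; first by apply: sph_susp => //; rewrite xpair_eqE andbF.
    by rewrite /e0 x1_adj eqxx.
  move=> -[[i hi] s]; rewrite inE /= => iA.
  rewrite /e0 !x1_adj !xpair_eqE -!val_eqE /=; lia.
have An : rungs n.+1 \subset A.
  by apply/subsetP => x; rewrite !inE; lia.
have AE : A :\ x2 true :\ x2 false = rungs n.+1.
  apply/setP => -[[i hi] s]; rewrite !inE !xpair_eqE -!val_eqE /= /A.
  by case: s; rewrite ?andbT ?andbF /=; lia.
have PA (B : {set vertex}) (e : rel vertex) : B \subset A -> indep B e \subset powerset A.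
  move=> BA; apply: subset_trans (indep_powerset _ _) _.
  by rewrite powersetS.
(* Rungs [n] and [n.+1] span a separate 4-cycle, in which opposite vertices have the same
   neighbours. The two vertices of rung [n.+1] are therefore restored by inverse folds. *)
have h2 : sph A c.+1 r (indep (A :\ x2 true) e0).
  apply: (@sph_expand _ _ _ _ (x1 true) (indep (A :\ x2 true :\ x2 false) e0)).
  - by apply: PA; exact: subsetDl.
  - exact: indep_set0.
  - apply: fold_cone_step => //.
    + by rewrite in_setD1 x12 x1A.
    + by rewrite in_setD1 x2A side_neq.
    + by rewrite x12.
    + by rewrite /e0 x1_adj x21 x20 andbF orbF xpair_eqE andbC.
    + move=> z; rewrite !inE => /andP[zx _]; rewrite /e0 x1_adj (negbTE zx) /= orbF.
      by move=> /eqP ->; rewrite /e0 x2_adj eqxx orbT.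
  - by rewrite AE; exact: sph_mono h1.
have h3 : sph A c.+1 r (indep A e0).
  apply: (@sph_expand _ _ _ _ (x1 false) (indep (A :\ x2 true) e0)) => //.
  - by apply: PA.
  - exact: indep_set0.
  - apply: fold_cone_step => //.
    + by rewrite x12.
    + by rewrite /e0 x1_adj x21 x20 andbF orbF xpair_eqE andbC.
    + move=> z _; rewrite /e0 x1_adj /= orbF => /orP[]/eqP ->; rewrite /e0 x2_adj eqxx //.
      by rewrite orbT.
have PAA (e : rel vertex) : indep A e \subset powerset A by exact: PA.
have h4 : sph A c.+1 r (indep A (lad_flags (upd (upd f0 true) false) f0 f1)).
  apply: sph_collapse (PAA _) (indep_set0 _ _) (toggle_c _ _ _) _ => //.
  by apply: sph_collapse (PAA _) (indep_set0 _ _) (toggle_c _ _ _) h3.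
set c1 := upd _ _ in h4.
have h5 : sph A c.+1 r (indep A (lad_flags c1 (upd (upd f0 true) false) f1)).
  apply: sph_collapse (PAA _) (indep_set0 _ _) (toggle_d _ _ _) _ => //.
  by apply: sph_collapse (PAA _) (indep_set0 _ _) (toggle_d _ _ _) h4.
have c1T s : c1 s by case: s.
have h6 : sph A c.+1 r (indep A (lad_flags c1 c1 (upd (upd f0 true) false))).
  have -> // : indep A (lad_flags c1 c1 (upd (upd f0 true) false)) =
    indep A (lad_flags c1 c1 f1).
  by apply: eq_indep => // p q _ _; rewrite -/c1 /lad_flags /symm_closure /flag_arc !c1T.
have h7 : sph A c.+1 r (indep A (lad_flags c1 c1 f0)).
  apply: sph_expand (PAA _) (indep_set0 _ _) (@toggle_a c1 c1 f0 true _ _) _ => //.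
  by apply: sph_expand (PAA _) (indep_set0 _ _) (@toggle_a c1 c1 (upd f0 true) false _ _) h6.
have -> // : indep (rungs n.+2) (lad n.+2 eps) = indep A (lad_flags c1 c1 f0).
have E k l : k < n.+2 -> l < n.+2 -> (k.+1 == l) && (l < n.+2) =
   [|| (k.+1 == l) && (l < n), (k == n) && (l == n.+1) | (k.+1 == n) && (l == n)] by lia.
have arcE (x y : vertex) : x \in A -> y \in A -> [|| (x.1 == y.1 :> nat) && (x.2 != y.2),
    [&& x.1.+1 == y.1 :> nat, y.1 < n.+2 & x.2 == y.2] |
    [&& x.1.+1 == n.+2, y.1 == 0 :> nat & y.2 == x.2 (+) eps]] = flag_arc c1 c1 f0 x y.
  move: x y => [[i hi] s] [[j hj] t]; rewrite !inE /= => iA jA.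
  rewrite /flag_arc /flag_core !c1T /= !andbF !andbT !orbF eqSS.
  case: (s == t); rewrite ?andbF ?andbT ?orbF //= E //.
  by case: (i == j); case: ((i.+1 == j) && _); case: ((i == n) && _);
    case: ((i.+1 == n) && _).
by apply: eq_indep => // x y xA yA; rewrite /lad /lad_flags /symm_closure -!arcE.
Qed.

End Step.

(** The complex is [r.+1] isolated points: the last remaining vertex is a cone, and every other one
    has an empty link and contributes a cell with one element. *)
Lemma indep_complete (V : finType) (A : {set V}) (e : rel V) r :
  symmetric e -> irreflexive e -> {in A &, forall x y, x != y -> e x y} ->
  #|A| = r.+1 -> attach 1 set0 r (indep A e).
Proof.
move=> se ie; elim: r A => [|r IH] A eA cA.
  have /eqP/cards1P[v Av] := cA; apply: (@indep_cone _ _ _ _ v) => //.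
    by rewrite Av inE.
  by move=> x; rewrite Av inE => /eqP ->; rewrite ie.
have [v vA] : exists v, v \in A by apply/set0Pn; rewrite -card_gt0 cA.
rewrite -[r.+1]addn1; apply: (@indep_split _ _ _ _ _ _ v) => //.
  apply: IH; last by move: cA; rewrite (cardsD1 v) vA => -[].
  by move=> x y; rewrite !inE => /andP[_ xA] /andP[_ yA]; exact: eA.
rewrite (_ : [set _ in A | _] = set0); first exact: indep_no_vertices.
apply/setP => x; rewrite !inE; apply/negP => /and3P[xA xv].
by rewrite eA // eq_sym.
Qed.

(** In a complete bipartite graph the vertices of one colour are twins. Folding them together leaves
    one edge, whose complex is two points. *)
Lemma indep_bipartite (V : finType) (A : {set V}) (e : rel V) (chi : V -> bool) u v :
  symmetric e -> irreflexive e ->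
  {in A &, forall x y, e x y = (chi x != chi y)} ->
  u \in A -> v \in A -> chi u -> ~~ chi v -> attach 1 set0 1 (indep A e).
Proof.
move=> se ie; move: {2}#|_| (leqnn #|A|) => m.
elim: m A => [|m IH] A cA eA uA vA cu cv.
  by move: cA; rewrite leqn0 cards_eq0 => /eqP A0; rewrite A0 inE in uA.
have uv : u != v by apply: contraNneq cv => <-.
have [Auv|/subsetPn[w wA]] := boolP (A \subset [set u; v]).
  have AE : A = [set u; v] by apply/eqP; rewrite eqEsubset Auv subUset !sub1set uA.
  apply: indep_complete => //; last by rewrite AE cards2 uv.
  move=> x y xA yA; rewrite eA //; move: xA yA; rewrite AE !inE.
  by move=> /orP[]/eqP -> /orP[]/eqP -> //; rewrite ?eqxx // cu (negbTE cv).
rewrite !inE negb_or => /andP[wu wv].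
pose z := if chi w then u else v.
have zA : z \in A by rewrite /z; case: ifP.
have cz : chi z = chi w by rewrite /z; case: ifP => // _; exact/negbTE.
apply: (@indep_fold _ _ _ _ _ z w) => //.
- by rewrite /z; case: ifP; rewrite eq_sym.
- by rewrite eA // cz eqxx.
- by move=> x xA; rewrite !eA // cz.
apply: IH; rewrite ?inE ?uA ?vA ?andbT //; try by rewrite eq_sym.
  by move: cA; rewrite (cardsD1 w) wA.
by move=> x y; rewrite !inE => /andP[_ xA] /andP[_ yA]; exact: eA.
Qed.

Lemma lad_sym m eps : symmetric (lad m eps).
Proof. by move=> x y; rewrite /lad /symm_closure orbC. Qed.

Lemma lad_irrefl m eps : 1 < m -> irreflexive (lad m eps).
Proof.
move=> m1 [[i hi] s]; rewrite /lad /symm_closure orbb /= eqxx /=.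
by apply/negbTE/negP; case: s; lia.
Qed.

Section Bases.
Hypothesis N3 : 3 < N.

Let mk i (hi : i < 3) s : vertex := (Ordinal (leq_trans hi (ltnW N3)), s).

(** This ladder is the complete graph on four vertices. *)
Lemma ladder2_twisted : attach 1 set0 3 (indep (rungs 2) (lad 2 true)).
Proof.
apply: indep_complete; [exact: lad_sym|exact: lad_irrefl| |].
  move=> [[i hi] s] [[j hj] t]; rewrite !inE /= xpair_eqE -val_eqE /=.
  rewrite /lad /symm_closure /=.
  case: i hi => [|[|i]] hi //; case: j hj => [|[|j]] hj //; by case: s; case: t.
have -> : rungs 2 = mk (isT : 0 < 3) false |: (mk (isT : 0 < 3) true |:
   (mk (isT : 1 < 3) false |: [set mk (isT : 1 < 3) true])).
  apply/setP => -[[i hi] s]; rewrite !inE /= !xpair_eqE -!val_eqE /=.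
  by case: i hi => [|[|i]] hi //; case: s.
by rewrite !cardsU1 cards1 !inE !xpair_eqE -!val_eqE.
Qed.

Let colour (x : vertex) := odd x.1 (+) x.2.

(** A 4-cycle, that is the complete bipartite graph with parts of size 2. *)
Lemma ladder2_straight : attach 1 set0 1 (indep (rungs 2) (lad 2 false)).
Proof.
apply: (@indep_bipartite _ _ _ colour (mk (isT : 0 < 3) true) (mk (isT : 0 < 3) false));
  rewrite ?inE //; [exact: lad_sym|exact: lad_irrefl|].
move=> [[i hi] s] [[j hj] t]; rewrite !inE /= /lad /symm_closure /colour /=.
by case: i hi => [|[|i]] hi //; case: j hj => [|[|j]] hj //; case: s; case: t.
Qed.

(** The complete bipartite graph with parts of size 3. *)
Lemma ladder3_twisted : attach 1 set0 1 (indep (rungs 3) (lad 3 true)).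
Proof.
apply: (@indep_bipartite _ _ _ colour (mk (isT : 0 < 3) true) (mk (isT : 0 < 3) false));
  rewrite ?inE //; [exact: lad_sym|exact: lad_irrefl|].
move=> [[i hi] s] [[j hj] t]; rewrite !inE /= /lad /symm_closure /colour /=.
by case: i hi => [|[|[|i]]] hi //; case: j hj => [|[|[|j]]] hj //; case: s; case: t.
Qed.

(** The independence complex of the triangular prism is a hexagon. Deleting one vertex leaves a
    contractible path, and the link of that vertex is two points. *)
Lemma ladder3_straight : attach 2 set0 1 (indep (rungs 3) (lad 3 false)).
Proof.
have se := lad_sym 3 false; have ie := lad_irrefl false (isT : 1 < 3).
pose a s := mk (isT : 0 < 3) s; pose b s := mk (isT : 1 < 3) s.
pose c s := mk (isT : 2 < 3) s.
rewrite -[1]add0n; apply: (@indep_split _ _ _ _ _ _ (a false)) => //.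
- by rewrite inE.
- apply: (@indep_fold _ _ _ _ _ (c false) (b true)) => //.
  + by rewrite !inE !xpair_eqE -!val_eqE.
  + by rewrite !inE !xpair_eqE -!val_eqE.
  + move=> [[i hi] s]; rewrite !inE !xpair_eqE -!val_eqE /= /lad /symm_closure /=.
    by case: i hi => [|[|[|i]]] hi //; case: s.
  apply: (@indep_fold _ _ _ _ _ (a true) (c false)) => //.
  + by rewrite !inE !xpair_eqE -!val_eqE.
  + by rewrite !inE !xpair_eqE -!val_eqE.
  + move=> [[i hi] s]; rewrite !inE !xpair_eqE -!val_eqE /= /lad /symm_closure /=.
    by case: i hi => [|[|[|i]]] hi //; case: s.
  apply: (@indep_cone _ _ _ _ (b false)) => //.
  + by rewrite !inE !xpair_eqE -!val_eqE.
  + move=> [[i hi] s]; rewrite !inE !xpair_eqE -!val_eqE /= /lad /symm_closure /=.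
    by case: i hi => [|[|[|i]]] hi //; case: s.
- apply: indep_complete => //.
    move=> [[i hi] s] [[j hj] t]; rewrite !inE !xpair_eqE -!val_eqE /= /lad /symm_closure /=.
    by case: i hi => [|[|[|i]]] hi //; case: j hj => [|[|[|j]]] hj //; case: s; case: t.
  rewrite (_ : [set _ in _ | _] = [set b true; c true]).
    by rewrite cards2 xpair_eqE -val_eqE.
  apply/setP => -[[i hi] s]; rewrite !inE !xpair_eqE -!val_eqE /= /lad /symm_closure /=.
  by case: i hi => [|[|[|i]]] hi //; case: s.
Qed.

End Bases.

(** Every step flips the twist, so the parity of [m] decides which base is reached. *)
Lemma sph_ladder n0 m eps c r : 1 < n0 -> n0 + m.*2 <= N ->
  sph (rungs n0) c r (indep (rungs n0) (lad n0 (eps (+) odd m))) ->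
  sph (rungs (n0 + m.*2)) (c + m) r (indep (rungs (n0 + m.*2)) (lad (n0 + m.*2) eps)).
Proof.
move=> n1; elim: m eps => [|m IH] eps mN; first by rewrite !addn0 addbF.
rewrite doubleS !addnS => h; apply: ladder_step; try lia.
by apply: IH; [lia|move: h; rewrite /= addbN addNb].
Qed.

Lemma sph_attach_indep (V : finType) (A : {set V}) (e : rel V) c r :
  attach c set0 r (indep A e) -> sph A c r (indep A e).
Proof. by apply: sph_attach; exact: indep_powerset. Qed.

(** The parity of [n] selects the base with 2 or 3 rungs, and the residue modulo 4 its twist. The
    form [k.+1] excludes [n = 0] and [n = 1]. *)
Lemma twisted_ladder_sph n k : 3 < N -> n <= N ->
  [/\ n = 4 * k.+1 -> sph (rungs n) (2 * k).+2 1 (indep (rungs n) (lad n true)),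
      n = 4 * k + 2 -> sph (rungs n) (2 * k).+1 3 (indep (rungs n) (lad n true)),
      n = 4 * k.+1 + 1 -> sph (rungs n) (2 * k.+1).+1 1 (indep (rungs n) (lad n true)) &
      n = 4 * k + 3 -> sph (rungs n) (2 * k).+1 1 (indep (rungs n) (lad n true))].
Proof.
move=> N3 nN; split=> E.
- have -> : (2 * k).+2 = 1 + (2 * k).+1 by lia.
  have E' : n = 2 + ((2 * k).+1).*2 by lia.
  rewrite E' in nN *; apply: sph_ladder => //; apply: sph_attach_indep.
  by rewrite /= mul2n odd_double; exact: ladder2_straight.
- have -> : (2 * k).+1 = 1 + (2 * k) by lia.
  have E' : n = 2 + (2 * k).*2 by lia.
  rewrite E' in nN *; apply: sph_ladder => //; apply: sph_attach_indep.
  by rewrite /= mul2n odd_double; exact: ladder2_twisted.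
- have -> : (2 * k.+1).+1 = 2 + (2 * k).+1 by lia.
  have E' : n = 3 + ((2 * k).+1).*2 by lia.
  rewrite E' in nN *; apply: sph_ladder => //; apply: sph_attach_indep.
  by rewrite /= mul2n odd_double; exact: ladder3_straight.
- have -> : (2 * k).+1 = 1 + (2 * k) by lia.
  have E' : n = 3 + (2 * k).*2 by lia.
  rewrite E' in nN *; apply: sph_ladder => //; apply: sph_attach_indep.
  by rewrite /= mul2n odd_double; exact: ladder3_twisted.
Qed.

End Ladder.

(** * Paths, cycles and perfect matchings of ladders *)

Section PathGraph.
Variables (V : finType) (e : rel V) (pos : V -> nat).
Hypotheses (se : symmetric e) (ie : irreflexive e).

(** Positions begin at an arbitrary [lo], so that a segment of a path needs no renumbering. *)
Definition path_like (A : {set V}) lo m :=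
  [/\ {in A &, injective pos},
      forall x, x \in A -> lo <= pos x < lo + m,
      forall i, lo <= i < lo + m -> exists2 x, x \in A & pos x = i &
      {in A &, forall x y, e x y = ((pos x).+1 == pos y) || ((pos y).+1 == pos x)}].

Lemma path_like_sub A lo m lo' m' : path_like A lo m -> lo <= lo' -> lo' + m' <= lo + m ->
  path_like [set x in A | lo' <= pos x < lo' + m'] lo' m'.
Proof.
move=> [inj rng sur adj] l1 l2; split.
- by move=> x y; rewrite !inE => /andP[xA _] /andP[yA _]; exact: inj.
- by move=> x; rewrite inE => /andP[].
- move=> i ilm; have [|x xA xi] := sur i; first lia.
  by exists x => //; rewrite inE xA xi.
- by move=> x y; rewrite !inE => /andP[xA _] /andP[yA _]; exact: adj.
Qed.

(** The known homotopy types for paths on [m] vertices: contractible, with [c] free, when [m] is 1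
    modulo 3, and a sphere of dimension [c - 1] otherwise. *)
Definition path_type m c r := (m %% 3 = 0 /\ c = m %/ 3 /\ r = 1) \/
  (m %% 3 = 1 /\ r = 0) \/ (m %% 3 = 2 /\ c = (m %/ 3).+1 /\ r = 1).

(** The only neighbour of the first vertex is adjacent to the third, so the third folds away. What
    remains is a separate edge and a path with three vertices fewer, that is a suspension. *)
Lemma attach_path A lo m c r : path_like A lo m -> path_type m c r ->
  attach c set0 r (indep A e).
Proof.
elim/ltn_ind: m A lo c r => m IH A lo c r pA mcr; rewrite /path_type in IH mcr.
have [inj rng sur adj] := pA.
have [m0|m0] := posnP m.
  have A0 : A = set0 by apply/setP => x; rewrite inE; apply/negP => /rng; lia.
  have [-> ->] : c = 0 /\ r = 1 by lia.
  by rewrite A0; exact: indep_no_vertices.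
have [m1|m1] := eqVneq m 1.
  have [x xA xlo] := sur lo ltac:(lia).
  have r0 : r = 0 by lia.
  rewrite r0; apply: (@indep_cone _ _ _ _ x) => // y yA.
  by rewrite adj // xlo; have := rng y yA; lia.
have [x1 x1A x1p] := sur lo ltac:(lia).
have [x2 x2A x2p] := sur lo.+1 ltac:(lia).
have e12 : e x1 x2 by rewrite adj // x1p x2p eqxx.
pose A' := [set x in A | lo + 3 <= pos x < lo + 3 + (m - 3)].
have x1A' : x1 \notin A' by rewrite inE x1p; lia.
have x2A' : x2 \notin A' by rewrite inE x2p; lia.
have nA' : {in A', forall x, ~~ e x1 x && ~~ e x2 x}.
  move=> x; rewrite inE => /andP[xA xlo]; rewrite !adj // x1p x2p; lia.
have IH' : 2 < m -> attach c set0 r (indep (x1 |: (x2 |: A')) e).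
  move=> m3; have pA' : path_like A' (lo + 3) (m - 3) by apply: path_like_sub pA _ _; lia.
  (* With at least three vertices [c = 0] is only compatible with the contractible case, where [c]
     may be replaced by 1. *)
  case: c mcr => [|c] mcr.
    have r0 : r = 0 by lia.
    rewrite r0; apply: (@attach_card _ 1 _ _ 0) => //.
    apply: indep_susp_attach => //; apply: IH pA' _; first lia.
    by lia.
  apply: indep_susp_attach => //; apply: IH pA' _; first lia.
  by lia.
have [m2|m2] := eqVneq m 2.
  have -> : A = x1 |: (x2 |: set0).
    apply/setP => x; rewrite !inE orbF; apply/idP/orP => [xA|[]/eqP -> //].
    have [xlo|xlo] := eqVneq (pos x) lo; [left|right]; apply/eqP/inj => //.
      by rewrite xlo.
    by rewrite x2p; have := rng x xA; lia.
  have [-> ->] : c = 1 /\ r = 1 by lia.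
  apply: indep_susp_attach => //; rewrite ?inE //; last exact: indep_no_vertices.
  by move=> x; rewrite inE.
have [x3 x3A x3p] := sur lo.+2 ltac:(lia).
apply: (@indep_fold _ _ _ _ _ x1 x3) => //.
- by apply/eqP => x13; move: x3p; rewrite -x13 x1p; lia.
- by rewrite adj // x1p x3p; lia.
- by move=> x xA; rewrite !adj // x1p x3p; have := rng x xA; lia.
rewrite (_ : A :\ x3 = x1 |: (x2 |: A')); first by apply: IH'; lia.
apply/setP => x; rewrite !inE; apply/andP/or3P => [[x3' xA]|].
  have := rng x xA => xr.
  have [xlo|xlo] := eqVneq (pos x) lo.
    by constructor 1; apply/eqP/inj; rewrite // xlo.
  have [xlo1|xlo1] := eqVneq (pos x) lo.+1.
    by constructor 2; apply/eqP/inj; rewrite // xlo1.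
  have xlo2 : pos x != lo.+2 by apply: contra_neq x3' => h; apply: inj; rewrite // h.
  by constructor 3; rewrite xA; lia.
case=> [/eqP ->|/eqP ->|/andP[xA xr]]; split=> //.
- by apply/eqP => h; move: x3p; rewrite -h x1p; lia.
- by apply/eqP => h; move: x3p; rewrite -h x2p; lia.
- by apply/eqP => h; move: xr; rewrite h x3p; lia.
Qed.

(** Deleting the last vertex leaves a path on [m - 1] vertices, with a path on [m - 3] vertices as
    link. Both contribute a cell if 3 divides [m], only the path if the remainder is 1, and only the
    link if it is 2. *)
Lemma attach_cycle (A : {set V}) m c r : 2 < m ->
  {in A &, injective pos} -> (forall x, x \in A -> pos x < m) ->
  (forall i, i < m -> exists2 x, x \in A & pos x = i) ->
  {in A &, forall x y, e x y = [|| (pos x).+1 == pos y, (pos y).+1 == pos x,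
     (pos x == 0) && ((pos y).+1 == m) | (pos y == 0) && ((pos x).+1 == m)]} ->
  (m %% 3 = 0 /\ c = m %/ 3 /\ r = 2) \/
  (m %% 3 = 1 /\ c = m %/ 3 /\ r = 1) \/
  (m %% 3 = 2 /\ c = (m %/ 3).+1 /\ r = 1) ->
  attach c set0 r (indep A e).
Proof.
move=> m2 inj rng sur adj mcr.
have [v vA vm] := sur m.-1 ltac:(lia).
have del : path_like (A :\ v) 0 m.-1.
  have neq x : x \in A -> x != v -> pos x < m.-1.
    move=> xA xv; have := rng x xA; have : pos x != m.-1; last lia.
    by apply: contra_neq xv => xm; apply: inj; rewrite // xm.
  split.
  - by move=> x y; rewrite !inE => /andP[_ xA] /andP[_ yA]; exact: inj.
  - by move=> x; rewrite !inE => /andP[xv xA]; rewrite add0n neq.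
  - move=> i im; have [|x xA xi] := sur i; first lia.
    by exists x => //; rewrite !inE xA andbT; apply/eqP => h; move: im; rewrite -xi h vm; lia.
  - move=> x y; rewrite !inE => /andP[xv xA] /andP[yv yA]; rewrite adj //.
    by have := neq x xA xv; have := neq y yA yv; lia.
have lkE : [set x in A | (x != v) && ~~ e v x] =
    [set x in A :\ v | 1 <= pos x < 1 + (m - 3)].
  apply/setP => x; rewrite !inE; have [xA|] := boolP (x \in A); last by rewrite andbF.
  have [->|xv] := eqVneq x v; first by [].
  rewrite /= adj // vm; have := rng x xA; have : pos x != m.-1; last lia.
  by apply: contra_neq xv => xm; apply: inj; rewrite // xm.
have lk : path_like [set x in A | (x != v) && ~~ e v x] 1 (m - 3).
  by rewrite lkE; apply: path_like_sub del _ _; lia.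
case: c mcr => [|c] mcr; first by lia.
pose r1 := if m.-1 %% 3 == 1 then 0 else 1.
have -> : r = r1 + (r - r1) by rewrite /r1; case: eqP; lia.
apply: (@indep_split _ _ _ _ _ _ v) => //.
  by apply: attach_path del _; rewrite /path_type /r1; case: eqP; lia.
by apply: attach_path lk _; rewrite /path_type /r1; case: eqP; lia.
Qed.

End PathGraph.

(** * Replacing a glued simplex by a cone *)

Section SimplexGluing.
Variable V : finType.

(* Gluing the simplex [S] to [M] amounts to coning off [M :&: powerset S]; the
   simplex coned from [p] collapses onto both. *)
Lemma sph_glue_simplex (B : {set V}) c r (M : {set {set V}}) (S : {set V}) a p :
  down_closed M -> M \subset powerset B -> S \subset B -> p \in B ->
  (forall t, t \in M -> p \notin t) -> p \notin S -> a \in S -> set0 \in M ->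
  sph B c r (M :|: join1 p (M :&: powerset S)) -> sph B c r (M :|: powerset S).
Proof.
move=> dM MB SB pB pM pS aS M0 h.
pose K2 := M :|: powerset S :|: join1 p (powerset S).
have pin (t : {set V}) : t \subset S -> p \notin t.
  by move=> /subsetP tS; apply: contra pS; exact: tS.
have dK2 : down_closed K2.
  apply: down_closed_join; [|exact: down_closed_powerset|exact: subsetUr].
  by apply: down_closedU => //; exact: down_closed_powerset.
have K2B : K2 \subset powerset B.
  rewrite !subUset MB powersetS SB /=; apply/subsetP => t /imsetP[s].
  by rewrite !inE => sS ->; rewrite subUset sub1set pB (subset_trans sS SB).
(* The missing faces are [s] and [p |: s] for [s] inside [S] but outside [M], which toggling [p]
   matches. *)
have st1 : cone_step p (M :|: join1 p (M :&: powerset S)) K2.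
  split=> //.
  - apply: down_closed_join => //; last exact: subsetIl.
    by apply: down_closedI => //; exact: down_closed_powerset.
  - rewrite subUset; apply/andP; split; first by rewrite /K2 -setUA subsetUl.
    by apply: subset_trans (subsetUr _ _); apply: imsetS; exact: subsetIr.
  - move=> t; rewrite !inE -orbA negb_or => tK2 /andP[tM tJ].
    have [s [sS sM ts]] : exists s : {set V}, [/\ s \subset S, s \notin M & t = s \/ t = p |: s].
      case/or3P: tK2 => [tM'|tS|/imsetP[s]]; first by rewrite tM' in tM.
        by exists t; split=> //; left.
      rewrite inE => sS ts; exists s; split=> //; last by right.
      apply: contra tJ => sM; apply/imsetP; exists s => //.
      by rewrite !inE sM.
    have ps := pin s sS.
    have -> : p |: t = p |: s by case: ts => -> //; rewrite setUA setUid.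
    have -> : t :\ p = s by case: ts => ->; [rewrite setD1_id|rewrite setU1K].
    split; first by apply/orP; right; apply: imset_f; rewrite inE.
    rewrite negb_or sM; apply/imsetP => -[s' _ ss']; move: ps; rewrite ss'.
    by rewrite !inE eqxx.
(* The missing faces are [p |: s] for all [s] inside [S]; any vertex [a] of the simplex matches
   them. *)
have st2 : cone_step a (M :|: powerset S) K2.
  have ap : a != p by apply: contraNneq pS => <-.
  split=> //.
  - by apply: down_closedU => //; exact: down_closed_powerset.
  - exact: subsetUl.
  - move=> t; rewrite in_setU => /orP[->//|/imsetP[s]]; rewrite inE => sS -> _; split.
      rewrite setUCA in_setU; apply/orP; right; apply: imset_f.
      by rewrite inE subUset sub1set aS.
    have pin' : p \in (p |: s) :\ a by rewrite !inE eq_sym ap eqxx.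
    rewrite !inE negb_or; apply/andP; split; first by apply: contraL pin' => /pM.
    by apply: contraL pin' => /pin.
have h2 : sph B c r K2 by apply: sph_expand st1 h => //; rewrite inE M0.
by apply: sph_collapse st2 h2 => //; rewrite inE M0.
Qed.

End SimplexGluing.

(** * The complex of rail-symmetric and alternating matchings *)

Section Labels.
Variable n : nat.
Hypothesis n2 : 1 < n.

(* The label [2 i] stands for the rung v_{i+1} v_{i+1+n}, and [2 i + 1] and
   [2 n + i] for the opposite rails v_{i+1} v_{i+2} and v_{i+1+n} v_{i+2+n}
   (indices modulo [2 n]). The labels [3 n, 3 n + 1, 3 n + 2] are spare apexes. *)
Definition label := 'I_(3 * n + 2).+1.

(* Identifies opposite rails. *)
Definition proj (x : nat) := if x < 2 * n then x else ((x - 2 * n) * 2).+1.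

Lemma proj_small x : x < 2 * n -> proj x = x.
Proof. by rewrite /proj => ->. Qed.

Lemma proj_large x : 2 * n <= x -> proj x = ((x - 2 * n) * 2).+1.
Proof. by rewrite /proj ltnNge => ->. Qed.

(** Conflicts on the cyclic strip: a rung with a neighbouring rail pair, or two consecutive rail
    pairs; the last two clauses close the cycle. The twist is invisible here, since opposite rails
    are identified. *)
Definition dimer_arc : rel nat := fun a b =>
  [|| a.+1 == b, odd a && (a.+2 == b), (a.+1 == 2 * n) && (b == 0) |
      (a.+1 == 2 * n) && (b == 1)].

(** Opposite rails have the same projection and do not conflict: they are twins. *)
Definition conflict : rel label := fun x y =>
  dimer_arc (proj x) (proj y) || dimer_arc (proj y) (proj x).

Lemma conflict_sym : symmetric conflict.
Proof. by move=> x y; rewrite /conflict orbC. Qed.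

Lemma conflict_irrefl : irreflexive conflict.
Proof.
by move=> x; rewrite /conflict orbb /dimer_arc; apply/negbTE/negP; lia.
Qed.

Definition labels (lo hi : nat) : {set label} := [set x : label | lo <= x < hi].

Let mkl k : k < 3 * n -> {x : label | x = k :> nat}.
Proof. by move=> kn; exists (inord k); rewrite inordK //; lia. Qed.

(** The strip has [m] rungs and the [m - 1] rail pairs between them. The first rung conflicts only
    with the first rail pair, and so do, among others, the second rung and the second rail pair:
    both fold away. This leaves a separate edge and a strip with two rungs fewer. Truncated
    subtraction makes the strip empty for [m = 0]. *)
Lemma attach_strip m lo : ~~ odd lo -> lo + 2 * m <= 2 * n ->
  (~~ odd m -> attach m./2 set0 1 (indep (labels lo (lo + (2 * m - 1))) conflict)) /\
  (odd m -> forall c, attach c set0 0 (indep (labels lo (lo + (2 * m - 1))) conflict)).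
Proof.
have se := conflict_sym; have ie := conflict_irrefl.
elim/ltn_ind: m lo => m IH lo olo lom.
have [m0|m0] := posnP m.
  rewrite m0; split=> // _; rewrite (_ : labels _ _ = set0); first exact: indep_no_vertices.
  by apply/setP => x; rewrite !inE; lia.
have confE (x y : label) : x < 2 * n - 1 -> y < 2 * n - 1 -> conflict x y =
    [|| x.+1 == y, y.+1 == x, odd x && (x.+2 == y) | odd y && (y.+2 == x)].
  move=> xn yn; have px : proj x = x by apply: proj_small; lia.
  have py : proj y = y by apply: proj_small; lia.
  rewrite /conflict /dimer_arc px py.
  rewrite (_ : (x.+1 == 2 * n) = false); last lia.
  rewrite (_ : (y.+1 == 2 * n) = false); last lia.
  by rewrite /= !orbF orbACA -orbA.
have [x1 x1p] := @mkl lo ltac:(lia).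
have [m1|m1] := eqVneq m 1.
  rewrite m1; split=> // _ c; apply: (@indep_cone _ _ _ _ x1) => //.
    by rewrite inE; lia.
  by move=> x; rewrite inE => xr; rewrite confE; lia.
have [x2 x2p] := @mkl lo.+1 ltac:(lia).
have [x3 x3p] := @mkl lo.+2 ltac:(lia).
have [x4 x4p] := @mkl lo.+3 ltac:(lia).
have [m' mE] : exists m', m = m'.+2 by exists (m - 2); lia.
have [IH1 IH2] := IH m' ltac:(lia) (lo + 4) ltac:(lia) ltac:(lia).
set A := labels lo _; set A' := labels (lo + 4) _ in IH1 IH2.
have fold c r : attach c set0 r (indep (x1 |: (x2 |: A')) conflict) ->
    attach c set0 r (indep A conflict).
  move=> h; apply: (@indep_fold _ _ _ _ _ x1 x3) => //.
  - by rewrite inE; lia.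
  - by rewrite inE; lia.
  - by rewrite -val_eqE /=; lia.
  - by rewrite confE; lia.
  - by move=> x; rewrite inE => xr; rewrite !confE; lia.
  (* With two rungs in all there is no second rail pair, so [x4] lies outside the strip. *)
  have [m0'|m0'] := posnP m'.
    rewrite (_ : A :\ x3 = x1 |: (x2 |: A')) //.
    by apply/setP => x; rewrite !inE -!val_eqE /=; lia.
  apply: (@indep_fold _ _ _ _ _ x1 x4) => //.
  - by rewrite !inE -val_eqE /=; lia.
  - by rewrite !inE -val_eqE /=; lia.
  - by rewrite -val_eqE /=; lia.
  - by rewrite confE; lia.
  - by move=> x; rewrite !inE => /andP[_ xr]; rewrite !confE; lia.
  rewrite (_ : A :\ x3 :\ x4 = x1 |: (x2 |: A')) //.
  by apply/setP => x; rewrite !inE -!val_eqE /=; lia.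
have susp c r : attach c set0 r (indep A' conflict) ->
    attach c.+1 set0 r (indep (x1 |: (x2 |: A')) conflict).
  apply: indep_susp_attach => //.
  - by rewrite inE; lia.
  - by rewrite inE; lia.
  - by rewrite confE; lia.
  - by move=> x; rewrite inE => xr; rewrite !confE; lia.
split=> om.
  rewrite (_ : m./2 = (m'./2).+1); last by lia.
  by apply/fold/susp/IH1; lia.
move=> c; apply: (@attach_card _ 1 _ _ 0) => //.
by apply/fold/susp/IH2; lia.
Qed.

(** Deleting the closing rail pair opens the cycle into a strip with [n] rungs. Its link is the
    strip of the [n - 2] rungs that it does not touch. *)
Lemma attach_dimers : (~~ odd n -> attach n./2 set0 2 (indep (labels 0 (2 * n)) conflict)) /\
  (odd n -> forall c, attach c set0 0 (indep (labels 0 (2 * n)) conflict)).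
Proof.
have se := conflict_sym; have ie := conflict_irrefl.
have [v vp] := @mkl (2 * n - 1) ltac:(lia).
have [d1 d2] := @attach_strip n 0 ltac:(lia) ltac:(lia).
have [l1 l2] := @attach_strip (n - 2) 2 ltac:(lia) ltac:(lia).
have delE : labels 0 (2 * n) :\ v = labels 0 (0 + (2 * n - 1)).
  by apply/setP => x; rewrite !inE -val_eqE /=; lia.
have lkE : [set x in labels 0 (2 * n) | (x != v) && ~~ conflict v x] =
    labels 2 (2 + (2 * (n - 2) - 1)).
  apply/setP => x; rewrite !inE -val_eqE /= /conflict /dimer_arc.
  case: (ltnP x (2 * n)) => xn; last by rewrite /=; lia.
  have pv : proj v = 2 * n - 1 by rewrite proj_small vp //; lia.
  rewrite pv proj_small // vp.
  rewrite (_ : ((2 * n - 1).+1 == x) = false); last lia.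
  rewrite (_ : ((2 * n - 1).+2 == x) = false); last lia.
  rewrite (_ : ((2 * n - 1).+1 == 2 * n) = true); last lia.
  rewrite (_ : (2 * n - 1 == 0) = false); last lia.
  rewrite (_ : (2 * n - 1 == 1) = false); last lia.
  rewrite (_ : odd x && (x.+2 == 2 * n - 1) = (x.+2 == 2 * n - 1)); last lia.
  by rewrite !andbF /= !orbF; lia.
have vA : v \in labels 0 (2 * n) by rewrite inE; lia.
split=> on.
  have -> : n./2 = ((n - 2)./2).+1 by lia.
  apply: (@indep_split _ _ 1 1 _ _ v) => //.
    by rewrite delE (_ : ((n - 2)./2).+1 = n./2); [apply: d1|lia].
  by rewrite lkE; apply: l1; lia.
move=> c; apply: (@attach_card _ 1 _ _ 0) => //.
apply: (@indep_split _ _ 0 0 _ _ v) => //.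
  by rewrite delE; apply: d2.
by rewrite lkE; apply: l2; lia.
Qed.

(** The label [2 * n + m] is a twin of [(2 * m).+1], so the second rails fold away one at a time. *)
Lemma attach_labels c r : attach c set0 r (indep (labels 0 (2 * n)) conflict) ->
  attach c set0 r (indep (labels 0 (3 * n)) conflict).
Proof.
have se := conflict_sym; have ie := conflict_irrefl.
move=> h; suff : forall m, m <= n -> attach c set0 r (indep (labels 0 (2 * n + m)) conflict).
  by move=> /(_ n (leqnn n)); rewrite (_ : 2 * n + n = 3 * n) //; lia.
elim=> [|m IH] mn; first by rewrite addn0.
have [v vp] := @mkl (2 * n + m) ltac:(lia).
have [u up] := @mkl (2 * m).+1 ltac:(lia).
have puv : proj u = proj v by rewrite proj_small ?proj_large; lia.
apply: (@indep_fold _ _ _ _ _ u v) => //.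
- by rewrite inE; lia.
- by rewrite inE; lia.
- by rewrite -val_eqE /=; lia.
- by rewrite /conflict puv -/(conflict v v) ie.
- by move=> x _; rewrite /conflict puv.
rewrite (_ : labels 0 (2 * n + m.+1) :\ v = labels 0 (2 * n + m)); first exact: IH (ltnW mn).
by apply/setP => x; rewrite !inE -val_eqE /=; lia.
Qed.

(* For odd [n], one of the two perfect matchings contained in the Hamiltonian
   cycle v_1 ... v_{2n}. *)
Definition alternating (b : bool) : {set label} := [set x : label | (x < 3 * n) &&
  (if x < 2 * n then odd x && (odd x./2 (+) b) else ~~ (odd x (+) b))].

Definition position (x : label) := (proj x)./2.

(** For odd [n] an alternating matching contains one rail of each opposite pair, and two of its
    rails conflict exactly when their pairs are cyclically consecutive: [position] identifies the
    conflict graph with an [n]-cycle. *)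
Lemma attach_alternating b c r : odd n ->
  (n %% 3 = 0 /\ c = n %/ 3 /\ r = 2) \/
  (n %% 3 = 1 /\ c = n %/ 3 /\ r = 1) \/
  (n %% 3 = 2 /\ c = (n %/ 3).+1 /\ r = 1) ->
  attach c set0 r (indep (alternating b) conflict).
Proof.
move=> on cr; apply: (@attach_cycle _ _ position conflict_sym conflict_irrefl _ n) => //.
- lia.
- move=> x y; rewrite !inE /position /proj => xA yA xy; apply/val_inj => /=.
  move: xA yA xy; case: (ltnP x (2 * n)) => ?; case: (ltnP y (2 * n)) => ?;
  case: b; lia.
- by move=> x; rewrite inE /position /proj; case: (ltnP x (2 * n)); lia.
- move=> i i_n; have [oi|oi] := boolP (odd i (+) b).
    have [x xk] := @mkl (2 * i).+1 ltac:(lia).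
    have x2n : x < 2 * n by lia.
    exists x; last by rewrite /position proj_small // xk; lia.
    by rewrite inE x2n xk; case: (b) oi; lia.
  have [x xk] := @mkl (2 * n + i) ltac:(lia).
  have x2n : 2 * n <= x by lia.
  exists x; last by rewrite /position proj_large // xk; lia.
  by rewrite inE (ltnNge x (2 * n)) x2n /= xk; case: (b) oi; lia.
- move=> x y; rewrite !inE /conflict /dimer_arc /position => xA yA.
  have ox : odd (proj x) by move: xA; rewrite /proj; case: (ltnP x (2 * n)); lia.
  have oy : odd (proj y) by move: yA; rewrite /proj; case: (ltnP y (2 * n)); lia.
  have px : proj x < 2 * n by move: xA; rewrite /proj; case: (ltnP x (2 * n)); lia.
  have py : proj y < 2 * n by move: yA; rewrite /proj; case: (ltnP y (2 * n)); lia.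
  move: ox oy px py; move: (proj x) (proj y) => p q op oq pn qn.
  have ne i j : odd i -> odd j -> (i.+1 == j) = false by lia.
  have e0 i : odd i -> (i == 0) = false by lia.
  have e1 i : odd i -> (i == 1) = (i./2 == 0) by lia.
  have e2 i j : odd i -> odd j -> (i.+2 == j) = (i./2.+1 == j./2) by lia.
  have en i : odd i -> (i.+1 == 2 * n) = (i./2.+1 == n) by lia.
  rewrite (ne p q) // (ne q p) // (e2 p q) // (e2 q p) // (en p) // (en q) //.
  rewrite (e0 p) // (e0 q) // (e1 p) // (e1 q) // op oq !andbF /=.
  by rewrite orbACA !orbA [(q./2 == 0) && _]andbC [(p./2 == 0) && _]andbC -!orbA;
    congr (_ || (_ || _)); rewrite orbC.
Qed.

Lemma alternating_witness b : exists x, x \in alternating b.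
Proof.
have [x xk] := @mkl (2 * n + b) ltac:(lia).
by exists x; rewrite inE xk (_ : 2 * n + b < 2 * n = false); lia.
Qed.

Lemma alternating_disjoint b x : x \in alternating b -> x \notin alternating (~~ b).
Proof. by rewrite !inE; case: (ltnP x (2 * n)); lia. Qed.

Lemma fresh_labels (p := inord (3 * n) : label) (q := inord (3 * n).+1 : label) :
  [/\ p \notin labels 0 (3 * n) /\ p \in labels 0 (3 * n + 2),
      q \notin labels 0 (3 * n) /\ q \in labels 0 (3 * n + 2) & p != q].
Proof.
have pv : p = 3 * n :> nat by rewrite /p inordK; lia.
have qv : q = (3 * n).+1 :> nat by rewrite /q inordK; lia.
by split; [split|split|]; rewrite ?inE -?val_eqE /= ?pv ?qv; lia.
Qed.

(* A perfect matching is invariant under exchanging opposite rails, and then it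
   is an independent set of [conflict] saturated by rungs, unless it is one of the
   two alternating ones. *)
Definition dimer_complex : {set {set label}} :=
  if odd n then indep (labels 0 (3 * n)) conflict :|: powerset (alternating true)
    :|: powerset (alternating false)
  else indep (labels 0 (3 * n)) conflict.

Lemma dimer_complex_even k : n = 2 * k ->
  sph (labels 0 (3 * n)) k 2 dimer_complex.
Proof.
move=> nk; have on : ~~ odd n by lia.
rewrite /dimer_complex (negbTE on); apply: sph_attach_indep; apply: attach_labels.
by have [h _] := attach_dimers; have -> : k = n./2; [lia|exact: h].
Qed.

(** The two alternating matchings are disjoint, so the gluings do not interfere: each simplex is
    replaced by a cone, from its own apex, over the complex of an [n]-cycle. The common part [M]
    needs no cells, and each cone contributes the [r] cells of its cycle with one more element. *)
Lemma dimer_complex_odd c r : odd n ->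
  (n %% 3 = 0 /\ c = n %/ 3 /\ r = 2) \/
  (n %% 3 = 1 /\ c = n %/ 3 /\ r = 1) \/
  (n %% 3 = 2 /\ c = (n %/ 3).+1 /\ r = 1) ->
  sph (labels 0 (3 * n + 2)) c.+1 (r + r) dimer_complex.
Proof.
move=> on cr; rewrite /dimer_complex on.
set M := indep _ conflict; set SA := alternating true; set SB := alternating false.
pose p : label := inord (3 * n); pose q : label := inord (3 * n).+1.
have := fresh_labels; rewrite -/p -/q => -[[pE pB] [qE qB] pq].
set B := labels 0 _.
have dM : down_closed M by exact: indep_down_closed.
have M0 : set0 \in M by exact: indep_set0.
have EB : labels 0 (3 * n) \subset B.
  by apply/subsetP => x; rewrite !inE => /leq_trans -> //; exact: leq_addr.
have MB : M \subset powerset B.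
  by apply: subset_trans (indep_powerset _ _) _; rewrite powersetS.
have SE b : alternating b \subset labels 0 (3 * n).
  by apply/subsetP => x; rewrite !inE => /andP[].
have fresh (x : label) (t : {set label}) :
    x \notin labels 0 (3 * n) -> t \subset labels 0 (3 * n) -> x \notin t.
  by move=> xE /subsetP tE; apply: contra xE; exact: tE.
have ME t : t \in M -> t \subset labels 0 (3 * n) by move=> /indepP[].
have MS (b : bool) : M :&: powerset (alternating b) = indep (alternating b) conflict.
  apply/setP => t; rewrite in_setI [t \in powerset _]inE; apply/andP/indepP => -[].
    by move=> /indepP[_ h] tS.
  by move=> tS h; split=> //; apply/indepP; split=> //; exact: subset_trans tS (SE b).
have [xa xaA] := alternating_witness true.
have [xb xbB] := alternating_witness false.
have SAB (t : {set label}) : t \subset SA -> t \subset SB -> t = set0.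
  move=> /subsetP tA /subsetP tB; apply/setP => x; rewrite inE; apply/negP => xt.
  by have := alternating_disjoint (tA _ xt); rewrite /= tB.
have PB (b : bool) : powerset (alternating b) \subset powerset B.
  by rewrite powersetS (subset_trans (SE b)).
apply: (@sph_glue_simplex _ _ _ _ _ _ xb q) => //.
- by apply: down_closedU => //; exact: down_closed_powerset.
- by rewrite subUset MB PB.
- exact: subset_trans (SE _) EB.
- by move=> t; rewrite in_setU powersetE => /orP[/ME|/subset_trans/(_ (SE _))]; exact: fresh.
- exact: fresh (SE _).
- by rewrite inE M0.
have -> : (M :|: powerset SA) :&: powerset SB = indep SB conflict.
  rewrite -MS setIUl; apply/setUidPl/subsetP => t.
  rewrite in_setI !powersetE => /andP[tA tB].
  by rewrite (SAB t) // in_setI M0 powersetE sub0set.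
rewrite setUAC.
apply: (@sph_glue_simplex _ _ _ _ _ _ xa p) => //.
- apply: down_closed_join => //; first exact: indep_down_closed.
  by rewrite -MS subsetIl.
- rewrite subUset MB /=; apply/subsetP => t /imsetP[s /indepP[sS _] ->].
  by rewrite inE subUset sub1set qB (subset_trans sS) // (subset_trans (SE _)).
- exact: subset_trans (SE _) EB.
- move=> t; rewrite in_setU => /orP[/ME|/imsetP[s /indepP[sS _] ->]]; first exact: fresh.
  by rewrite !inE negb_or pq (fresh _ _ pE (subset_trans sS (SE _))).
- exact: fresh (SE _).
- by rewrite inE M0.
have -> : (M :|: join1 q (indep SB conflict)) :&: powerset SA = indep SA conflict.
  rewrite -(MS true) setIUl; apply/setUidPl/subsetP => t.
  rewrite in_setI => /andP[/imsetP[s _ ->]]; rewrite inE => /subsetP/(_ q).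
  rewrite setU11 => /(_ isT) qA.
  by have := subsetP (SE _) _ qA; rewrite (negbTE qE).
apply: sph_attach.
  rewrite !subUset MB /=; apply/andP; split.
    apply/subsetP => t /imsetP[s /indepP[sS _] ->].
    by rewrite inE subUset sub1set qB (subset_trans sS) // (subset_trans (SE _)).
  apply/subsetP => t /imsetP[s /indepP[sS _] ->].
  by rewrite inE subUset sub1set pB (subset_trans sS) // (subset_trans (SE _)).
rewrite -[r + r]add0n addnA.
apply: (attach_trans (K1 := M :|: join1 q (indep SB conflict))).
  apply: (attach_trans (K1 := M)).
    by have [_ h] := attach_dimers; exact/attach_labels/h.
  apply: attach_join.
  - exact: attach_alternating.
  - by rewrite -MS subsetIl.
  - by move=> t /ME; exact: fresh.
apply: attach_join.
- exact: attach_alternating.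
- by rewrite -MS (subset_trans (subsetIl _ _)) // subsetUl.
- move=> t; rewrite in_setU => /orP[/ME|/imsetP[s /indepP[sS _] ->]]; first exact: fresh.
  by rewrite !inE negb_or pq (fresh _ _ pE (subset_trans sS (SE _))).
Qed.

End Labels.

(** * Perfect matchings as exact covers *)

Section Covers.
Variable n : nat.
Hypothesis n2 : 1 < n.
Notation label := (label n).

Definition one3 (a b c : bool) : bool := (a + b + c == 1)%N.

(* The two rails and the rung at the vertex [v]. *)
Definition incident (v : nat) : nat * nat * nat :=
  if v == 0 then (1, (3 * n).-1, 0) else
  if v < n then ((2 * v).+1, (2 * v).-1, 2 * v) else
  if v == n then (2 * n, (2 * n).-1, 0) else (n + v, (n + v).-1, 2 * (v - n)).

Definition exact_cover (t : nat -> bool) := forall v, v < 2 * n ->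
  one3 (t (incident v).1.1) (t (incident v).1.2) (t (incident v).2).

(** The equations are regular at all places but the vertices 0 and [n], where the twist joins the
    end of one rail to the beginning of the other. *)
Lemma exact_coverP t : exact_cover t <->
  [/\ forall k, 0 < k < n -> one3 (t (2 * k).+1) (t (2 * k).-1) (t (2 * k)),
      forall k, 0 < k < n -> one3 (t (2 * n + k)) (t (2 * n + k).-1) (t (2 * k)),
      one3 (t 1) (t (3 * n).-1) (t 0) & one3 (t (2 * n)) (t (2 * n).-1) (t 0)].
Proof.
split=> [h|[h1 h2 h3 h4] v vn].
- split.
  + move=> k /andP[k0 kn]; have := h k ltac:(lia).
    by rewrite /incident (gtn_eqF k0) kn.
  + move=> k /andP[k0 kn]; have := h (n + k) ltac:(lia).
    rewrite /incident (_ : (n + k == 0) = false); last lia.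
    rewrite (_ : (n + k < n) = false); last lia.
    rewrite (_ : (n + k == n) = false); last lia.
    by rewrite addnA addnn -mul2n addKn.
  + by have := h 0 ltac:(lia).
  + have := h n ltac:(lia).
    by rewrite /incident (_ : (n == 0) = false) ?ltnn ?eqxx //; lia.
- rewrite /incident; have [//|v0] := eqVneq v 0.
  have [vn'|nv] := ltnP v n; first by apply: h1; lia.
  have [//|vn'] := eqVneq v n.
  by have := h2 (v - n) ltac:(lia); rewrite (_ : 2 * n + (v - n) = n + v) //; lia.
Qed.

Definition charf (T : {set label}) (k : nat) : bool := inord k \in T.

Lemma charfE (T : {set label}) (x : label) : charf T x = (x \in T).
Proof. by rewrite /charf inord_val. Qed.

Lemma in_dimer_complex_alternating (b : bool) (T : {set label}) : odd n ->
  T \subset alternating n b -> T \in dimer_complex n.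
Proof.
move=> on Tb; rewrite /dimer_complex on !in_setU !powersetE.
by case: b Tb => ->; rewrite !orbT.
Qed.

Lemma indep_dimer_complex (T : {set label}) : T \in indep (labels n 0 (3 * n)) (@conflict n) ->
  T \in dimer_complex n.
Proof. by move=> h; rewrite /dimer_complex; case: ifP => _; rewrite ?in_setU h. Qed.

Lemma dimer_complex_down_closed : down_closed (dimer_complex n).
Proof.
rewrite /dimer_complex; case: ifP => _; last exact: indep_down_closed.
apply: down_closedU; last exact: down_closed_powerset.
by apply: down_closedU; [exact: indep_down_closed|exact: down_closed_powerset].
Qed.

Lemma one3_12 a b c : one3 a b c -> ~~ (a && b).
Proof. by case: a; case: b; case: c. Qed.

Lemma one3_13 a b c : one3 a b c -> ~~ (a && c).
Proof. by case: a; case: b; case: c. Qed.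

Lemma one3_23 a b c : one3 a b c -> ~~ (b && c).
Proof. by case: a; case: b; case: c. Qed.

Lemma one3_swap a b a' b' c : one3 a b c -> one3 a' b' c -> (a == a') = (b == b').
Proof. by case: a; case: b; case: c; case: a'; case: b'. Qed.

Lemma one3_neg a b c : one3 a b c -> one3 (~~ a) (~~ b) c -> c = false /\ a = ~~ b.
Proof. by case: a; case: b; case: c. Qed.

Lemma exact_cover_even t j : exact_cover t -> ~~ odd j -> 0 < j < 2 * n ->
  one3 (t j.+1) (t j.-1) (t j).
Proof.
move=> /exact_coverP[h _ _ _] oj jn; have := h j./2 ltac:(lia).
by rewrite mul2n halfK (negbTE oj) subn0.
Qed.

(** Opposite vertices share their rung, so whether opposite rails agree passes from each rail pair
    to the next: the answer is the same for all pairs. *)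
Lemma exact_cover_shift t k : exact_cover t -> k < n ->
  (t (2 * k).+1 == t (2 * n + k)) = (t 1 == t (2 * n)).
Proof.
move=> /exact_coverP[h1 h2 _ _]; elim: k => [|k IH] kn; first by rewrite muln0 addn0.
rewrite -IH; last exact: ltnW.
have := h2 k.+1 kn; have := h1 k.+1 kn; rewrite addnS mulnS /= => e1 e2.
by rewrite (one3_swap e1 e2) eq_sym.
Qed.

(** For every arc a vertex is covered twice. Symmetry enters only for the last and the first rail
    pair: across the twist the rail [(2 * n).-1] meets [2 * n], not 1. *)
Lemma exact_cover_arc t a b : exact_cover t ->
  (forall k, k < n -> t (2 * n + k) = t (2 * k).+1) ->
  a < 2 * n -> b < 2 * n -> t a -> t b -> ~~ dimer_arc n a b.
Proof.
move=> ct sym an bn ta tb; have /exact_coverP[_ _ h3 h4] := ct.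
apply/negP => /or4P[/eqP ab|/andP[oa /eqP ab]|/andP[/eqP a2n /eqP b0]|/andP[/eqP a2n /eqP b1]].
- have [oa|oa] := boolP (odd a).
    rewrite -ab in bn; have := exact_cover_even (j := b) ct; rewrite -ab /= oa bn.
    by move=> /(_ isT isT)/one3_23; rewrite ta ab tb.
  have [a0|a0] := posnP a.
    by have := one3_13 h3; rewrite -{1}a0 ab tb -a0 ta.
  have := exact_cover_even ct oa; rewrite a0 an => /(_ isT)/one3_13.
  by rewrite ab tb ta.
- have := exact_cover_even (j := a.+1) ct; rewrite /= oa.
  move=> /(_ isT)/(_ ltac:(lia))/one3_12.
  by rewrite ab tb ta.
- have := one3_23 h4; rewrite -a2n /= ta -b0 tb //.
- have t1 : t 1 by rewrite -b1.
  have tn : t (2 * n).-1 by rewrite -a2n.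
  by have := one3_12 h4; have := sym 0 (ltnW n2); rewrite addn0 muln0 t1 tn => ->.
Qed.

(** With complementary opposite rails, the rails at two opposite vertices already account for both
    covers, so no rung occurs and the rails alternate. Closing up through the twist forces [n] to be
    odd. *)
Lemma exact_cover_alternates t : exact_cover t ->
  (forall k, k < n -> t (2 * n + k) = ~~ t (2 * k).+1) ->
  [/\ forall k, k < n -> t (2 * k) = false,
      forall k, k < n -> t (2 * k).+1 = t 1 (+) odd k & odd n].
Proof.
move=> /exact_coverP[h1 h2 h3 h4] neg.
have e1 : (t 0 = false) /\ (t 1 = ~~ ~~ t (2 * n).-1).
  have t2n : t (2 * n) = ~~ t 1 by rewrite -[in LHS](addn0 (2 * n)) neg ?muln0 // ltnW.
  have t3n : t (3 * n).-1 = ~~ t (2 * n).-1.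
    rewrite (_ : (3 * n).-1 = 2 * n + n.-1); last lia.
    by rewrite neg; [congr (~~ t _)|]; lia.
  apply: one3_neg; first by rewrite -t3n.
  by rewrite -t2n negbK.
have e2 k : 0 < k < n -> (t (2 * k) = false) /\ (t (2 * k).+1 = ~~ t (2 * k).-1).
  move=> kn; apply: one3_neg (h1 k kn) _; have := h2 k kn.
  rewrite neg; last by case/andP: kn.
  rewrite (_ : (2 * n + k).-1 = 2 * n + k.-1); last lia.
  by rewrite neg; [rewrite (_ : (2 * k.-1).+1 = (2 * k).-1)|]; lia.
have alt k : k < n -> t (2 * k).+1 = t 1 (+) odd k.
  elim: k => [|k IH] kn; first by rewrite muln0 addbF.
  have [_ ->] := e2 k.+1 kn; rewrite mulnS /= IH ?(ltnW kn) //.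
  by rewrite addbN.
split=> //.
  by move=> k kn; have [->|k0] := posnP k; [rewrite muln0; case: e1|case: (e2 k); rewrite ?k0].
have [_] := e1; rewrite negbK (_ : (2 * n).-1 = (2 * n.-1).+1); last lia.
rewrite alt; last lia.
rewrite (_ : odd n = ~~ odd n.-1); last lia.
by case: (t 1); case: (odd _).
Qed.

Lemma exact_cover_dimer_complex (T : {set label}) : T \subset labels n 0 (3 * n) ->
  exact_cover (charf T) -> T \in dimer_complex n.
Proof.
move=> /subsetP TL ct.
have T3 x : x \in T -> x < 3 * n by move/TL; rewrite inE => /andP[].
have shift := exact_cover_shift ct.
have [d0|d0] := boolP (charf T 1 == charf T (2 * n)).
  have sym k : k < n -> charf T (2 * n + k) = charf T (2 * k).+1.
    by move=> /shift; rewrite d0 => /eqP.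
  apply: indep_dimer_complex; apply/indepP; split; first exact/subsetP.
  have tproj x : x \in T -> charf T (proj n x).
    move=> xT; have x3 := T3 x xT; have [x2|x2] := ltnP x (2 * n).
      by rewrite proj_small // charfE.
    rewrite proj_large // mulnC -sym; last lia.
    by rewrite subnKC // charfE.
  have proj2n x : x \in T -> proj n x < 2 * n.
    by move=> /T3; rewrite /proj; case: (ltnP x (2 * n)); lia.
  move=> x y xT yT; rewrite /conflict negb_or.
  by rewrite !(exact_cover_arc ct sym) ?tproj ?proj2n.
have neg k : k < n -> charf T (2 * n + k) = ~~ charf T (2 * k).+1.
  by move=> /shift; rewrite (negbTE d0); case: (charf T _); case: (charf T _).
have [rung alt on] := exact_cover_alternates ct neg.
apply: (@in_dimer_complex_alternating (charf T 1)) => //; apply/subsetP => x xT.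
have x3 := T3 x xT; rewrite inE x3 /=; have [x2|x2] := ltnP x (2 * n).
  have [ox|ox] := boolP (odd x).
    have := alt x./2 ltac:(lia); rewrite (_ : (2 * x./2).+1 = x); last lia.
    by rewrite charfE xT addbC => <-.
  have := rung x./2 ltac:(lia); rewrite (_ : 2 * x./2 = x); last lia.
  by rewrite charfE xT.
have := neg (x - 2 * n) ltac:(lia); rewrite subnKC // charfE xT alt; last lia.
by rewrite (_ : odd (x - 2 * n) = odd x); [rewrite addbC => <-|lia].
Qed.

Lemma charf_set (P : nat -> bool) k : k < 3 * n ->
  charf [set x : label | (x < 3 * n) && P x] k = P k.
Proof. by move=> kn; rewrite /charf inE inordK ?kn //; lia. Qed.

Lemma exact_cover_eq t t' : (forall k, k < 3 * n -> t k = t' k) ->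
  exact_cover t' -> exact_cover t.
Proof.
move=> tt' /exact_coverP[h1 h2 h3 h4]; apply/exact_coverP; split.
- by move=> k kn; rewrite !tt'; try lia; exact: h1.
- by move=> k kn; rewrite !tt'; try lia; exact: h2.
- by rewrite !tt'; try lia; exact: h3.
- by rewrite !tt'; try lia; exact: h4.
Qed.

Lemma exact_cover_alternating b : odd n -> exact_cover (charf (alternating n b)).
Proof.
move=> on.
pose P k := if k < 2 * n then odd k && (odd k./2 (+) b) else ~~ (odd k (+) b).
apply: (@exact_cover_eq _ P); first by move=> k kn; exact: (charf_set P).
apply/exact_coverP; rewrite /P; split.
- move=> k kn; rewrite !ifT; try lia.
  rewrite (_ : (2 * k).+1./2 = k); last lia.
  rewrite (_ : (2 * k).-1./2 = k.-1); last lia.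
  rewrite (_ : odd (2 * k).+1 = true); last lia.
  rewrite (_ : odd (2 * k).-1 = true); last lia.
  rewrite (_ : odd (2 * k) = false); last lia.
  rewrite (_ : odd k.-1 = ~~ odd k); last lia.
  by case: (odd k); case: (b).
- move=> k kn; rewrite (_ : 2 * n + k < 2 * n = false); last lia.
  rewrite (_ : (2 * n + k).-1 < 2 * n = false); last lia.
  rewrite ifT; last lia.
  rewrite (_ : odd (2 * n + k).-1 = ~~ odd k); last lia.
  rewrite (_ : odd (2 * k) = false); last lia.
  rewrite (_ : odd (2 * n + k) = odd k); last lia.
  by case: (odd k); case: (b).
- rewrite (_ : (3 * n).-1 < 2 * n = false); last lia.
  rewrite (_ : odd (3 * n).-1 = false); last lia.
  by rewrite !ifT; try lia; case: (b).
- rewrite ltnn; rewrite !ifT; try lia.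
  rewrite (_ : (2 * n).-1./2 = n.-1); last lia.
  rewrite (_ : odd n.-1 = false); last lia.
  rewrite (_ : odd (2 * n).-1 = true); last lia.
  rewrite (_ : odd (2 * n) = false); last lia.
  by case: (b).
Qed.

Definition covers_gap (s : {set label}) k := charf s (2 * k).+1 || charf s (2 * n + k).

Definition prev k := if k == 0 then n.-1 else k.-1.

Lemma prev_lt k : k < n -> prev k < n.
Proof. by rewrite /prev; case: eqP; lia. Qed.

Lemma conflictP (s : {set label}) x y : s \in indep (labels n 0 (3 * n)) (@conflict n) ->
  charf s x -> charf s y -> x < 3 * n -> y < 3 * n ->
  ~~ dimer_arc n (proj n x) (proj n y).
Proof.
move=> /indepP[_ h] sx sy xn yn; have := h _ _ sx sy.
by rewrite /conflict !inordK ?negb_or; [case/andP|lia|lia].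
Qed.

Lemma covers_gapP (s : {set label}) k : k < n -> covers_gap s k ->
  exists x, [/\ charf s x, x < 3 * n & proj n x = (2 * k).+1].
Proof.
move=> kn /orP[sk|sk]; [exists (2 * k).+1|exists (2 * n + k)]; split=> //; try lia.
  by rewrite proj_small; lia.
by rewrite proj_large; lia.
Qed.

Lemma dimer_arc_prev k : k < n ->
  dimer_arc n (2 * prev k).+1 (2 * k).+1 && dimer_arc n (2 * prev k).+1 (2 * k).
Proof. by move=> kn; rewrite /prev; have [->|k0] := eqVneq k 0; rewrite /dimer_arc; lia. Qed.

(** The extension takes both rails of each pair that [s] meets, and the rung wherever neither
    adjacent rail pair is taken. Independence of [s] prevents consecutive rail pairs from both being
    taken. *)
Lemma exact_cover_extension (s : {set label}) :
  s \in indep (labels n 0 (3 * n)) (@conflict n) ->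
  exists T : {set label}, [/\ s \subset T, T \subset labels n 0 (3 * n) & exact_cover (charf T)].
Proof.
move=> sI; pose C := covers_gap s.
have CC k : k < n -> ~~ (C k && C (prev k)).
  move=> kn; apply/negP => /andP[/(covers_gapP kn)[x [sx xn px]]].
  move=> /(covers_gapP (prev_lt kn))[y [sy yn py]].
  have := conflictP sI sy sx yn xn; rewrite px py.
  by have /andP[-> _] := dimer_arc_prev kn.
pose P x := if (x < 2 * n) && ~~ odd x then ~~ C x./2 && ~~ C (prev x./2) else C (proj n x)./2.
have [sL _] := indepP _ _ _ sI; move/subsetP: sL => sL.
exists [set x : label | (x < 3 * n) && P x]; split.
- apply/subsetP => x xs; have x3 : x < 3 * n by have := sL x xs; rewrite inE.
  have cx : charf s x by rewrite charfE.
  rewrite inE x3 /P /=; case: (ltnP x (2 * n)) => x2 /=; last first.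
    rewrite proj_large //; apply/orP; right.
    by rewrite (_ : 2 * n + (_.+1)./2 = x) //; lia.
  have [ox|ox] := boolP (odd x) => /=.
    rewrite proj_small //; apply/orP; left.
    by rewrite (_ : (2 * x./2).+1 = x) //; lia.
  have k_n : x./2 < n by lia.
  have px : proj n x = 2 * x./2 by rewrite proj_small //; lia.
  apply/andP; split; apply/negP.
    move=> /(covers_gapP k_n)[y [sy yn py]].
    have := conflictP sI cx sy x3 yn; rewrite px py.
    by rewrite /dimer_arc eqxx.
  move=> /(covers_gapP (prev_lt k_n))[y [sy yn py]].
  have := conflictP sI sy cx yn x3; rewrite px py.
  by have /andP[_ ->] := dimer_arc_prev k_n.
- by apply/subsetP => x; rewrite !inE => /andP[].
apply: (@exact_cover_eq _ P); first by move=> k kn; exact: (charf_set P).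
have Pe k : k < n -> P (2 * k) = ~~ C k && ~~ C (prev k).
  by move=> kn; rewrite /P ifT; [rewrite (_ : (2 * k)./2 = k)|]; lia.
have Po k : k < n -> P (2 * k).+1 = C k.
  move=> kn; rewrite /P ifF; last lia.
  by rewrite proj_small; [rewrite (_ : (2 * k).+1./2 = k)|]; lia.
have Pl k : k < n -> P (2 * n + k) = C k.
  move=> kn; rewrite /P ifF; last lia.
  by rewrite proj_large; [rewrite (_ : (_.+1)./2 = k)|]; lia.
have one k : k < n -> one3 (C k) (C (prev k)) (~~ C k && ~~ C (prev k)).
  by move=> /CC; case: (C k); case: (C _).
have prevE k : 0 < k -> prev k = k.-1 by rewrite /prev; case: k.
apply/exact_coverP; split.
- move=> k /andP[k0 kn]; rewrite Pe // Po // (_ : (2 * k).-1 = (2 * k.-1).+1); last lia.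
  by rewrite Po -?prevE //; [exact: one|exact: prev_lt].
- move=> k /andP[k0 kn]; rewrite Pe // Pl // (_ : (2 * n + k).-1 = 2 * n + k.-1); last lia.
  by rewrite Pl -?prevE //; [exact: one|exact: prev_lt].
- have n0 : 0 < n by lia.
  have := one 0 n0; rewrite -Pe // -Po // -Pl; last exact: prev_lt.
  by rewrite muln0 /prev eqxx (_ : 2 * n + n.-1 = (3 * n).-1) //; lia.
- have n0 : 0 < n by lia.
  have := one 0 n0; rewrite -Pe // -Pl // -Po; last exact: prev_lt.
  by rewrite muln0 addn0 /prev eqxx (_ : (2 * n.-1).+1 = (2 * n).-1) //; lia.
Qed.

Lemma dimer_complexP (s : {set label}) : s \in dimer_complex n <->
  exists T : {set label}, [/\ s \subset T, T \subset labels n 0 (3 * n) & exact_cover (charf T)].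
Proof.
split=> [|[T [sT TL cT]]]; last first.
  by apply: dimer_complex_down_closed sT; exact: exact_cover_dimer_complex.
have alt b : odd n -> s \subset alternating n b ->
    exists T : {set label}, [/\ s \subset T, T \subset labels n 0 (3 * n) & exact_cover (charf T)].
  move=> on sb; exists (alternating n b); split=> //; last exact: exact_cover_alternating.
  by apply/subsetP => x; rewrite !inE => /andP[].
rewrite /dimer_complex; case: ifP => on; last exact: exact_cover_extension.
rewrite !in_setU !powersetE -orbA => /or3P[|/(alt _ on)//|/(alt _ on)//].
exact: exact_cover_extension.
Qed.

End Covers.

(** * Labels as edges of the Möbius ladder *)

Section MobiusEdges.
Variable n : nat.
Hypothesis n2 : 1 < n.
Notation label := (label n).
Notation L3 := (labels n 0 (3 * n)).

Definition edge_lo (x : nat) := if x < 2 * n then x./2 else x - n.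

Definition edge_hi (x : nat) :=
  if x < 2 * n then (if odd x then x./2.+1 else x./2 + n)
  else if x.+1 == 3 * n then 0 else (x - n).+1.

Definition edge_of (x : label) : {set 'I_(2 * n)} :=
  [set v : 'I_(2 * n) | (v == edge_lo x :> nat) || (v == edge_hi x :> nat)].

(** The four kinds of edges are rungs, rails starting in the first half, rails starting in the
    second half, and the closing edge. Arbitrary numbers in place of the ends reduce later goals to
    linear arithmetic. *)
Lemma label_ind (P : nat -> nat -> nat -> Prop) :
  (forall i, i < n -> P (2 * i) i (i + n)) ->
  (forall i, i < n -> P (2 * i).+1 i i.+1) ->
  (forall i, n <= i < (2 * n).-1 -> P (i + n) i i.+1) ->
  P (3 * n).-1 (2 * n).-1 0 ->
  forall x, x < 3 * n -> P x (edge_lo x) (edge_hi x).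
Proof.
move=> h1 h2 h3 h4 x x3; rewrite /edge_lo /edge_hi.
have [x2|x2] := ltnP x (2 * n).
  have [ox|ox] := boolP (odd x).
    by have := h2 x./2 ltac:(lia); rewrite (_ : (2 * x./2).+1 = x) //; lia.
  by have := h1 x./2 ltac:(lia); rewrite (_ : 2 * x./2 = x) //; lia.
have [xn|xn] := eqVneq x.+1 (3 * n).
  have <- : (3 * n).-1 = x by lia.
  by rewrite (_ : (3 * n).-1 - n = (2 * n).-1) //; lia.
by have := h3 (x - n) ltac:(lia); rewrite subnK //; lia.
Qed.

Lemma edge_shape x : x < 3 * n -> exists i,
  [\/ [/\ i < n, x = 2 * i, edge_lo x = i & edge_hi x = i + n],
      [/\ i < n, x = (2 * i).+1, edge_lo x = i & edge_hi x = i.+1],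
      [/\ n <= i < (2 * n).-1, x = i + n, edge_lo x = i & edge_hi x = i.+1] |
      [/\ i = (2 * n).-1, x = (3 * n).-1, edge_lo x = i & edge_hi x = 0]].
Proof.
apply: (@label_ind (fun x l h => exists i, [\/ [/\ i < n, x = 2 * i, l = i & h = i + n],
  [/\ i < n, x = (2 * i).+1, l = i & h = i.+1],
  [/\ n <= i < (2 * n).-1, x = i + n, l = i & h = i.+1] |
  [/\ i = (2 * n).-1, x = (3 * n).-1, l = i & h = 0]])) => [i i_n|i i_n|i i_n|].
- by exists i; constructor 1.
- by exists i; constructor 2.
- by exists i; constructor 3.
- by exists (2 * n).-1; constructor 4.
Qed.

Lemma edge_ends x : x < 3 * n -> edge_lo x < 2 * n /\ edge_hi x < 2 * n.
Proof. by apply: (@label_ind (fun x l h => l < 2 * n /\ h < 2 * n)) => [i|i|i|]; lia. Qed.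

(** This ties the table [incident] to the ends of the edges. *)
Lemma edge_incident (x : label) (v : 'I_(2 * n)) : x < 3 * n -> (v \in edge_of x) =
  [|| x == (incident n v).1.1 :> nat, x == (incident n v).1.2 :> nat |
      x == (incident n v).2 :> nat].
Proof.
move=> x3; rewrite inE; have := ltn_ord v; move: (v : nat) => {}v vn.
move: (x : nat) x3 => {}x.
apply: (@label_ind (fun x l h => (v == l) || (v == h) =
  [|| x == (incident n v).1.1, x == (incident n v).1.2 | x == (incident n v).2])).
all: rewrite /incident; (have [v0|v0] := eqVneq v 0); [|have [v1|v1] := ltnP v n;
  [|have [v2|v2] := eqVneq v n]] => /=; lia.
Qed.

Lemma edge_of_inj : {in L3 &, injective edge_of}.
Proof.
move=> x y; rewrite !inE => xn yn /setP xy; apply: val_inj => /=.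
have {}xy v : v < 2 * n -> (v == edge_lo x) || (v == edge_hi x) =
    ((v == edge_lo y) || (v == edge_hi y)).
  by move=> vn; have := xy (Ordinal vn); rewrite !inE.
have [] := edge_ends xn; have [] := edge_ends yn.
move: (x : nat) xn xy => {}x xn; move: (y : nat) yn => {}y yn.
move=> xy yh yl xh xl.
have := xy _ xl; have := xy _ xh; have := xy _ yl; have := xy _ yh.
clear xy xl xh yl yh; rewrite !eqxx /= !orbT.
have [i xi] := edge_shape xn; have [j yj] := edge_shape yn.
by case: xi => -[? -> -> ->]; case: yj => -[? -> -> ->]; lia.
Qed.

Let G := mobius_ladder n.

Lemma edge_of_edges (x : label) : x < 3 * n -> edge_of x \in edges G.
Proof.
move=> xn; have [ln hn] := edge_ends xn.
rewrite inE; apply/existsP; exists (Ordinal ln); apply/existsP; exists (Ordinal hn).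
apply/andP; split; last first.
  by apply/eqP/setP => v; rewrite !inE.
rewrite /= /mobius_adj /mobius_arc /=.
by have [i xi] := edge_shape xn; case: xi => -[? _ -> ->]; lia.
Qed.

Lemma edges_edge_of e : e \in edges G -> exists2 x, x \in L3 & e = edge_of x.
Proof.
rewrite inE => /existsP[a /existsP[b /andP[ab /eqP ->]]].
wlog {ab} : a b / mobius_arc a b.
  by move=> h; case/orP: ab => /h // [x xL E]; exists x; rewrite // -E setUC.
have mk k (a' b' : 'I_(2 * n)) : k < 3 * n -> a' = edge_lo k :> nat -> b' = edge_hi k :> nat ->
    exists2 x, x \in L3 & [set a'; b'] = edge_of x.
  move=> kn al bh; have kv : (inord k : label) = k :> nat by rewrite inordK //; lia.
  exists (inord k); first by rewrite inE kv.
  by apply/setP => v; rewrite !inE kv -al -bh.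
have := ltn_ord a; have := ltn_ord b => bn an.
case/or3P => [/eqP ab|/andP[/eqP a0 /eqP b0]|/andP[a_n /eqP ab]].
- have [a_n|a_n] := ltnP a n.
    by apply: (mk (2 * a).+1); rewrite /edge_lo /edge_hi ?ifT; lia.
  by apply: (mk (a + n)); rewrite /edge_lo /edge_hi ?ifF; lia.
- rewrite setUC; apply: (mk (3 * n).-1); first lia.
    by rewrite /edge_lo ifF; lia.
  by rewrite /edge_hi ifF ?ifT; lia.
- apply: (mk (2 * a)); first lia.
    by rewrite /edge_lo ifT; lia.
  by rewrite /edge_hi ifT ?[X in _ = X]ifF; lia.
Qed.

(** Each vertex has three distinct incident labels; covering says that at least one of them is in
    [T], disjointness that at most one is. *)
Lemma perfect_matching_cover (T : {set label}) : T \subset L3 ->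
  perfect_matching G (edge_of @: T) <-> exact_cover n (charf T).
Proof.
move=> /subsetP TL.
have T3 x : x \in T -> x < 3 * n by move/TL; rewrite inE.
have TE : edge_of @: T \subset edges G.
  by apply/subsetP => e /imsetP[x /T3 xn ->]; exact: edge_of_edges.
have inc_lt v : v < 2 * n -> [/\ (incident n v).1.1 < 3 * n, (incident n v).1.2 < 3 * n &
    (incident n v).2 < 3 * n].
  rewrite /incident; have [v0|v0] := eqVneq v 0; first by split=> /=; lia.
  have [v1|v1] := ltnP v n; first by split=> /=; lia.
  by have [v2|v2] := eqVneq v n; split=> /=; lia.
have inc_neq v : v < 2 * n -> [/\ (incident n v).1.1 != (incident n v).1.2,
    (incident n v).1.1 != (incident n v).2 & (incident n v).1.2 != (incident n v).2].
  rewrite /incident; have [v0|v0] := eqVneq v 0; first by split=> /=; lia.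
  have [v1|v1] := ltnP v n; first by split=> /=; lia.
  by have [v2|v2] := eqVneq v n; split=> /=; lia.
have inordv k : k < 3 * n -> (inord k : label) = k :> nat by move=> ?; rewrite inordK //; lia.
split=> [/andP[/andP[_ tP] /eqP cP] v vn|cT].
- pose w : 'I_(2 * n) := Ordinal vn.
  have [i1 i2 i3] := inc_lt v vn; have [d1 d2 d3] := inc_neq v vn.
  have uniq_inc a b : a < 3 * n -> b < 3 * n -> charf T a -> charf T b ->
      w \in edge_of (inord a) -> w \in edge_of (inord b) -> a = b.
    move=> an bn ta tb wa wb; rewrite -(inordv a an) -(inordv b bn); congr nat_of_ord.
    apply: edge_of_inj; try exact: TL.
    apply: contraTeq wa => ab; have := trivIsetP tP _ _ (imset_f _ ta) (imset_f _ tb) ab.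
    by move=> /disjointFl ->.
  have : w \in finset.cover (edge_of @: T) by rewrite cP inE.
  move=> /bigcupP[e /imsetP[x xT ->]]; rewrite edge_incident ?T3 // => wx.
  have wi : [/\ w \in edge_of (inord (incident n v).1.1), w \in edge_of (inord (incident n v).1.2)
      & w \in edge_of (inord (incident n v).2)].
    by split; rewrite edge_incident inordv ?eqxx ?orbT.
  case: wi => w1 w2 w3.
  have n12 : ~~ (charf T (incident n v).1.1 && charf T (incident n v).1.2).
    by apply: contra d1 => /andP[t1 t2]; apply/eqP; exact: uniq_inc.
  have n13 : ~~ (charf T (incident n v).1.1 && charf T (incident n v).2).
    by apply: contra d2 => /andP[t1 t2]; apply/eqP; exact: uniq_inc.
  have n23 : ~~ (charf T (incident n v).1.2 && charf T (incident n v).2).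
    by apply: contra d3 => /andP[t1 t2]; apply/eqP; exact: uniq_inc.
  have : [|| charf T (incident n v).1.1, charf T (incident n v).1.2 | charf T (incident n v).2].
    by case/or3P: wx => /eqP <-; rewrite charfE xT ?orbT.
  by move: n12 n13 n23; rewrite /one3; case: (charf T _); case: (charf T _); case: (charf T _).
- rewrite /perfect_matching /matching TE /=; apply/andP; split.
    apply/trivIsetP => _ _ /imsetP[x xT ->] /imsetP[y yT ->] xy.
    rewrite -setI_eq0; apply/eqP/setP => v; rewrite in_setI in_set0; apply/negP.
    rewrite !edge_incident ?T3 // => /andP[vx vy]; case/eqP: xy.
    congr edge_of; apply: val_inj => /=.
    have := cT v (ltn_ord v); rewrite /one3.
    have cx : charf T x by rewrite charfE.
    have cy : charf T y by rewrite charfE.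
    by case/or3P: vx => /eqP xE; case/or3P: vy => /eqP yE; first [by rewrite xE yE |
      by rewrite -xE -yE cx cy; case: (charf T _)].
  apply/eqP/setP => v; rewrite inE; apply/bigcupP.
  have := cT v (ltn_ord v); have [i1 i2 i3] := inc_lt v (ltn_ord v).
  rewrite /one3.
  have mk k : k < 3 * n -> charf T k -> [|| k == (incident n v).1.1, k == (incident n v).1.2 |
      k == (incident n v).2] -> exists2 e, e \in edge_of @: T & v \in e.
    move=> kn tk kv; exists (edge_of (inord k)); first exact: imset_f.
    by rewrite edge_incident inordv.
  case t1: (charf T _); first by move=> _; apply: (mk _ i1 t1); rewrite eqxx.
  case t2: (charf T _); first by move=> _; apply: (mk _ i2 t2); rewrite eqxx orbT.
  case t3: (charf T _) => // _; apply: (mk _ i3 t3); by rewrite eqxx !orbT.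
Qed.

Lemma sub_edges_imset (M : {set {set 'I_(2 * n)}}) : M \subset edges G ->
  exists2 s : {set label}, s \subset L3 & M = edge_of @: s.
Proof.
move=> /subsetP ME; exists [set x in L3 | edge_of x \in M].
  by apply/subsetP => x; rewrite !inE => /andP[].
apply/setP => e; apply/idP/imsetP => [eM|[x]]; last by rewrite !inE => /andP[_ h] ->.
by have [x xL E] := edges_edge_of (ME e eM); exists x => //; rewrite inE xL -E.
Qed.

Lemma sub_imset_edge_of (s T : {set label}) : s \subset L3 -> T \subset L3 ->
  edge_of @: s \subset edge_of @: T -> s \subset T.
Proof.
move=> /subsetP sL /subsetP TL /subsetP sT; apply/subsetP => x xs.
have /imsetP[y yT E] := sT _ (imset_f edge_of xs).
by rewrite (edge_of_inj (sL x xs) (TL y yT) E).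
Qed.

Lemma perfect_matching_faces : faces (perfect_matching_complex (mobius_ladder n)) =
  [set [set edge_of x | x in s] | s : {set label} in dimer_complex n].
Proof.
apply/setP => M; rewrite inE.
apply/andP/imsetP => [[/andP[ME _] /existsP[P /andP[pP MP]]]|[s sK ->]].
  have [s sL sE] := sub_edges_imset ME.
  have PE : P \subset edges G by case/andP: pP => /andP[].
  have [T TL TE] := sub_edges_imset PE.
  exists s => //; apply/(dimer_complexP n2); exists T; split=> //.
    by apply: sub_imset_edge_of => //; rewrite -sE -TE.
  by apply/perfect_matching_cover; rewrite -?TE.
have [T [sT TL cT]] := (dimer_complexP n2 s).1 sK.
have pT := (perfect_matching_cover TL).2 cT.
have sTE : edge_of @: s \subset edge_of @: T by exact: imsetS.
have /andP[/andP[TE tT] _] := pT; split.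
  by rewrite /matching (subset_trans sTE TE) (trivIsetS sTE tT).
by apply/existsP; exists (edge_of @: T); rewrite pT sTE.
Qed.

End MobiusEdges.

(** * The Möbius ladder as a twisted ladder *)

Section MobiusIndependence.
Variable n : nat.
Hypothesis n2 : 1 < n.

Definition rung_position (v : 'I_(2 * n)) : 'I_n.+4 * bool :=
  (inord (if v < n then v : nat else v - n), n <= v).

Lemma rung_positionE (v : 'I_(2 * n)) :
  (rung_position v).1 = (if v < n then v : nat else v - n) :> nat.
Proof. by rewrite inordK //; have := ltn_ord v; case: (ltnP v n); lia. Qed.

Lemma rung_position_lt v : (rung_position v).1 < n.
Proof. by rewrite rung_positionE; have := ltn_ord v; case: (ltnP v n); lia. Qed.

Lemma rung_position_inj : injective rung_position.
Proof.
move=> v w vw; apply: val_inj => /=.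
have := congr1 (fun x => nat_of_ord x.1) vw; have := congr1 snd vw.
rewrite /= -!/(rung_position _) !rung_positionE /=.
by have := ltn_ord v; have := ltn_ord w; case: (ltnP v n); case: (ltnP w n); lia.
Qed.

Lemma rung_position_onto x : x \in rungs n.+4 n -> exists v, x = rung_position v.
Proof.
case: x => i [] /[1!inE] /= i_n.
  have vn : i + n < 2 * n by lia.
  exists (Ordinal vn); congr pair; last by rewrite /= leq_addl.
  by apply: val_inj; rewrite /= ltnNge leq_addl addnK inordK //; lia.
have vn : i < 2 * n by lia.
exists (Ordinal vn); congr pair; last by rewrite /= leqNgt i_n.
by apply: val_inj; rewrite /= i_n inordK //; lia.
Qed.

Lemma lad_rung_position v w : lad n true (rung_position v) (rung_position w) = mobius_adj v w.
Proof.
rewrite /lad /symm_closure !rung_positionE /mobius_adj /mobius_arc /=.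
have := ltn_ord v; have := ltn_ord w.
by case: (ltnP v n); case: (ltnP w n); lia.
Qed.

Lemma independence_faces :
  [set [set rung_position v | v in s] | s : {set 'I_(2 * n)} in
    faces (independence_complex (mobius_ladder n))] = indep (rungs n.+4 n) (lad n true).
Proof.
apply/setP => t; apply/imsetP/indepP => [[s + ->]|[/subsetP tA tI]].
  rewrite inE => /forall_inP sI; split.
    by apply/subsetP => _ /imsetP[v _ ->]; rewrite inE rung_position_lt.
  move=> _ _ /imsetP[v vs ->] /imsetP[w ws ->]; rewrite lad_rung_position.
  by move/forall_inP: (sI v vs) => /(_ w ws).
exists [set v | rung_position v \in t].
  rewrite inE; apply/forall_inP => v; rewrite inE => vt.
  by apply/forall_inP => w; rewrite inE => wt; rewrite /= -lad_rung_position tI.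
apply/setP => x; apply/idP/imsetP => [xt|[v]]; last by rewrite inE => vt ->.
by have [v xE] := rung_position_onto (tA x xt); exists v; rewrite // inE -xE.
Qed.

End MobiusIndependence.

From mathcomp Require Import all_order all_algebra.
From mathcomp Require Import all_classical all_reals all_analysis.
From mathcomp Require Import wedge_sigT ring lra.

Import Order.TTheory GRing.Theory Num.Theory.
Import numFieldNormedType.Exports.

Local Open Scope classical_set_scope.
Local Open Scope ring_scope.

(** * Realizations *)

Section HomotopyEquivalence.
Variable R : realType.

Definition clamp (t : R) : R := Num.max 0 (Num.min 1 t).

Lemma clamp_ge0 t : 0 <= clamp t.
Proof. by rewrite /clamp le_max lexx. Qed.

Lemma clamp_le1 t : clamp t <= 1.
Proof. by rewrite /clamp ge_max ler01 ge_min lexx. Qed.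

Lemma clamp_id t : 0 <= t <= 1 -> clamp t = t.
Proof. by move=> /andP[t0 t1]; rewrite /clamp min_r // max_r. Qed.

Lemma continuous_minr (X : topologicalType) (f g : X -> R) :
  continuous f -> continuous g -> continuous (fun x => Num.min (f x) (g x)).
Proof. by move=> cf cg x; apply: continuous_min; [exact: cf|exact: cg]. Qed.

Lemma continuous_maxr (X : topologicalType) (f g : X -> R) :
  continuous f -> continuous g -> continuous (fun x => Num.max (f x) (g x)).
Proof. by move=> cf cg x; apply: continuous_max; [exact: cf|exact: cg]. Qed.

Lemma continuous_fst (X Y : topologicalType) : continuous (@fst X Y).
Proof. by move=> z; exact: cvg_fst. Qed.

Lemma continuous_snd (X Y : topologicalType) : continuous (@snd X Y).
Proof. by move=> z; exact: cvg_snd. Qed.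

Lemma continuous_pairing (X Y Z : topologicalType) (f : X -> Y) (g : X -> Z) :
  continuous f -> continuous g -> continuous (fun x => (f x, g x)).
Proof. by move=> cf cg x; apply: cvg_pair; [exact: cf|exact: cg]. Qed.

Lemma continuous_compose (X Y Z : topologicalType) (f : X -> Y) (g : Y -> Z) :
  continuous f -> continuous g -> continuous (fun x => g (f x)).
Proof. by move=> cf cg x; apply: continuous_comp; [exact: cf|exact: cg]. Qed.

Lemma continuous_const (X Y : topologicalType) (y : Y) :
  continuous (fun _ : X => y).
Proof. by move=> x; exact: cvg_cst. Qed.

Lemma continuous_ident (X : topologicalType) : continuous (fun x : X => x).
Proof. by move=> x; exact: cvg_id. Qed.

Lemma continuous_addr (X : topologicalType) (f g : X -> R) :
  continuous f -> continuous g -> continuous (fun x => f x + g x).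
Proof. by move=> cf cg x; apply: cvgD; [exact: cf|exact: cg]. Qed.

Lemma continuous_subr (X : topologicalType) (f g : X -> R) :
  continuous f -> continuous g -> continuous (fun x => f x - g x).
Proof. by move=> cf cg x; apply: cvgB; [exact: cf|exact: cg]. Qed.

Lemma continuous_mulr (X : topologicalType) (f g : X -> R) :
  continuous f -> continuous g -> continuous (fun x => f x * g x).
Proof. by move=> cf cg x; apply: cvgM; [exact: cf|exact: cg]. Qed.

Lemma continuous_divr (X : topologicalType) (f g : X -> R) :
  continuous f -> continuous g -> (forall x, g x != 0) ->
  continuous (fun x => f x / g x).
Proof.
move=> cf cg g0 x; apply: cvgM; first exact: cf.
by apply: cvgV; [exact: g0|exact: cg].
Qed.

Lemma continuous_clamp : continuous clamp.
Proof.
apply: continuous_maxr; first by move=> x; exact: cvg_cst.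
by apply: continuous_minr => x; [exact: cvg_cst|exact: cvg_id].
Qed.

Lemma homotopic_intro (X Y : topologicalType) (f g : X -> Y) (H : X * R -> Y) :
  continuous H -> (forall x, H (x, 0) = f x) -> (forall x, H (x, 1) = g x) ->
  homotopic R f g.
Proof.
by move=> cH H0 H1; exists H; split=> //; exact: continuous_subspaceT.
Qed.

(** Clamping the time to the unit interval extends a homotopy that is only known to be continuous
    there to all of [R], where continuity composes without side conditions. *)
Lemma homotopic_elim (X Y : topologicalType) (f g : X -> Y) :
  homotopic R f g ->
  exists H : X * R -> Y, [/\ continuous H, forall x, H (x, 0) = f x &
                                           forall x, H (x, 1) = g x].
Proof.
move=> [H [cH H0 H1]]; exists (fun z => H (z.1, clamp z.2)); split.
- move=> z.
  set A := [set: X] `*` `[0, 1]%classic in cH.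
  have Ac (w : X * R) : A (w.1, clamp w.2).
    by split=> //=; rewrite in_itv/= clamp_ge0 clamp_le1.
  have /subspace_continuousP/(_ _ (Ac z)) cHz := cH.
  apply: cvg_trans cHz => B /= HB.
  have cc : continuous (fun w : X * R => (w.1, clamp w.2)).
    apply: continuous_pairing; first exact: continuous_fst.
    by apply: continuous_compose; [exact: continuous_snd|exact: continuous_clamp].
  have h : nbhs z (fun w => A (w.1, clamp w.2) -> B (H (w.1, clamp w.2))).
    exact: cc z _ HB.
  by apply: filterS h => w; apply; exact: Ac.
- by move=> x; rewrite /= clamp_id ?lexx ?ler01.
- by move=> x; rewrite /= clamp_id ?lexx ?ler01.
Qed.

Lemma continuous_paste (X Y : topologicalType) (f g : X * R -> Y) (c : R) :
  continuous f -> continuous g -> (forall x, f (x, c) = g (x, c)) ->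
  continuous (fun z => if z.2 <= c then f z else g z).
Proof.
move=> cf cg fg.
pose A := [set z : X * R | z.2 <= c]; pose B := [set z : X * R | c <= z.2].
have /continuous_closedP cs := @continuous_snd X R.
have cA : closed A by apply: (cs [set t | t <= c]); exact: closed_le.
have cB : closed B by apply: (cs [set t | c <= t]); exact: closed_ge.
have AB : A `|` B = setT.
  by rewrite -subTset => z _; case: (leP z.2 c) => h; [left|right; exact: ltW].
apply/continuous_subspace_setT; rewrite -AB; apply: withinU_continuous => //.
  apply: (@subspace_eq_continuous _ A _ f); last exact: continuous_subspaceT.
  by move=> z; rewrite inE /A /from_subspace /= => ->.
apply: (@subspace_eq_continuous _ B _ g); last exact: continuous_subspaceT.
move=> [x t]; rewrite inE /B /from_subspace /= => ct; case: ifPn => // tc.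
by have -> : t = c by apply/eqP; rewrite eq_le ct tc.
Qed.

Lemma homotopic_trans (X Y : topologicalType) (g f h : X -> Y) :
  homotopic R f g -> homotopic R g h -> homotopic R f h.
Proof.
move=> /homotopic_elim[F [cF F0 F1]] /homotopic_elim[G [cG G0 G1]].
have aff (a b : R) : continuous (fun z : X * R => (z.1, a * z.2 + b)).
  apply: continuous_pairing => z; first exact: continuous_fst.
  apply: cvgD; last exact: cvg_cst.
  by apply: cvgM; [exact: cvg_cst|exact: continuous_snd].
apply: (@homotopic_intro _ _ _ _ (fun z =>
  if z.2 <= 2^-1 then F (z.1, 2 * z.2 + 0) else G (z.1, 2 * z.2 + (- 1)))).
- apply: (@continuous_paste _ _ (fun z => F (z.1, 2 * z.2 + 0))
    (fun z => G (z.1, 2 * z.2 + (- 1)))).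
  + by move=> z; apply: continuous_comp; [exact: aff|exact: cF].
  + by move=> z; apply: continuous_comp; [exact: aff|exact: cG].
  + by move=> x /=; rewrite divff ?pnatr_eq0// addr0 F1 subrr G0.
- by move=> x /=; rewrite ifT ?mulr0 ?addr0// invr_ge0.
- move=> x /=; rewrite ifF; first by rewrite mulr1 -{1}[2]/(1 + 1) addrK.
  by apply/negbTE; rewrite -ltNge invf_lt1 // ltr1n.
Qed.

Lemma homotopic_compl (X Y Z : topologicalType) (h : Y -> Z) (f g : X -> Y) :
  continuous h -> homotopic R f g -> homotopic R (h \o f) (h \o g).
Proof.
move=> ch /homotopic_elim[F [cF F0 F1]].
apply: (@homotopic_intro _ _ _ _ (h \o F)).
- by move=> z; apply: continuous_comp; [exact: cF|exact: ch].
- by move=> x /=; rewrite F0.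
- by move=> x /=; rewrite F1.
Qed.

Lemma homotopic_compr (X Y Z : topologicalType) (h : Z -> X) (f g : X -> Y) :
  continuous h -> homotopic R f g -> homotopic R (f \o h) (g \o h).
Proof.
move=> ch /homotopic_elim[F [cF F0 F1]].
apply: (@homotopic_intro _ _ _ _ (fun z => F (h z.1, z.2))).
- apply: (continuous_compose _ cF).
  apply: continuous_pairing; last exact: continuous_snd.
  exact: continuous_compose (@continuous_fst _ _) ch.
- by move=> x /=; rewrite F0.
- by move=> x /=; rewrite F1.
Qed.

Lemma homotopic_refl (X Y : topologicalType) (f : X -> Y) :
  continuous f -> homotopic R f f.
Proof.
move=> cf; apply: (@homotopic_intro _ _ _ _ (f \o fst)) => // z.
by apply: continuous_comp; [exact: continuous_fst|exact: cf].
Qed.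

Lemma homotopy_equivalent_refl (X : topologicalType) :
  homotopy_equivalent R X X.
Proof.
by exists id, id; split; try (by move=> ?; exact: cvg_id);
  apply: homotopic_refl => ?; exact: cvg_id.
Qed.

Lemma homotopy_equivalent_sym (X Y : topologicalType) :
  homotopy_equivalent R X Y -> homotopy_equivalent R Y X.
Proof. by move=> [f [g [cf cg gf fg]]]; exists g, f. Qed.

Lemma homotopy_equivalent_trans (Y X Z : topologicalType) :
  homotopy_equivalent R X Y -> homotopy_equivalent R Y Z ->
  homotopy_equivalent R X Z.
Proof.
move=> [f [g [cf cg gf fg]]] [f' [g' [cf' cg' gf' fg']]].
exists (f' \o f), (g \o g'); split.
- by move=> x; apply: continuous_comp; [exact: cf|exact: cf'].
- by move=> x; apply: continuous_comp; [exact: cg'|exact: cg].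
- apply: homotopic_trans gf.
  exact: (homotopic_compr cf (homotopic_compl cg gf')).
- apply: homotopic_trans fg'.
  exact: (homotopic_compr cg' (homotopic_compl cf' fg)).
Qed.

End HomotopyEquivalence.

(** * Barycentric coordinates and the minimum over a face *)

Section Realization.
Variables (R : realType) (V : finType).
Implicit Types (K : {set {set V}}) (x : V -> R) (s : {set V}).

Definition supp (x : V -> R) : {set V} := [set v | x v != 0]%SET.

Lemma mem_supp x v : (v \in supp x) = (x v != 0).
Proof. by rewrite finset.in_set. Qed.

Definition gset (K : {set {set V}}) : set {ptws V -> R} :=
  [set x : {ptws V -> R} | [/\ forall v, 0 <= x v,
    \sum_(v : V) x v = 1 & [set v | x v != 0]%SET \in K]].

(** A realization of a bare set of faces: no proof of closure is attached, so equal sets of faces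
    can be rewritten into each other. *)
Definition geo (K : {set {set V}}) : topologicalType := set_type (gset K).

Definition mkgeo K (x : V -> R) (Kx : gset K x) : geo K :=
  exist (fun x => x \in gset K) x (mem_set Kx).

Definition coords K (x : geo K) : V -> R := sval x.

Lemma coordsP K (x : geo K) : gset K (coords x).
Proof. by case: x => x /= /set_mem. Qed.

Lemma coords_ge0 K (x : geo K) v : 0 <= coords x v.
Proof. by have [] := coordsP x. Qed.

Lemma coords_sum K (x : geo K) : \sum_v coords x v = 1.
Proof. by have [] := coordsP x. Qed.

Lemma coords_supp K (x : geo K) : supp (coords x) \in K.
Proof. by have [] := coordsP x. Qed.

Lemma coords_le1 K (x : geo K) v : coords x v <= 1.
Proof.
rewrite -(coords_sum x) (bigD1 v)//= lerDl.
by apply: sumr_ge0 => i _; exact: coords_ge0.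
Qed.

Lemma geo_eq K (x y : geo K) : coords x =1 coords y -> x = y.
Proof.
by move=> xy; apply/val_inj/funext => v; exact: xy.
Qed.

Lemma continuous_coords K v : continuous (fun x : geo K => coords x v).
Proof.
have h : continuous (fun x : geo K => sval x : {ptws V -> R}).
  exact: initial_continuous.
exact: (continuous_compose h (@proj_continuous V (fun=> R) v)).
Qed.

Lemma continuous_mkgeo (X : topologicalType) K (F : X -> V -> R)
    (KF : forall z, gset K (F z)) :
  (forall v, continuous (fun z => F z v)) ->
  continuous (fun z => mkgeo (KF z)).
Proof.
move=> cF; apply: continuous_comp_initial => z.
suff h : {ptws, F @ z --> F z} by exact: h.
apply/cvg_sup => v; apply/cvg_image.
  rewrite eqEsubset; split=> // r _; exists (fun=> r) => //.
move=> A Az; exists ((fun g : V -> R => g v) @^-1` A).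
  exact: cF v z _ Az.
rewrite image_preimage // eqEsubset; split=> // r _; exists (fun=> r) => //.
Qed.

(** On realizations this function is positive exactly on the open star of [s]. The default 1 bounds
    all coordinates, so for nonempty [s] the value is attained. *)
Definition minface (s : {set V}) x : R := \big[Num.min/1]_(v in s) x v.

Lemma continuous_sumr (X : topologicalType) (I : Type) (r : seq I) (P : pred I)
    (F : I -> X -> R) :
  (forall i, P i -> continuous (F i)) ->
  continuous (fun z => \sum_(i <- r | P i) F i z).
Proof.
move=> cF; apply: continuous_big => //.
move=> z; apply: cvgD; [exact: continuous_fst|exact: continuous_snd].
Qed.

Lemma continuous_minface (X : topologicalType) s (F : X -> V -> R) :
  (forall v, continuous (fun z => F z v)) ->
  continuous (fun z => minface s (F z)).
Proof.
move=> cF; apply: continuous_big => //.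
by apply: continuous_minr; [exact: continuous_fst|exact: continuous_snd].
Qed.

Lemma minface_le s x v : v \in s -> minface s x <= x v.
Proof. by move=> vs; apply: bigmin_le_cond. Qed.

Lemma minface_ge0 s x : (forall v, 0 <= x v) -> 0 <= minface s x.
Proof. by move=> x0; apply: le_bigmin => //; exact: ler01. Qed.

Lemma minface_gt0 s x : (forall v, 0 <= x v) ->
  (0 < minface s x) = (s \subset supp x)%SET.
Proof.
move=> x0; apply/idP/fintype.subsetP => [m0 v vs|h].
  by rewrite mem_supp gt_eqF // (lt_le_trans m0) // minface_le.
apply: lt_bigmin => // v vs; rewrite lt_def x0 andbT -mem_supp; exact: h.
Qed.

Lemma minface_eq0 s x : (forall v, 0 <= x v) ->
  ~~ (s \subset supp x)%SET -> minface s x = 0.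
Proof.
move=> x0; rewrite -minface_gt0 // -leNgt => m0.
by apply/eqP; rewrite eq_le m0 minface_ge0.
Qed.

Lemma minface_attained s x : s != finset.set0 -> (forall v, x v <= 1) ->
  exists2 v, v \in s & minface s x = x v.
Proof.
move=> /set0Pn[w ws] x1.
by have [v vs] := @eq_bigmin _ _ _ 1 w (mem s) x ws (fun i _ => x1 i); exists v.
Qed.

End Realization.

Arguments geo : clear implicits.

(** * Elementary expansions are homotopy equivalences *)

Section ElementaryExpansion.
Variables (R : realType) (V : finType) (K : {set {set V}}).
Variables (s : {set V}) (v : V).
Hypotheses (dK : down_closed K) (s0 : s != finset.set0) (vs : v \notin s).
Hypotheses (sK : s \notin K).
Hypothesis facesK : forall t : {set V}, (t \proper v |: s)%SET -> t != s ->
  t \in K.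

Let K' := (s |: ((v |: s) |: K))%SET.

Let sub_K' (t : {set V}) : (t \subset v |: s)%SET -> t \in K'.
Proof.
move=> tvs; rewrite !inE.
have [//|ts] := eqVneq t s; have [//|tvs'] := eqVneq t (v |: s)%SET.
by rewrite facesK // finset.properEneq tvs'.
Qed.

(* Moves mass evenly from [s] to [v]; at [t = 1] some coordinate in [s] vanishes. *)
Let push (t : R) (x : V -> R) : V -> R := fun w =>
  x w - t * minface s x * ((w \in s)%:R - #|s|%:R * (w == v)%:R).

Let push_ge0 t x : 0 <= t <= 1 -> (forall w, 0 <= x w) ->
  forall w, 0 <= push t x w.
Proof.
move=> /andP[t0 t1] x0 w; rewrite /push.
have m0 := minface_ge0 s x0.
have [->|wv] := eqVneq w v.
  rewrite (negbTE vs) sub0r mulr1 mulrN opprK addr_ge0 // mulr_ge0 //.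
  exact: mulr_ge0.
rewrite mulr0 subr0; have [ws|ws] := boolP (w \in s); last by rewrite mulr0 subr0.
rewrite mulr1 subr_ge0 (le_trans _ (minface_le x ws)) // ler_piMl //.
Qed.

Let push_sum t x : \sum_w push t x w = \sum_w x w.
Proof.
have es : \sum_w (w \in s)%:R = #|s|%:R :> R.
  rewrite -natr_sum; have -> // : (\sum_w (w \in s))%N = #|s|.
  by rewrite -sum1_card [RHS]big_mkcond; apply: eq_bigr => w _; case: (w \in s).
have ev : \sum_w (w == v)%:R = 1 :> R.
  by rewrite (bigD1 v)//= eqxx big1 ?addr0// => i /negbTE ->.
by rewrite /push sumrB -mulr_sumr sumrB -mulr_sumr es ev mulr1 subrr mulr0 subr0.
Qed.

Let push_id t x : minface s x = 0 -> push t x =1 x.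
Proof. by move=> m w; rewrite /push m mulr0 mul0r subr0. Qed.

(** No face of [K] contains [s], so only the two new faces do. *)
Let suppK' (x : V -> R) : gset K' x -> (s \subset supp x)%SET ->
  (supp x \subset v |: s)%SET.
Proof.
move=> [_ _]; rewrite !inE => /or3P[/eqP|/eqP|] h sx.
- by rewrite /supp h finset.subsetUr.
- by rewrite /supp h.
- by case/negP: sK; exact: dK h sx.
Qed.

Let supp_push t x : (supp x \subset v |: s)%SET ->
  (supp (push t x) \subset v |: s)%SET.
Proof.
move=> /fintype.subsetP xs; apply/fintype.subsetP => w; rewrite mem_supp; apply: contraR => wvs.
have wx : x w = 0 by apply/eqP; move: (wvs); apply: contraR; rewrite -mem_supp; exact: xs.
move: wvs; rewrite !inE negb_or => /andP[/negbTE wv /negbTE ws].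
by rewrite /push wx wv ws mulr0 subrr mulr0 subr0.
Qed.

Let push_K' t (x : geo R V K') : 0 <= t <= 1 -> gset K' (push t (coords x)).
Proof.
move=> t01; split.
- by move=> w; apply: push_ge0 => //; exact: coords_ge0.
- by rewrite push_sum coords_sum.
- have [sx|sx] := boolP (s \subset supp (coords x))%SET.
    exact/sub_K'/supp_push/suppK'/sx/coordsP.
  have m := minface_eq0 (coords_ge0 x) sx.
  rewrite -/(supp _) (_ : supp _ = supp (coords x)); first exact: coords_supp.
  by apply/setP => w; rewrite !mem_supp push_id.
Qed.

Let push_K (x : geo R V K') : gset K (push 1 (coords x)).
Proof.
have [p0 p1 p2] := @push_K' 1 x (introT andP (conj ler01 (lexx _))).
split=> //; rewrite -/(supp _).
have [sx|sx] := boolP (s \subset supp (coords x))%SET; last first.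
  have m := minface_eq0 (coords_ge0 x) sx.
  rewrite (_ : supp _ = supp (coords x)); last first.
    by apply/setP => w; rewrite !mem_supp push_id.
  have := coords_supp x; rewrite !inE.
  case/or3P => // /eqP h; move: sx; rewrite h ?fintype.subxx //.
  by rewrite finset.subsetUr.
(* A coordinate in [s] attaining the minimum is pushed to zero, so the new support is a proper face
   of [v |: s] different from [s]. *)
have [w ws mw] := minface_attained s0 (coords_le1 x).
have wp : w \notin supp (push 1 (coords x)).
  rewrite mem_supp negbK /push mw ws (_ : w == v = false); last first.
    by apply/negbTE; apply: contraNneq vs => <-.
  by rewrite mulr0 subr0 !mulr1 mul1r subrr.
apply: facesK.
  rewrite properE supp_push ?suppK' //=; last exact: coordsP.
  by apply/fintype.subsetPn; exists w => //; rewrite !inE ws orbT.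
by apply: contraNneq wp => ->.
Qed.

Let incl_K (x : geo R V K) : gset K' (coords x).
Proof.
have [x0 x1 x2] := coordsP x; split=> //.
by rewrite !finset.in_setU x2 !orbT.
Qed.

(** The minimum over [s] vanishes on [K], so [push] fixes [K] pointwise and deforms the larger
    complex onto it. *)
Lemma elementary_expansion : homotopy_equivalent R (geo R V K)
  (geo R V (s |: ((v |: s) |: K))%SET).
Proof.
have cpush (X : topologicalType) (f : X -> R) (g : X -> geo R V K') w :
    continuous f -> continuous g ->
    continuous (fun z => push (f z) (coords (g z)) w).
  move=> cf cg; rewrite /push.
  have cc u : continuous (fun z => coords (g z) u).
    exact: (continuous_compose cg (@continuous_coords _ _ _ u)).
  move=> z; apply: cvgB; first exact: cc.
  apply: cvgM; last exact: cvg_cst.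
  apply: cvgM; first exact: cf.
  have cm := continuous_minface (s := s) cc.
  exact: (cm z).
pose f (x : geo R V K) : geo R V K' := mkgeo (incl_K x).
pose g (x : geo R V K') : geo R V K := mkgeo (push_K x).
have cf : continuous f.
  by apply: continuous_mkgeo => w; exact: continuous_coords.
have cg : continuous g.
  apply: continuous_mkgeo => w; apply: (cpush _ (fun=> 1) id).
    exact: continuous_const.
  exact: continuous_ident.
exists f, g; split => //.
- have -> : g \o f = id.
    apply/funext => x; apply: geo_eq => w /=.
    rewrite /g /coords /= -/(coords x) push_id //.
    apply: minface_eq0; first exact: coords_ge0.
    by apply: contra sK => sx; exact: dK (coords_supp x) sx.
  exact/homotopic_refl/continuous_ident.
- have h (z : geo R V K' * R) : gset K' (push (1 - clamp z.2) (coords z.1)).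
    apply: push_K'; have := clamp_ge0 z.2; have := clamp_le1 z.2; lra.
  apply: (@homotopic_intro _ _ _ _ _ (fun z => mkgeo (h z))).
  + apply: continuous_mkgeo => w; apply: cpush; last exact: continuous_fst.
    move=> z; apply: cvgB; first exact: cvg_cst.
    exact: (continuous_compose (@continuous_snd _ _) (@continuous_clamp R)).
  + move=> x; apply: geo_eq => w.
    by rewrite /coords /= clamp_id ?lexx ?ler01 // subr0.
  + move=> x; apply: geo_eq => w.
    by rewrite /coords /= clamp_id ?lexx ?ler01 // subrr /push !mul0r subr0.
Qed.

End ElementaryExpansion.

(** * Compactness and quotient maps *)

Section Compactness.

(** A continuous surjection from a compact space to a Hausdorff space is closed, hence a quotient
    map. *)
Lemma quotient_continuous (X Y Z : topologicalType) (q : X -> Y) (h : Y -> Z) :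
  compact [set: X] -> hausdorff_space Y -> continuous q ->
  (forall y, exists x, q x = y) -> continuous (h \o q) -> continuous h.
Proof.
move=> cX hY cq sq /continuous_closedP chq; apply/continuous_closedP => D cD.
have -> : h @^-1` D = q @` ((h \o q) @^-1` D).
  rewrite eqEsubset; split=> [y Dy|y [x Dx <-]//].
  by have [x qx] := sq y; exists x; rewrite /= ?qx.
apply: compact_closed => //; apply: continuous_compact.
  exact: continuous_subspaceT.
by apply: subclosed_compact cX _ => //; exact: chq.
Qed.

Lemma compact_set_type (X : topologicalType) (A : set X) :
  compact A -> compact [set: set_type A].
Proof.
move=> cA F FF _.
have FA : (\val @ F) A by apply: nearW => x; exact: set_valP.
have [x [Ax clx]] := cA _ _ FA.
exists (exist _ x (mem_set Ax)); split=> // B U FB [W [[Q oQ <-] Qx QU]].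
have [y [By Qy]] : ((\val @` B) `&` Q) !=set0.
  apply: clx; last exact: open_nbhs_nbhs.
  have : F (\val @^-1` (\val @` B)) by apply: filterS FB => z Bz; exists z.
  exact.
case: By => z Bz zy; exists z; split=> //; apply: QU.
by move: Qy; rewrite -zy.
Qed.

Lemma hausdorff_set_type (X : topologicalType) (A : set X) :
  hausdorff_space X -> hausdorff_space (set_type A).
Proof.
move=> hX x y cxy; apply: val_inj; apply: hX => U W Ux Wy.
have [z [Uz Wz]] := cxy _ _ (initial_continuous Ux) (initial_continuous Wy).
by exists (\val z).
Qed.

Lemma hausdorff_pair (X Y : topologicalType) :
  hausdorff_space X -> hausdorff_space Y -> hausdorff_space (X * Y)%type.
Proof.
move=> hX hY [x y] [x' y'] c.
congr (_, _); [apply: hX|apply: hY] => U W Ux Wy.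
  have [z [Uz Wz]] := c _ _ (@continuous_fst X Y (x, y) _ Ux)
    (@continuous_fst X Y (x', y') _ Wy).
  by exists z.1.
have [z [Uz Wz]] := c _ _ (@continuous_snd X Y (x, y) _ Ux)
  (@continuous_snd X Y (x', y') _ Wy).
by exists z.2.
Qed.

End Compactness.

Section GeoCompact.
Variables (R : realType) (V : finType) (K : {set {set V}}).
Hypothesis dK : down_closed K.

(** The realization is closed in a cube. The support condition is closed because supports can only
    grow near a point, and subsets of faces are faces. *)
Lemma compact_gset : compact (gset (R := R) K).
Proof.
have cp v : continuous (fun x : {ptws V -> R} => x v).
  exact: (@proj_continuous V (fun=> R) v).
pose C := [set x : {ptws V -> R} | forall v, `[0, 1]%classic (x v)].
have cC : compact C.
  by apply: (@tychonoff V (fun=> R) (fun=> `[0, 1]%classic)) => v; exact: segment_compact.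
apply: (subclosed_compact _ cC); last first.
  move=> x gx v; have [x0 _ _] := gx.
  have := coords_le1 (mkgeo gx) v; rewrite /coords /= => x1.
  by rewrite in_itv /= x0 x1.
rewrite (_ : gset K = (\bigcap_v [set x : {ptws V -> R} | 0 <= x v]) `&`
   ([set x : {ptws V -> R} | \sum_v x v = 1] `&`
    [set x : {ptws V -> R} | supp (x : V -> R) \in K])); last first.
  rewrite eqEsubset; split=> x; first by case=> x0 x1 x2; split=> [v _|]; [exact: x0|split].
  by case=> x0 [x1 x2]; split=> // v; apply: x0.
apply: closedI.
  apply: closed_bigI => v _; have /continuous_closedP/(_ [set t | 0 <= t]) := cp v.
  by apply; exact: closed_ge.
apply: closedI.
  have cs : continuous (fun x : {ptws V -> R} => \sum_v x v).
    by apply: continuous_sumr => v _; exact: cp.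
  have /continuous_closedP/(_ [set t | t = 1]) := cs.
  by apply; exact: closed_eq.
rewrite -openC openE => x /negP Kx.
have nx : \forall y \near x, forall v, v \in supp (x : V -> R) -> y v != 0.
  suff h v : \forall y \near x, v \in supp (x : V -> R) -> y v != 0.
    exact: (@filter_forall _ _ (fun v (y : {ptws V -> R}) =>
      v \in supp (x : V -> R) -> y v != 0) _ (nbhs_filter x) h).
  have [|vx] := boolP (v \in supp (x : V -> R)); last by apply: filterE => y.
  rewrite mem_supp => xv.
  have : \forall t \near x v, t != 0.
    by apply: open_nbhs_nbhs; split=> //; exact: open_neq.
  move=> h; have h2 : nbhs x (fun y : {ptws V -> R} => y v != 0) := cp v x _ h.
  by apply: filterS h2 => y yv _; exact: yv.
apply: filterS nx => y yx /= Ky; apply: (negP Kx); apply: dK Ky _.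
by apply/fintype.subsetP => v /yx; rewrite mem_supp.
Qed.

Lemma compact_geo : compact [set: geo R V K].
Proof. exact/compact_set_type/compact_gset. Qed.

End GeoCompact.

(** * Injective relabelling of vertices *)

Section Transport.
Variables (R : realType) (V W : finType) (j : W -> V) (A : {set W}).
Variable (K : {set {set W}}).
Hypotheses (jA : {in A &, injective j}).
Hypothesis KA : forall s, s \in K -> s \subset A.

Let jK : {set {set V}} := finset.imset (fun s : {set W} => finset.imset j (mem s)) (mem K).

Let push (y : W -> R) (v : V) : R := \sum_(w in A | j w == v) y w.
Let pull (x : V -> R) (w : W) : R := if w \in A then x (j w) else 0.

Let pushj (y : W -> R) w : w \in A -> push y (j w) = y w.
Proof.
move=> wA; rewrite /push (bigD1 w) ?wA ?eqxx//= big1 ?addr0// => i.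
by move=> /andP[/andP[iA /eqP /jA]] ->; rewrite ?eqxx.
Qed.

Let supp_push (y : geo R W K) : supp (push (coords y)) = finset.imset j (mem (supp (coords y))).
Proof.
apply/setP => v; rewrite mem_supp; apply/idP/imsetP => [|[w ws ->]].
  rewrite psumr_neq0 => [/hasP[w _ /andP[/andP[wA /eqP jw] w0]]|w _]; last first.
    exact: coords_ge0.
  by exists w; rewrite ?mem_supp // gt_eqF.
rewrite pushj -?mem_supp //; move/fintype.subsetP: (KA (coords_supp y)); exact.
Qed.

Let push_gset (y : geo R W K) : gset jK (push (coords y)).
Proof.
split.
- by move=> v; apply: sumr_ge0 => w _; exact: coords_ge0.
- rewrite /push -(coords_sum y) [RHS](bigID (mem A))/= [X in _ + X]big1 ?addr0.
    by rewrite (partition_big j xpredT).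
  move=> w wA; apply/eqP; move: wA; apply: contraR; rewrite -mem_supp.
  by move/fintype.subsetP: (KA (coords_supp y)); exact.
- by rewrite -/(supp _) supp_push imset_f // coords_supp.
Qed.

Let pull_supp (x : geo R V jK) :
  finset.imset j (mem (supp (pull (coords x)))) = supp (coords x) /\
  supp (pull (coords x)) \in K.
Proof.
have /imsetP[s sK sx] := coords_supp x.
suff -> : supp (pull (coords x)) = s by rewrite -sx.
apply/setP => w; rewrite mem_supp /pull.
have sA : w \in s -> w \in A by move/fintype.subsetP: (KA sK); exact.
have [wA|/negbTE wA] := boolP (w \in A); last first.
  by rewrite eqxx; apply/esym/negbTE; apply: contraFN wA.
rewrite -mem_supp sx; apply/imsetP/idP => [[w' ws' /jA ->//]|ws]; last by exists w.
by move/fintype.subsetP: (KA sK); exact.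
Qed.

Let pull_gset (x : geo R V jK) : gset K (pull (coords x)).
Proof.
have [jx Kx] := pull_supp x.
split=> //.
  by move=> w; rewrite /pull; case: ifP => // _; exact: coords_ge0.
rewrite /pull -big_mkcond/= -(coords_sum x).
rewrite [RHS](bigID (mem (finset.imset j (mem A))))/= [X in _ + X]big1 ?addr0.
  by rewrite big_imset.
move=> v; apply: contraNeq; rewrite -mem_supp -jx => /imsetP[w wx ->].
by apply: imset_f; move/fintype.subsetP: (KA Kx); exact.
Qed.

Lemma geo_imset : homotopy_equivalent R (geo R V
   (finset.imset (fun s : {set W} => finset.imset j (mem s)) (mem K))) (geo R W K).
Proof.
pose f (x : geo R V jK) : geo R W K := mkgeo (pull_gset x).
pose g (y : geo R W K) : geo R V jK := mkgeo (push_gset y).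
have cf : continuous f.
  apply: continuous_mkgeo => w; rewrite /pull.
  by case: (w \in A); [exact: continuous_coords|exact: continuous_const].
have cg : continuous g.
  by apply: continuous_mkgeo => v; apply: continuous_sumr => w _; exact: continuous_coords.
exists f, g; split=> //.
- have -> : g \o f = id; last exact/homotopic_refl/continuous_ident.
  apply/funext => x; apply: geo_eq => v; rewrite /g /f /coords /= -/(coords x).
  have [/imsetP[w wA ->]|vA] := boolP (v \in finset.imset j (mem A)).
    by rewrite pushj // /pull wA.
  rewrite /push big1 => [|w /andP[wA /eqP jw]]; last first.
    by move: vA; rewrite -jw imset_f.
  apply/esym/eqP; move: vA; apply: contraR; rewrite -mem_supp.
  have [<- Kx] := pull_supp x; move=> /imsetP[w wx ->]; apply: imset_f.
  by move/fintype.subsetP: (KA Kx); exact.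
- have -> : f \o g = id; last exact/homotopic_refl/continuous_ident.
  apply/funext => y; apply: geo_eq => w; rewrite /g /f /coords /= -/(coords y) /pull.
  case: ifPn => wA; first by rewrite pushj.
  apply/esym/eqP; move: wA; apply: contraR; rewrite -mem_supp.
  by move/fintype.subsetP: (KA (coords_supp y)); exact.
Qed.

End Transport.

Lemma continuous_row (R : realType) (X : topologicalType) (m : nat)
    (F : X -> 'rV[R]_m) :
  (forall i, continuous (fun x => F x ord0 i)) -> continuous F.
Proof.
move=> cF x U [P Px PU].
have h : \forall y \near x, forall i, P ord0 i (F y ord0 i).
  apply: (@filter_forall _ _ (fun i y => P ord0 i (F y ord0 i)) _
    (nbhs_filter x)) => i.
  exact: cF i x _ (Px ord0 i).
have h' : nbhs x (fun y => U (F y)).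
  apply: filterS h => y Fy; apply: PU => i j.
  by rewrite ord1; exact: Fy.
exact: h'.
Qed.

Lemma sphere_eq_base (R : realType) d (b : sphere R d) :
  sval b ord0 ord0 = 1 -> b = sphere_base R d.
Proof.
move=> b0; apply: val_inj; apply/rowP => i; rewrite /= mxE /=.
have [->|i0] := eqVneq i ord0; first by rewrite -b0.
have : sphere_set R d (sval b) by case: (b) => b' /= /set_mem.
rewrite /sphere_set /= (bigD1 ord0)//= b0 expr1n => /(canRL (addKr _)).
rewrite addNr => /eqP; rewrite psumr_eq0; last by move=> k _; exact: sqr_ge0.
by move=> /allP/(_ i); rewrite mem_index_enum i0 /= sqrf_eq0 => /(_ isT)/eqP.
Qed.

(** * Contracting a cone to obtain a wedge of spheres *)

Section ConeCollapse.
Variables (R : realType) (V : finType) (L : {set {set V}}) (p : V).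
Variables (r d : nat) (e : 'I_r -> 'I_d.+1 -> V).
Let F (j : 'I_r) : {set V} := [set e j i | i : 'I_d.+1]%SET.
Hypotheses (dL : down_closed L) (L0 : finset.set0 \in L).
Hypotheses (e_inj : forall j, injective (e j)) (F_inj : injective F).
Hypotheses (pF : forall j, p \notin F j) (FL : forall j, F j \notin L).
Hypothesis F_proper : forall j (t : {set V}), (t \proper F j)%SET -> t \in L.

(* The cone over [L] together with the faces [F j], whose boundaries lie in [L]:
   contracting the cone leaves one sphere for each [j]. *)
Let K := [set t : {set V} | (t :\ p \in L) || [exists j, t == F j]]%SET.

Variables (Y : topologicalType) (lift : 'I_r -> sphere R d -> Y) (y0 : Y).
Hypothesis cont_lift : forall j, continuous (lift j).
Hypothesis lift_base : forall j, lift j (sphere_base R d) = y0.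
Hypothesis lift_onto : forall y, y = y0 \/ exists j b, y = lift j b.
Hypothesis lift_inj : forall i j a b, lift i a = lift j b ->
  (i = j /\ a = b) \/ (a = sphere_base R d /\ b = sphere_base R d).
Hypothesis hausY : hausdorff_space Y.

Let eF j i : e j i \in F j. Proof. exact: imset_f. Qed.

Let s j (x : V -> R) := minface (F j) x.

Let s_le j x i : s j x <= x (e j i).
Proof. exact/minface_le/eF. Qed.

Let dK : down_closed K.
Proof.
move=> t u; rewrite !inE => /orP[tL|/existsP[j /eqP ->]] ut.
  by rewrite (dL tL) // finset.setSD.
have [->|uF] := eqVneq u (F j).
  by apply/orP; right; apply/existsP; exists j.
rewrite (F_proper (j := j)) // finset.properEneq.
rewrite (fintype.subset_trans (subsetDl _ _) ut) andbT.
apply: contra_neq uF => h; apply/eqP; rewrite finset.eqEsubset ut -h.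
exact: subsetDl.
Qed.

(** The support contains [F j]. It cannot come from the cone, since [p] is not in [F j] and [F j] is
    not in [L]; hence it is some [F i], which has the same cardinality. *)
Let supp_pos (x : geo R V K) j : 0 < s j (coords x) -> supp (coords x) = F j.
Proof.
rewrite minface_gt0 => [Fx|v]; last exact: coords_ge0.
have := coords_supp x; rewrite inE => /orP[xL|/existsP[i /eqP xF]].
  case/negP: (FL j); apply: dL xL _; apply/fintype.subsetP => v vF.
  rewrite finset.in_setD1 (fintype.subsetP Fx) // andbT.
  by apply: contraNneq (pF j) => <-.
rewrite xF in Fx *; apply/esym/eqP; rewrite eqEcard Fx.
rewrite (card_imset _ (@e_inj i)) (card_imset _ (@e_inj j)) /=; exact: leqnn.
Qed.

Let s_ge0 j (x : geo R V K) : 0 <= s j (coords x).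
Proof. by apply: minface_ge0 => v; exact: coords_ge0. Qed.

Let s_zero (x : geo R V K) i j : i != j -> 0 < s i (coords x) -> s j (coords x) = 0.
Proof.
move=> ij /supp_pos xi; apply/eqP; apply: contraNT ij => xj.
have /supp_pos : 0 < s j (coords x) by rewrite lt_def xj s_ge0.
by rewrite xi => /F_inj ->.
Qed.

Let out j (x : V -> R) : R := \sum_(v | v \notin F j) x v.
Let u j (x : V -> R) i := x (e j i) - x (e j ord0).
Let N j (x : V -> R) : R := \sum_i u j x i ^+ 2 + out j x ^+ 2.

Let sum_F j (x : V -> R) : \sum_v x v = \sum_i x (e j i) + out j x.
Proof.
rewrite (bigID (mem (F j)))/=; congr (_ + _).
by rewrite big_imset /=; [apply: eq_bigl|move=> ? ? _ _; exact: e_inj].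
Qed.

Let sumu_ge0 j x : 0 <= \sum_i u j x i ^+ 2.
Proof. by apply: sumr_ge0 => i _; exact: sqr_ge0. Qed.

Let s_attained j (x : geo R V K) : exists i, s j (coords x) = coords x (e j i).
Proof.
have F0 : F j != finset.set0 by apply/set0Pn; exists (e j ord0).
have [v /imsetP[i _ vi] sv] := minface_attained F0 (coords_le1 x).
by exists i; rewrite -vi.
Qed.

(** If the denominator vanished, there would be no mass outside [F j], and all coordinates on [F j]
    would equal their minimum 0, against total mass 1. *)
Let den_gt0 j (x : geo R V K) : 0 < N j (coords x) + s j (coords x) ^+ 2.
Proof.
set y := coords x.
have N0 : 0 <= N j y by rewrite addr_ge0 ?sqr_ge0.
rewrite lt_def addr_ge0 ?sqr_ge0 // andbT; apply/eqP => den0.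
have /andP[/eqP NE /eqP sE] : (N j y == 0) && (s j y ^+ 2 == 0).
  by rewrite -paddr_eq0 ?sqr_ge0 //; exact/eqP.
have /andP[/eqP uE /eqP oE] : (\sum_i u j y i ^+ 2 == 0) && (out j y ^+ 2 == 0).
  by rewrite -paddr_eq0 ?sqr_ge0 //; exact/eqP.
move/eqP: sE; rewrite sqrf_eq0 => /eqP sE; move/eqP: oE; rewrite sqrf_eq0 => /eqP oE.
have u0 i : u j y i = 0.
  move/eqP: uE; rewrite psumr_eq0; last by move=> k _; exact: sqr_ge0.
  by move=> /allP/(_ i); rewrite mem_index_enum /= sqrf_eq0 => /(_ isT)/eqP.
have [k sk] := s_attained j x.
have y0' : y (e j ord0) = 0.
  have : s j y - y (e j ord0) = 0 by rewrite sk; exact: u0.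
  by rewrite sE sub0r => /eqP; rewrite oppr_eq0 => /eqP.
have := coords_sum x; rewrite (sum_F j) -/y oE addr0 big1; last first.
  by move=> i _; have := u0 i; rewrite /u y0' subr0.
by move/esym/eqP; rewrite oner_eq0.
Qed.

(* Inverse stereographic projection of [u j x / s j x], where the interior of the
   face [F j] is [s j x > 0]; the term [out j x] keeps the denominator positive
   outside [F j]. *)
Let phi_row j (x : V -> R) : 'rV[R]_d.+1 := \row_i
  ((if i == ord0 then N j x - s j x ^+ 2 else 2 * s j x * u j x i) /
   (N j x + s j x ^+ 2)).

Let s_out j (x : geo R V K) : s j (coords x) * out j (coords x) = 0.
Proof.
have [->|sx] := eqVneq (s j (coords x)) 0; first by rewrite mul0r.
have /supp_pos xF : 0 < s j (coords x) by rewrite lt_def sx s_ge0.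
rewrite /out big1 ?mulr0 // => v; rewrite -xF mem_supp negbK; exact/eqP.
Qed.

Let u0 j x : u j x ord0 = 0. Proof. exact: subrr. Qed.

(** Since [s * out = 0], the squared norm of s u is [s ^+ 2 * N], and the claim becomes (N - s^2)^2
    + 4 s^2 N = (N + s^2)^2. *)
Let phi_sphere j (x : geo R V K) : sphere_set R d (phi_row j (coords x)).
Proof.
rewrite /sphere_set /= big_ord_recl mxE eqxx.
have D0 := den_gt0 j x; set D := _ + _ in D0 *.
set y := coords x in D D0 *.
transitivity (((N j y - s j y ^+ 2) ^+ 2 + (2 * s j y) ^+ 2 * \sum_i u j y i ^+ 2) / D ^+ 2).
  rewrite [RHS]mulrDl [in LHS]expr_div_n; congr (_ + _).
  rewrite [in RHS]big_ord_recl u0 expr0n /= add0r mulr_sumr mulr_suml.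
  by apply: eq_bigr => i _; rewrite mxE /= expr_div_n exprMn.
have sN : s j y ^+ 2 * \sum_i u j y i ^+ 2 = s j y ^+ 2 * N j y.
  by rewrite /N mulrDr -[X in _ + X]exprMn s_out expr0n /= addr0.
rewrite exprMn -mulrA sN; apply: (canLR (mulfK _)).
  by rewrite expf_neq0 // gt_eqF.
by rewrite /D; ring.
Qed.

Let phi j (x : geo R V K) : sphere R d :=
  exist (fun b => b \in sphere_set R d) _ (mem_set (phi_sphere j x)).

Let phiE j x : sval (phi j x) = phi_row j (coords x). Proof. by []. Qed.

Let continuous_u j i : continuous (fun x : geo R V K => u j (coords x) i).
Proof. by apply: continuous_subr; exact: continuous_coords. Qed.

Let continuous_s j : continuous (fun x : geo R V K => s j (coords x)).
Proof. by apply: continuous_minface => v; exact: continuous_coords. Qed.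

Let continuous_sqr (X : topologicalType) (f : X -> R) : continuous f ->
  continuous (fun x => f x ^+ 2).
Proof. by move=> cf; apply: continuous_mulr. Qed.

Let continuous_N j : continuous (fun x : geo R V K => N j (coords x)).
Proof.
apply: continuous_addr.
  by apply: continuous_sumr => i _; exact/continuous_sqr/continuous_u.
apply: continuous_sqr.
by apply: continuous_sumr => i _; exact: continuous_coords.
Qed.

Let continuous_phi j : continuous (phi j).
Proof.
apply: continuous_comp_initial.
have h : continuous (fun x : geo R V K => phi_row j (coords x)); last exact: h.
apply: continuous_row => i.
have -> : (fun x : geo R V K => phi_row j (coords x) ord0 i) = fun x =>
  (if i == ord0 then N j (coords x) - s j (coords x) ^+ 2
   else 2 * s j (coords x) * u j (coords x) i) /
   (N j (coords x) + s j (coords x) ^+ 2) by apply/funext => x; rewrite mxE.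
have cs2 := continuous_sqr (@continuous_s j).
apply: continuous_divr; last by move=> x; rewrite gt_eqF.
  case: (i == ord0); first exact: (continuous_subr (@continuous_N j) cs2).
  apply: continuous_mulr; last exact: continuous_u.
  apply: continuous_mulr; [exact: continuous_const|exact: continuous_s].
exact: (continuous_addr (@continuous_N j) cs2).
Qed.

Let phi_base j (x : geo R V K) : s j (coords x) = 0 -> phi j x = sphere_base R d.
Proof.
move=> sx; apply: sphere_eq_base; rewrite phiE mxE eqxx.
have := den_gt0 j x; rewrite sx expr0n /= addr0 subr0 => N0.
by rewrite divff // gt_eqF.
Qed.

Let phi_neq j (x : geo R V K) : 0 < s j (coords x) -> phi j x <> sphere_base R d.
Proof.
move=> sx /(congr1 (fun b : sphere R d => sval b ord0 ord0)).
rewrite phiE !mxE !eqxx /= => h.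
have D0 := den_gt0 j x.
have : N j (coords x) - s j (coords x) ^+ 2 = N j (coords x) + s j (coords x) ^+ 2.
  by rewrite -[LHS](divfK (lt0r_neq0 D0)) h mul1r.
have : 0 < s j (coords x) ^+ 2 by rewrite exprn_gt0.
lra.
Qed.

(** The first coordinate determines N / s^2 and the others then u / s. Since the minimum of the
    coordinates on [F j] is s, this fixes all of them up to scale, and total mass 1 fixes the
    scale. *)
Let phi_inj j (x x' : geo R V K) : 0 < s j (coords x) -> 0 < s j (coords x') ->
  phi j x = phi j x' -> x = x'.
Proof.
move=> sx sx' E0.
have E i : phi_row j (coords x) ord0 i = phi_row j (coords x') ord0 i.
  by rewrite -!phiE E0.
have D0 := den_gt0 j x; have D0' := den_gt0 j x'.
have xF := supp_pos sx; have xF' := supp_pos sx'.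
have [kx skx] := s_attained j x; have [kx' skx'] := s_attained j x'.
have := coords_sum x; have := coords_sum x'.
rewrite !(sum_F j) => sumx' sumx.
have o0 : out j (coords x) = 0.
  by have /eqP := s_out j x; rewrite mulf_eq0 (gt_eqF sx) => /eqP.
have o0' : out j (coords x') = 0.
  by have /eqP := s_out j x'; rewrite mulf_eq0 (gt_eqF sx') => /eqP.
rewrite o0 addr0 in sumx; rewrite o0' addr0 in sumx'.
have le := @s_le j (coords x); have le' := @s_le j (coords x').
set y := coords x in xF E D0 sx skx sumx le *.
set y' := coords x' in xF' E D0' sx' skx' sumx' le' *.
set a := s j y in E D0 sx skx le *; set a' := s j y' in E D0' sx' skx' le' *.
have ratio : N j y * a' ^+ 2 = N j y' * a ^+ 2.
  have := E ord0; rewrite !mxE !eqxx -/a -/a' => /eqP.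
  rewrite (eqr_div _ _ (lt0r_neq0 D0) (lt0r_neq0 D0')) -subr_eq0 => /eqP h.
  by apply/eqP; rewrite -subr_eq0; apply/eqP; lra.
have ratio_u i : u j y i * a' = u j y' i * a.
  have [->|i0] := eqVneq i ord0; first by rewrite !u0 !mul0r.
  have := E i; rewrite !mxE (negbTE i0) -/a -/a' => /eqP.
  rewrite (eqr_div _ _ (lt0r_neq0 D0) (lt0r_neq0 D0')) => /eqP h.
  have : 2 * a * a' * (u j y i * a' - u j y' i * a) * (N j y + a ^+ 2) = 0.
    have e1 : u j y i * a * a' ^+ 2 * (N j y + a ^+ 2) =
       u j y i * a * a ^+ 2 * (N j y' + a' ^+ 2).
      by rewrite -!mulrA; congr (_ * _); congr (_ * _); lra.
    have -> : 2 * a * a' * (u j y i * a' - u j y' i * a) * (N j y + a ^+ 2) =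
      2 * (u j y i * a * a' ^+ 2 * (N j y + a ^+ 2)) -
      a ^+ 2 * (2 * a' * u j y' i * (N j y + a ^+ 2)) by ring.
    by rewrite -h e1; ring.
  move/eqP; rewrite !mulf_eq0 (gt_eqF D0) (gt_eqF sx) (gt_eqF sx') pnatr_eq0 /= orbF.
  by rewrite subr_eq0 => /eqP.
(* It suffices that the coordinates at [e j ord0] correspond; comparing at the two places where the
   minima are attained gives one inequality each way. *)
have same i : y (e j i) * a' = y' (e j i) * a.
  have ui := ratio_u i; have ukx := ratio_u kx; have ukx' := ratio_u kx'.
  rewrite /u -?skx -?skx' in ui ukx ukx'.
  have l1 := le kx'; have l2 := le' kx.
  have m1 : y (e j kx') * a' >= a * a' by rewrite ler_wpM2r // ltW.
  have m2 : y' (e j kx) * a >= a' * a by rewrite ler_wpM2r // ltW.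
  lra.
have aa : a' = a.
  have : (\sum_i y (e j i)) * a' = (\sum_i y' (e j i)) * a.
    by rewrite !mulr_suml; apply: eq_bigr => i _.
  by rewrite sumx sumx' !mul1r.
apply: geo_eq => v; rewrite -/y -/y'.
have [/imsetP[i _ ->]|vF] := boolP (v \in F j).
  by apply: (mulIf (lt0r_neq0 sx)); rewrite -{1}aa.
have := vF; rewrite -{1}xF mem_supp negbK => /eqP ->.
by have := vF; rewrite -{1}xF' mem_supp negbK => /eqP ->.
Qed.

Let phi_onto j b : b <> sphere_base R d ->
  exists2 x : geo R V K, 0 < s j (coords x) & phi j x = b.
Proof.
move=> b1.
have nb : \sum_i sval b ord0 i ^+ 2 = 1 by case: (b) => b' /= /set_mem.
set c := sval b ord0 ord0.
have c1 : c < 1.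
  rewrite lt_def; apply/andP; split.
    by rewrite eq_sym; apply/eqP => /sphere_eq_base.
  have : c ^+ 2 <= 1.
    by rewrite -nb (bigD1 ord0)//= lerDl; apply: sumr_ge0 => i _; exact: sqr_ge0.
  move=> c2; rewrite leNgt; apply/negP => c1.
  by have : 1 < c ^+ 2; [rewrite exprn_egt1|lra].
have C0 : 0 < 1 - c by rewrite subr_gt0.
(* The witness inverts the projection: [w] holds the stereographic coordinates, the shift makes
   their minimum exactly 1, and division by the sum gives total mass 1. Then s = 1 / Z and u = w /
   Z. *)
pose w i := if i == ord0 then 0 else sval b ord0 i / (1 - c).
have w0 : w ord0 = 0 by rewrite /w eqxx.
have [k m_le] : exists k, forall i, w k <= w i.
  by exists [arg min_(i < ord0) w i]%O; case: arg_minP => // i _ h i'; exact: h.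
pose m := w k.
pose z i := w i - m + 1.
have z1 i : 1 <= z i by rewrite /z /m; have := m_le i; lra.
pose Z := \sum_i z i.
have Z0 : 0 < Z.
  rewrite /Z big_ord_recl ltr_pwDl //; first exact: (lt_le_trans ltr01 (z1 _)).
  by apply: sumr_ge0 => i _; exact: (le_trans ler01 (z1 _)).
pose y v := \sum_(i | e j i == v) z i / Z.
have ye i : y (e j i) = z i / Z.
  by rewrite /y (big_pred1 i) // => i'; apply/eqP/eqP => [/e_inj|->].
have yF v : v \notin F j -> y v = 0.
  move=> vF; rewrite /y big_pred0 // => i; apply: contraNF vF => /eqP <-.
  exact: eF.
have ypos i : 0 < y (e j i).
  by rewrite ye divr_gt0 //; exact: (lt_le_trans ltr01 (z1 _)).
have gy : gset K y.
  split.
  - move=> v; apply: sumr_ge0 => i _; rewrite divr_ge0 ?ltW //.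
    exact: (lt_le_trans ltr01 (z1 _)).
  - rewrite (sum_F j) [out j y]big1 ?addr0; last by move=> v /yF.
    under eq_bigr do rewrite ye.
    by rewrite -mulr_suml divff // gt_eqF.
  - rewrite inE; apply/orP; right; apply/existsP; exists j; apply/eqP/setP => v.
    rewrite inE; have [/imsetP[i _ ->]|vF] := boolP (v \in F j).
      by rewrite gt_eqF.
    by rewrite yF ?eqxx.
have sy : s j y = Z^-1.
  apply/eqP; rewrite eq_le; apply/andP; split.
    by rewrite (le_trans (s_le j y k)) // ye /z subrr add0r mul1r.
  apply: le_bigmin.
    rewrite invf_le1 // /Z big_ord_recl (le_trans (z1 ord0)) // lerDl.
    by apply: sumr_ge0 => i _; exact: (le_trans ler01 (z1 _)).
  by move=> v /imsetP[i _ ->]; rewrite ye ler_peMl // invr_ge0 ltW.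
exists (mkgeo gy); first by rewrite /coords /= sy invr_gt0.
have uy i : u j y i = w i / Z.
  by rewrite /u !ye /z w0 -mulrBl; congr (_ / _); ring.
pose W := \sum_i w i ^+ 2.
have Ny : N j y = W / Z ^+ 2.
  rewrite /N [out j y]big1 ?expr0n ?addr0; last by move=> v /yF.
  by rewrite /W mulr_suml; apply: eq_bigr => i _; rewrite uy expr_div_n.
have WC : W * (1 - c) = 1 + c.
  apply: (mulIf (lt0r_neq0 C0)); rewrite -mulrA -expr2.
  rewrite /W big_ord_recl w0 expr0n add0r mulr_suml.
  have := nb; rewrite big_ord_recl -/c => /(canRL (addKr _)) nb'.
  transitivity (\sum_(i < d) sval b ord0 (fintype.lift ord0 i) ^+ 2); last by rewrite nb'; ring.
  by apply: eq_bigr => i _; rewrite /w /= expr_div_n divfK // expf_neq0 // gt_eqF.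
have W1 : (W + 1) * (1 - c) = 2 by rewrite mulrDl WC mul1r; ring.
have W10 : W + 1 != 0.
  by apply: contra_eq_neq W1 => ->; rewrite mul0r eq_sym pnatr_eq0.
apply: val_inj; apply/rowP => i; rewrite /phi /= mxE.
rewrite sy Ny uy; have Zn := lt0r_neq0 Z0.
have [->|i0] := eqVneq i ord0.
  rewrite -/c; have -> : c = (W - 1) / (W + 1).
    by apply: (canRL (mulfK W10)); lra.
  by field; rewrite Zn W10.
have -> : sval b ord0 i = w i * (1 - c).
  by rewrite /w (negbTE i0) divfK // gt_eqF.
have -> : 1 - c = 2 / (W + 1) by apply: (canRL (mulfK W10)); rewrite mulrC.
by field; rewrite Zn W10.
Qed.

Let s_dichotomy (x : geo R V K) :
  (exists j, 0 < s j (coords x) /\ forall i, i != j -> s i (coords x) = 0) \/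
  (forall j, s j (coords x) = 0).
Proof.
case: (pickP (fun j => 0 < s j (coords x))) => [j sj|h]; [left|right=> j].
  by exists j; split=> // i ij; apply: (s_zero _ sj); rewrite eq_sym.
by apply/eqP; have := h j; rewrite lt_def s_ge0 andbT => /negbFE.
Qed.

Let q (x : geo R V K) : Y :=
  if [pick j | 0 < s j (coords x)] is Some j then lift j (phi j x) else y0.

Let qE (x : geo R V K) j : (forall i, i != j -> s i (coords x) = 0) ->
  q x = lift j (phi j x).
Proof.
move=> si; rewrite /q; case: pickP => [i sx|h].
  by have [->//|/si si0] := eqVneq i j; rewrite si0 ltxx in sx.
rewrite phi_base ?lift_base //; apply/eqP.
by have := h j; rewrite lt_def s_ge0 andbT => /negbFE.
Qed.

Let qE0 (x : geo R V K) : (forall j, s j (coords x) = 0) -> q x = y0.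
Proof. by move=> sx; rewrite /q; case: pickP => // i; rewrite sx ltxx. Qed.

(** Inside an open face [q] is locally [lift j] after [phi j]. Elsewhere all these finitely many
    maps take the value [y0], and nearby [q] agrees with one of them or equals [y0]. *)
Let continuous_q : continuous q.
Proof.
move=> x U; have [[j [sj si]]|sx] := s_dichotomy x.
  rewrite (qE si) => Ux.
  have h1 : nbhs x (fun z => U (lift j (phi j z))).
    have cl := continuous_compose (@continuous_phi j) (@cont_lift j).
    exact: (cl x _ Ux).
  have h2 : nbhs x (fun z => 0 < s j (coords z)).
    have op : nbhs (s j (coords x)) (fun t : R => 0 < t).
      by apply: open_nbhs_nbhs; split=> //; exact: open_gt.
    exact: (@continuous_s j x _ op).
  have h : nbhs x (fun z => U (q z)); last exact: h.
  apply: filterS2 h1 h2 => z Uz sz; rewrite (@qE z j) // => i ij.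
  by apply: (s_zero _ sz); rewrite eq_sym.
rewrite (qE0 sx) => Ux.
have h1 : nbhs x (fun z => forall j, U (lift j (phi j z))).
  apply: (@filter_forall _ _ (fun j z => U (lift j (phi j z))) _
    (nbhs_filter x)) => j.
  have cl := continuous_compose (@continuous_phi j) (@cont_lift j).
  by apply: (cl x); rewrite phi_base // lift_base.
have h : nbhs x (fun z => U (q z)); last exact: h.
apply: filterS h1 => z Uz; rewrite /q; case: pickP => // _.
exact: nbhs_singleton Ux.
Qed.

Let apex_sum : \sum_v (v == p)%:R = 1 :> R.
Proof. by rewrite (bigD1 p)//= eqxx big1 ?addr0// => i /negbTE ->. Qed.

Let apex : gset (R := R) K (fun v => (v == p)%:R).
Proof.
split=> [v||].
- exact: ler0n.
- exact: apex_sum.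
- rewrite inE; apply/orP; left; rewrite (_ : (_ :\ p)%SET = finset.set0) //.
  by apply/setP => v; rewrite !inE; case: (v == p); rewrite ?eqxx.
Qed.

Let q_onto y : exists x, q x = y.
Proof.
have qp : exists x, q x = y0.
  exists (mkgeo apex); apply: qE0 => j; apply: minface_eq0.
    by move=> v; exact: coords_ge0.
  apply/fintype.subsetPn; exists (e j ord0); first exact: eF.
  rewrite mem_supp negbK /coords /=; have [ep|//] := eqVneq (e j ord0) p.
  by have := pF j; rewrite -ep eF.
have [->//|[j [b ->]]] := lift_onto y.
have [->|/phi_onto-/(_ j)[x sx <-]] := pselect (b = sphere_base R d).
  by rewrite lift_base.
exists x; apply: qE => i ij; apply: (s_zero _ sx); by rewrite eq_sym.
Qed.

Let q_fiber (x x' : geo R V K) : q x = q x' -> x = x' \/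
  (forall j, s j (coords x) = 0) /\ (forall j, s j (coords x') = 0).
Proof.
have [[j [sj si]]|sx] := s_dichotomy x; have [[j' [sj' si']]|sx'] := s_dichotomy x'.
- rewrite (qE si) (qE si') => /lift_inj[[jj]|[/(phi_neq sj)//]].
  by subst j'; move=> /(phi_inj sj sj'); left.
- rewrite (qE si) (qE0 sx') -(lift_base j) => /lift_inj[[_]|[]] /(phi_neq sj) //.
- rewrite (qE0 sx) (qE si') -(lift_base j') => /lift_inj[[_]|[_]].
    by move/esym/(phi_neq sj').
  by move/(phi_neq sj').
- by right.
Qed.

Let D : R := d.+1%:R.
Let D0 : 0 < D. Proof. by rewrite /D ltr0n. Qed.
Let c j t (x : V -> R) : R := Num.min (s j x) (t / (2 * D)).
Let shrink t (x : V -> R) v : R := x v - \sum_(j | v \in F j) c j t x.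
Let mass t (x : V -> R) : R := 1 - D * \sum_j c j t x.
Let lam t (x : V -> R) : R := Num.max 0 (t - 2 * D * \sum_j s j x).
(* A homotopy, compatible with the fibres of the collapse, from the identity to a
   map constant on the cone: first shrink every [F j] away from its boundary, then
   slide along the straight lines to the apex [p]. *)
Let flow t (x : V -> R) v : R :=
  (1 - lam t x) * (shrink t x v / mass t x) + lam t x * (v == p)%:R.

Let c0 j t x : 0 <= t -> s j x = 0 -> c j t x = 0.
Proof. by move=> t0 sj; rewrite /c sj min_l // divr_ge0 // mulr_ge0 // ltW. Qed.

Let sum_only (j : 'I_r) (f : 'I_r -> R) (P : pred 'I_r) :
  (forall i, i != j -> f i = 0) -> \sum_(i | P i) f i = if P j then f j else 0.
Proof.
move=> fi; case: ifPn => Pj; last first.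
  by rewrite big1 // => i Pi; apply: fi; apply: contraNneq Pj => <-.
by rewrite (bigD1 j)//= big1 ?addr0// => i /andP[_ /fi].
Qed.

Let lam_ge0 t x : 0 <= lam t x.
Proof. by rewrite /lam le_max lexx. Qed.

Let lam_le1 t (x : geo R V K) : 0 <= t <= 1 -> lam t (coords x) <= 1.
Proof.
move=> /andP[t0 t1]; rewrite /lam ge_max ler01 /=.
rewrite lerBlDr (le_trans t1) // lerDl mulr_ge0 //; first by rewrite mulr_ge0 // ltW.
by apply: sumr_ge0 => j _.
Qed.

Let c_sum t (x : geo R V K) : 0 <= t <= 1 ->
  0 <= \sum_j c j t (coords x) <= t / (2 * D).
Proof.
move=> /andP[t0 t1]; have tD : 0 <= t / (2 * D) by rewrite divr_ge0 // mulr_ge0 // ltW.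
have [[j [sj si]]|sx] := s_dichotomy x.
  rewrite (@sum_only j) => [|i ij]; last by rewrite c0 // si.
  by rewrite /c le_min s_ge0 tD /= ge_min lexx orbT.
by rewrite big1 ?lexx // => j _; rewrite c0.
Qed.

Let mass_gt0 t (x : geo R V K) : 0 <= t <= 1 -> 0 < mass t (coords x).
Proof.
move=> t01; have /andP[_ ] := c_sum x t01; move/andP: t01 => [t0 t1].
rewrite ler_pdivlMr ?mulr_gt0 // /mass => h.
by have : D * \sum_j c j t (coords x) < 1; lra.
Qed.

Let shrink_ge0 t (x : geo R V K) v : 0 <= t <= 1 -> 0 <= shrink t (coords x) v.
Proof.
move=> /andP[t0 t1]; rewrite /shrink subr_ge0.
have [[j [sj si]]|sx] := s_dichotomy x; last first.
  by rewrite big1 ?coords_ge0 // => j _; rewrite c0.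
rewrite (@sum_only j) => [|i ij]; last by rewrite c0 // si.
case: ifP => [vF|_]; last exact: coords_ge0.
by rewrite /c ge_min minface_le.
Qed.

Let shrink_sum t (x : geo R V K) :
  \sum_v shrink t (coords x) v = mass t (coords x).
Proof.
rewrite /shrink sumrB coords_sum /mass; congr (_ - _).
rewrite (exchange_big_dep predT) //= mulr_sumr; apply: eq_bigr => j _.
by rewrite sumr_const (card_imset _ (@e_inj j)) card_ord -mulr_natl.
Qed.

Let flow_gset t (x : geo R V K) : 0 <= t <= 1 -> gset K (flow t (coords x)).
Proof.
move=> t01; have m0 := mass_gt0 x t01; have l1 := lam_le1 x t01.
split.
- move=> v; rewrite /flow addr_ge0 // mulr_ge0 ?subr_ge0 ?ler0n //.
  by rewrite divr_ge0 ?shrink_ge0 // ltW.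
- rewrite /flow big_split /= -!mulr_sumr -mulr_suml shrink_sum divff ?gt_eqF //.
  by rewrite apex_sum !mulr1 subrK.
rewrite -/(supp _).
have sub v : v != p -> v \in supp (flow t (coords x)) ->
    shrink t (coords x) v != 0.
  move=> vp; rewrite mem_supp /flow (negbTE vp) mulr0 addr0.
  by apply: contraNneq => ->; rewrite mul0r mulr0.
have [t0 t1] := andP t01.
have [[j [sj si]]|sx] := s_dichotomy x; last first.
  rewrite inE; apply/orP; left; apply: (@dL (supp (coords x) :\ p)).
    have := coords_supp x; rewrite inE => /orP[//|/existsP[j /eqP xj]].
    have : 0 < s j (coords x).
      by rewrite minface_gt0 ?xj // => v; exact: coords_ge0.
    by rewrite sx ltxx.
  apply/fintype.subsetP => v; rewrite !finset.in_setD1 => /andP[vp /(sub _ vp)].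
  rewrite vp mem_supp /shrink big1 ?subr0 // => j _.
  by rewrite c0.
have xF := supp_pos sj.
have shE v : shrink t (coords x) v = coords x v - if v \in F j then c j t (coords x) else 0.
  rewrite /shrink (@sum_only j (fun j => c j t (coords x))) // => i ij.
  by rewrite c0 // si.
have shF v : shrink t (coords x) v != 0 -> v \in F j.
  rewrite shE; apply: contraNT => vF; rewrite (negbTE vF) subr0.
  by move: vF; rewrite -xF mem_supp negbK.
have lamE : lam t (coords x) = Num.max 0 (t - 2 * D * s j (coords x)).
  by rewrite /lam (@sum_only j).
(* Either sliding has not begun and the support stays in [F j], or the smallest coordinate has been
   shrunk to 0 and the support without [p] is a proper subset of [F j]. *)
have [tl|tl] := leP t (2 * D * s j (coords x)).
  have l0 : lam t (coords x) = 0 by rewrite lamE max_l // subr_le0.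
  apply: (@dK (F j)).
    by rewrite inE; apply/orP; right; apply/existsP; exists j.
  apply/fintype.subsetP => v; rewrite mem_supp /flow l0 mul0r addr0 subr0 mul1r => fv.
  by apply: shF; apply: contraNneq fv => ->; rewrite mul0r.
have ce : c j t (coords x) = s j (coords x).
  by rewrite /c min_l // ler_pdivlMr ?mulr_gt0 // mulrC ltW.
have [k sk] := s_attained j x.
rewrite inE; apply/orP; left; apply: (@F_proper j); rewrite properE.
apply/andP; split.
  apply/fintype.subsetP => v; rewrite finset.in_setD1 => /andP[vp /(sub _ vp)].
  exact: shF.
apply/fintype.subsetPn; exists (e j k); first exact: eF.
rewrite finset.in_setD1 negb_and negbK orbC; apply/orP; left.
have ep : e j k != p by apply: contraNneq (pF j) => <-; exact: eF.
apply/negP => /(sub _ ep); rewrite shE eF ce -sk subrr.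
by rewrite eqxx.
Qed.

Let G (t : R) (x : geo R V K) : geo R V K :=
  mkgeo (flow_gset x (introT andP (conj (clamp_ge0 t) (clamp_le1 t)))).

Let GE t x v : coords (G t x) v = flow (clamp t) (coords x) v.
Proof. by []. Qed.

Let continuous_G (X : topologicalType) (f : X -> R) (g : X -> geo R V K) :
  continuous f -> continuous g -> continuous (fun z => G (f z) (g z)).
Proof.
move=> cf cg.
have cc := continuous_compose cf (@continuous_clamp R).
have cx v := continuous_compose cg (@continuous_coords _ _ _ v).
have cs j := continuous_compose cg (@continuous_s j).
have ccj j : continuous (fun z => c j (clamp (f z)) (coords (g z))).
  apply: continuous_minr; first exact: cs.
  by apply: continuous_mulr; [exact: cc|exact: continuous_const].
have cl : continuous (fun z => lam (clamp (f z)) (coords (g z))).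
  apply: continuous_maxr; first exact: continuous_const.
  apply: continuous_subr; first exact: cc.
  apply: continuous_mulr; first exact: continuous_const.
  by apply: continuous_sumr => j _; exact: cs.
apply: continuous_mkgeo => v; apply: continuous_addr.
  apply: continuous_mulr.
    by apply: continuous_subr; [exact: continuous_const|exact: cl].
  apply: continuous_divr.
  - apply: continuous_subr; first exact: cx.
    by apply: continuous_sumr => j _; exact: ccj.
  - apply: continuous_subr; first exact: continuous_const.
    apply: continuous_mulr; first exact: continuous_const.
    by apply: continuous_sumr => j _; exact: ccj.
  - by move=> z; rewrite gt_eqF // mass_gt0 // clamp_ge0 clamp_le1.
by apply: continuous_mulr; [exact: cl|exact: continuous_const].
Qed.

Let G_zero t (x : geo R V K) : (forall j, s j (coords x) = 0) ->
  forall v, coords (G t x) v =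
    (1 - clamp t) * coords x v + clamp t * (v == p)%:R.
Proof.
move=> sx v; rewrite GE /flow /lam big1 // mulr0 subr0 max_r ?clamp_ge0 //.
rewrite /mass /shrink !big1 => [|j _|j _]; rewrite ?c0 ?clamp_ge0 //.
by rewrite mulr0 !subr0 divr1.
Qed.

Let G_zero_s t (x : geo R V K) : (forall j, s j (coords x) = 0) ->
  forall j, s j (coords (G t x)) = 0.
Proof.
move=> sx j; apply: minface_eq0; first by move=> v; exact: coords_ge0.
have : ~~ (F j \subset supp (coords x))%SET.
  rewrite -minface_gt0; first by rewrite -/(s j _) sx ltxx.
  by move=> v; exact: coords_ge0.
apply: contraNN => /fintype.subsetP FG; apply/fintype.subsetP => v vF.
have := FG v vF; rewrite !mem_supp G_zero //.
have vp : v != p by apply: contraTneq vF => ->.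
by rewrite (negbTE vp) mulr0 addr0; apply: contraNneq => ->; rewrite mulr0.
Qed.

Let G0 x : G 0 x = x.
Proof.
apply: geo_eq => v; rewrite GE clamp_id ?lexx ?ler01 //.
have l0 : lam 0 (coords x) = 0.
  rewrite /lam max_l // sub0r oppr_le0 mulr_ge0 ?sumr_ge0 //.
  by rewrite mulr_ge0 // ltW.
have cE j : c j 0 (coords x) = 0 by rewrite /c mul0r min_r.
rewrite /flow l0 mul0r addr0 subr0 mul1r /shrink /mass !big1 //.
by rewrite mulr0 !subr0 divr1.
Qed.

Let qG (x x' : geo R V K) t : q x = q x' -> q (G t x) = q (G t x').
Proof.
move=> /q_fiber[->//|[sx sx']].
by rewrite !qE0 //; exact: G_zero_s.
Qed.

Let G1_fiber (x x' : geo R V K) : q x = q x' -> G 1 x = G 1 x'.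
Proof.
move=> /q_fiber[->//|[sx sx']]; apply: geo_eq => v.
by rewrite !G_zero // clamp_id ?lexx ?ler01 // subrr !mul0r.
Qed.

Lemma cone_collapse : homotopy_equivalent R (geo R V
  [set t : {set V} | (t :\ p \in L) || [exists j, t == F j]]%SET) Y.
Proof.
(* The section need not be continuous: the maps built from it do not depend on the point chosen in a
   fibre of [q], so their continuity is checked upstairs. *)
have [sec secK] := choice q_onto.
(* The time is restricted to a compact interval so that the product with the realization is compact
   and [Q] is a quotient map. *)
pose T : topologicalType := set_type `[(0 : R), 1]%classic.
have cT : compact [set: T] by apply: compact_set_type; exact: segment_compact.
have clT (t : R) : `[0, 1]%classic (clamp t) by rewrite /= in_itv /= clamp_ge0 clamp_le1.
pose clampT (t : R) : T := exist (fun t => t \in `[(0 : R), 1]%classic) _ (mem_set (clT t)).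
have continuous_clampT : continuous clampT.
  apply: continuous_comp_initial.
  have h : continuous (fun t => sval (clampT t)) by exact: continuous_clamp.
  exact: h.
have cval : continuous (fun t : T => sval t : R) by exact: initial_continuous.
pose g y := G 1 (sec y).
have cg : continuous g.
  apply: (quotient_continuous (compact_geo dK) hausY continuous_q q_onto).
  have -> : g \o q = (fun x => G 1 x).
    by apply/funext => x; apply: G1_fiber; rewrite secK.
  by apply: continuous_G; [exact: continuous_const|exact: continuous_ident].
pose h (z : Y * T) := q (G (sval z.2) (sec z.1)).
have ch : continuous h.
  pose Q (z : geo R V K * T) := (q z.1, z.2).
  apply: (@quotient_continuous _ _ _ Q).
  - by rewrite -setXTT; apply: compact_setX => //; exact: compact_geo.
  - apply: hausdorff_pair => //.
    by apply: hausdorff_set_type; exact: Rhausdorff.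
  - apply: continuous_pairing; last exact: continuous_snd.
    exact: continuous_compose (@continuous_fst _ _) continuous_q.
  - by move=> [y t]; have [x qx] := q_onto y; exists (x, t); rewrite /Q /= qx.
  - have -> : h \o Q = (fun z => q (G (sval z.2) z.1)).
      by apply/funext => z; apply: qG; rewrite secK.
    apply: continuous_compose continuous_q.
    apply: continuous_G; last exact: continuous_fst.
    exact: continuous_compose (@continuous_snd _ _) cval.
exists q, g; split=> //.
- apply: (@homotopic_intro _ _ _ _ _ (fun z => G (1 - z.2) z.1)).
  + apply: continuous_G; last exact: continuous_fst.
    by apply: continuous_subr; [exact: continuous_const|exact: continuous_snd].
  + by move=> x /=; rewrite subr0; apply: G1_fiber; rewrite secK.
  + by move=> x /=; rewrite subrr G0.
- apply: (@homotopic_intro _ _ _ _ _ (fun z => h (z.1, clampT (1 - z.2)))).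
  + apply: continuous_compose ch; apply: continuous_pairing.
      exact: continuous_fst.
    apply: continuous_compose continuous_clampT.
    by apply: continuous_subr; [exact: continuous_const|exact: continuous_snd].
  + move=> y; rewrite /h /= /g; apply: congr1; apply: geo_eq => v.
    by rewrite !GE subr0 clamp_id // clamp_ge0 clamp_le1.
  + move=> y; rewrite /h /= -[RHS]secK; apply: congr1; apply: geo_eq => v.
    rewrite -[in RHS](G0 (sec y)) !GE subrr; congr (flow _ _ _).
    by rewrite clamp_id // clamp_ge0 clamp_le1.
Qed.

End ConeCollapse.

(** * From combinatorial constructions to wedges of spheres *)

Section Bouquets.
Variable R : realType.

(* [Y] is a Hausdorff wedge of [r] copies of the [d]-sphere, in a form covering
   both [sphere R d] and [wedge_spheres R r d]. *)
Definition bouquet (r d : nat) (Y : topologicalType) :=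
  exists (lift : 'I_r -> sphere R d -> Y) (y0 : Y),
  [/\ forall j, continuous (lift j), forall j, lift j (sphere_base R d) = y0,
      forall y, y = y0 \/ exists j b, y = lift j b,
      forall i j a b, lift i a = lift j b ->
        (i = j /\ a = b) \/ (a = sphere_base R d /\ b = sphere_base R d) &
      hausdorff_space Y].

Lemma hausdorff_sphere d : hausdorff_space (sphere R d).
Proof. by apply: hausdorff_set_type; exact: norm_hausdorff. Qed.

Lemma bouquet_sphere d : bouquet 1 d (sphere R d).
Proof.
exists (fun _ => id), (sphere_base R d); split=> //.
- by move=> _; exact: continuous_ident.
- by move=> y; right; exists ord0, y.
- by move=> i j a b ->; left; rewrite !ord1.
- exact: hausdorff_sphere.
Qed.

Lemma bouquet_wedge r d : bouquet r.+1 d (wedge_spheres R r.+1 d).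
Proof.
pose p0 := fun _ : 'I_r.+1 => sphere_base R d.
exists (fun j => @wedge_lift _ _ p0 j), (@wedge_lift _ _ p0 ord0 (p0 ord0)); split.
- by move=> j; exact: (@wedge_lift_continuous _ _ p0 j).
- by move=> j; exact: (@wedge_liftE _ _ p0 ord0 (p0 ord0) j (p0 j)).
- move=> y; right; have : [set: wedge p0] y by [].
  by rewrite -wedgeTE => -[j _ [b _ <-]]; exists j, b.
- move=> i j a b /eqmodP/predU1P[E|/andP[/eqP /= -> /eqP /= ->]]; last by right.
  left; have ij : i = j := existT_inj1 E.
  by subst j; split=> //; exact: existT_inj2 E.
- by apply: wedge_hausdorff => j; exact: hausdorff_sphere.
Qed.

Section Complexes.
Variable V : finType.
Implicit Types (K L : {set {set V}}) (p : V).

(** The empty face is present from the start, so the smaller face of every later pair is nonempty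
    and the pair is a genuine deformation. *)
Lemma geo_attach c K1 r K2 : down_closed K1 -> finset.set0 \in K1 ->
  attach c K1 r K2 -> r = 0%N -> homotopy_equivalent R (geo R V K1) (geo R V K2).
Proof.
move=> dK1 K10; elim=> // [_|r1 K s v K1K IH vs sK fK r0].
  exact: homotopy_equivalent_refl.
apply: (homotopy_equivalent_trans (IH r0)).
apply: elementary_expansion => //; first exact: attach_down_closed K1K.
by apply: contraNneq sK => ->; exact: (fintype.subsetP (attach_sub K1K)).
Qed.

Lemma geo_cone_step p K1 K2 : finset.set0 \in K1 -> cone_step p K1 K2 ->
  homotopy_equivalent R (geo R V K1) (geo R V K2).
Proof.
move=> K10 st; have [dK1 _ _ _] := st.
exact: (geo_attach dK1 K10 (cone_step_attach 0 st)).
Qed.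

Lemma geo_bouquet d r K p Y : bouquet r d Y -> (0 < r)%N ->
  attach d.+1 finset.set0 r K -> (forall t, t \in K -> p \notin t) ->
  homotopy_equivalent R (geo R V K) Y.
Proof.
move=> [lift [y0 [Y1 Y2 Y3 Y4 Y5]]] r0 attK pK.
have [L [F [attL cF hF attLF]]] := attach_reorder attK.
have dL : down_closed L := attach_down_closed (@down_closed0 V) attL.
have LFK := fintype.subsetP (attach_sub attLF).
have pL t : t \in L -> p \notin t by move=> tL; apply: pK; rewrite LFK // inE tL.
have pF t : t \in F -> p \notin t by move=> tL; apply: pK; rewrite LFK // inE tL orbT.
have [F0 F0F] : exists t, t \in F by apply/set0Pn; rewrite -card_gt0 cF.
(* Some cell exists, and the empty face lies in its boundary since it has [d.+1] elements. *)
have L0 : finset.set0 \in L.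
  have [cF0 _] := hF _ F0F; apply; rewrite properE finset.sub0set /=.
  by rewrite finset.subset0 -cards_eq0 cF0.
have dLF : down_closed (L :|: F)%SET.
  move=> s t; rewrite !inE => /orP[sL|sF] ts; first by rewrite (dL _ _ sL ts).
  have [->|tns] := eqVneq t s; first by rewrite sF orbT.
  by have [_ _ /(_ t)] := hF s sF; rewrite finset.properEneq tns ts => /(_ isT) ->.
have LF0 : finset.set0 \in (L :|: F)%SET by rewrite inE L0.
apply: (homotopy_equivalent_trans (homotopy_equivalent_sym
  (geo_attach dLF LF0 attLF erefl))).
(* [L] has no cells, so its cone consists of expansions over the complex with its cells; even the
   pair of the empty face now has the nonempty smaller face {p}. *)
have attC := attach_join (M := (L :|: F)%SET) (p := p) attL (finset.subsetUl _ _).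
have pLF t : t \in (L :|: F)%SET -> p \notin t.
  by rewrite inE => /orP[/pL|/pF].
apply: (homotopy_equivalent_trans (geo_attach dLF LF0 (attC pLF) erefl)).
pose Fe (j : 'I_r) : {set V} := enum_val (cast_ord (esym cF) j).
have FeF j : Fe j \in F by exact: enum_valP.
have cFe j : #|Fe j| = d.+1 by have [] := hF _ (FeF j).
pose e (j : 'I_r) (i : 'I_d.+1) : V := enum_val (cast_ord (esym (cFe j)) i).
have e_inj j : injective (e j).
  by move=> i i' /enum_val_inj /cast_ord_inj.
have eE j : [set e j i | i : 'I_d.+1]%SET = Fe j.
  apply/eqP; rewrite eqEcard card_imset ?cFe ?card_ord ?leqnn ?andbT //.
  by apply/fintype.subsetP => v /imsetP[i _ ->]; exact: enum_valP.
have -> : ((L :|: F) :|: join1 p L = [set t : {set V} | (t :\ p \in L) ||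
     [exists j, t == [set e j i | i : 'I_d.+1]]])%SET.
  apply/setP => t; rewrite inE [RHS]inE [t \in L :|: F]inE -orbA.
  have -> : [exists j, t == [set e j i | i : 'I_d.+1]%SET] = (t \in F).
    apply/existsP/idP => [[j /eqP ->]|tF]; first by rewrite eE.
    exists (cast_ord cF (enum_rank_in tF t)); rewrite eE /Fe cast_ordK.
    by rewrite enum_rankK_in.
  rewrite orbCA orbC; congr (_ || _).
  apply/orP/idP => [[tL|/imsetP[s sL ->]]|tL].
  - by apply: dL tL _; exact: subsetDl.
  - by rewrite setU1K // pL.
  - have [pt|pt] := boolP (p \in t).
      by right; apply/imsetP; exists (t :\ p)%SET; rewrite ?finset.setD1K.
    by left; rewrite -(setD1_id pt).
apply: (@cone_collapse _ _ _ _ _ _ e _ _ _ _ _ _ _ _ lift y0) => //.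
- move=> i j /=; rewrite !eE => /enum_val_inj /cast_ord_inj; exact.
- by move=> j; rewrite eE; exact: pF.
- by move=> j; rewrite eE; have [] := hF _ (FeF j).
- by move=> j t; rewrite eE; have [_ _] := hF _ (FeF j); apply.
Qed.

Lemma sph_geo (A : {set V}) d r K p Y : bouquet r.+1 d Y -> p \notin A ->
  sph A d.+1 r.+1 K -> homotopy_equivalent R (geo R V K) Y.
Proof.
move=> bY pA; elim=> [{}K KA attK|q K1 K2 _ K10 st _ IH|q K1 K2 _ K10 st _ IH].
- apply: (geo_bouquet (p := p) bY) => // t /(fintype.subsetP KA).
  by rewrite inE => /fintype.subsetP tA; apply: contra pA; exact: tA.
- exact: homotopy_equivalent_trans (homotopy_equivalent_sym (geo_cone_step K10 st)) IH.
- exact: homotopy_equivalent_trans (geo_cone_step K10 st) IH.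
Qed.

End Complexes.

End Bouquets.

(** * Application to the Möbius ladder *)

Section MobiusComplexes.
Variables (R : realType) (n : nat).
Hypothesis n2 : (1 < n)%N.

Lemma independence_complex_geo : homotopy_equivalent R
  (realization R (independence_complex (mobius_ladder n)))
  (geo R ('I_n.+4 * bool)%type (indep (rungs n.+4 n) (lad n true))).
Proof.
rewrite -(independence_faces n2); apply: homotopy_equivalent_sym.
apply: (@geo_imset R _ _ (@rung_position n) [set: 'I_(2 * n)]%SET) => [v w _ _|s _].
  exact: rung_position_inj.
exact: finset.subsetT.
Qed.

Lemma independence_complex_bouquet d r Y : bouquet R r.+1 d Y ->
  sph (rungs n.+4 n) d.+1 r.+1 (indep (rungs n.+4 n) (lad n true)) ->
  homotopy_equivalent R (realization R (independence_complex (mobius_ladder n))) Y.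
Proof.
move=> bY sK; apply: homotopy_equivalent_trans independence_complex_geo _.
apply: (sph_geo (p := (inord n, true)) bY _ sK).
by rewrite inE /= inordK ?ltnn //; lia.
Qed.

(** The bound [hi] is [3 * n] for even [n] and [3 * n + 2] for odd [n], where two labels already
    serve as cone apexes; the label [hi] is still free. *)
Lemma perfect_matching_complex_bouquet d r hi Y : bouquet R r.+1 d Y -> (hi <= 3 * n + 2)%N ->
  sph (labels n 0 hi) d.+1 r.+1 (dimer_complex n) ->
  homotopy_equivalent R (realization R (perfect_matching_complex (mobius_ladder n))) Y.
Proof.
move=> bY hi_n sK; apply: (@homotopy_equivalent_trans _ (geo R (label n) (dimer_complex n))).
  rewrite /realization (perfect_matching_faces n2).
  apply: (@geo_imset R _ _ (@edge_of n) (labels n 0 (3 * n))) => [|s].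
    exact: edge_of_inj.
  by move=> /(dimer_complexP n2)[T [sT TL _]]; exact: fintype.subset_trans sT TL.
apply: (sph_geo (p := inord hi) bY _ sK).
by rewrite inE /= inordK ?ltnn //; lia.
Qed.

End MobiusComplexes.

Theorem theorem1 (R : realType) (n : nat) (hn : (2 <= n)%N) :
  (forall k : nat,
    ((n = 4 * k)%N ->
       homotopy_equivalent R
         (realization R (independence_complex (mobius_ladder n)))
         (sphere R (2 * k - 1)%N)) /\
    ((n = 4 * k + 2)%N ->
       homotopy_equivalent R
         (realization R (independence_complex (mobius_ladder n)))
         (wedge_spheres R 3 (2 * k)%N)) /\
    ((n = 4 * k + 1)%N \/ (n = 4 * k + 3)%N ->
       homotopy_equivalent R
         (realization R (independence_complex (mobius_ladder n)))
         (sphere R (2 * k)%N))) /\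
  (forall k : nat, (n = 2 * k)%N ->
     homotopy_equivalent R
       (realization R (perfect_matching_complex (mobius_ladder n)))
       (wedge_spheres R 2 (k - 1)%N)) /\
  (odd n -> forall k : nat,
    ((n = 3 * (2 * k + 1))%N ->
       homotopy_equivalent R
         (realization R (perfect_matching_complex (mobius_ladder n)))
         (wedge_spheres R 4 (2 * k + 1)%N)) /\
    ((n = 3 * (2 * k + 1) + 2)%N \/ (n = 3 * (2 * k + 1) + 4)%N ->
       homotopy_equivalent R
         (realization R (perfect_matching_complex (mobius_ladder n)))
         (wedge_spheres R 2 (2 * k + 2)%N))).
Proof.
have n_le : (n <= n.+4)%N by lia.
have ladder k := @twisted_ladder_sph n.+4 n k isT n_le.
have sphereP d := independence_complex_bouquet hn (bouquet_sphere R d).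
have wedgeP r d := independence_complex_bouquet hn (bouquet_wedge R r d).
split=> [k|]; first split=> [n4k|].
(* The value [k = 0] contradicts [2 <= n], so the subtraction in [2 * k - 1] is not truncated. *)
- case: k n4k => [|k] n4k; first lia.
  have [/(_ n4k) sK _ _ _] := ladder k.
  by rewrite (_ : (2 * k.+1 - 1 = (2 * k).+1)%N); [exact: sphereP|lia].
- split=> [n4k|]; first by have [_ /(_ n4k) sK _ _] := ladder k; exact: wedgeP.
  case=> n4k; last by have [_ _ _ /(_ n4k) sK] := ladder k; exact: sphereP.
  case: k n4k => [|k] n4k; first lia.
  by have [_ _ /(_ n4k) sK _] := ladder k; exact: sphereP.
split=> [k n2k|on k].
  case: k n2k => [|k] n2k; first lia.
  rewrite subSS subn0.
  apply: perfect_matching_complex_bouquet (bouquet_wedge R 1 k) _ (dimer_complex_even hn n2k) => //.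
  lia.
have dimerP r c := dimer_complex_odd (c := c) (r := r) hn on.
split=> [nk|nk].
  apply: perfect_matching_complex_bouquet (bouquet_wedge R 3 _) (leqnn _) _ => //.
  by apply: (dimerP 2); lia.
apply: perfect_matching_complex_bouquet (bouquet_wedge R 1 _) (leqnn _) _ => //.
(* Both residues give [c = 2 * k + 2], because 3 (2 k + 1) + 4 = 3 (2 k + 2) + 1. *)
by apply: (dimerP 1); lia.
Qed.
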